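(* A Schur-class function $S\in{\mathcal S}_d({\mathcal U},{\mathcal Y})$ admits a contractive commutative realization if and only if there exist a Hilbert space ${\mathcal F}$ and $\widetilde S$ such that $\widehat S(\lambda)=\begin{bmatrix}S(\lambda)&\widetilde S(\lambda)\end{bmatrix}\in{\mathcal S}_d({\mathcal U}\oplus{\mathcal F},{\mathcal Y})$, the de Branges–Rovnyak space ${\mathcal H}(K_{\widehat S})$ is ${\mathbf M}_\lambda^*$-invariant, and $\sum_{j=1}^d\|M_{\lambda_j}^*f\|^2_{{\mathcal H}(K_{\widehat S})}\le\|f\|^2_{{\mathcal H}(K_{\widehat S})}-\|f(0)\|^2_{\mathcal Y}$ for every $f\in{\mathcal H}(K_{\widehat S})$.
   Context: Let ${\mathbb B}^d=\{\lambda\in{\mathbb C}^d:\langle\lambda,\lambda\rangle<1\}$. ${\mathcal H}_{\mathcal Y}(k_d)$ is the reproducing kernel Hilbert space of ${\mathcal Y}$-valued functions on ${\mathbb B}^d$ with kernel $k_d(\lambda,\zeta)I_{\mathcal Y}$, $k_d(\lambda,\zeta)=1/(1-\langle\lambda,\zeta\rangle)$. ${\mathcal S}_d({\mathcal U},{\mathcal Y})$ is the set of ${\mathcal L}({\mathcal U},{\mathcal Y})$-valued holomorphic $S$ on ${\mathbb B}^d$ such that $M_S:f\mapsto Sf$ is a contraction from ${\mathcal H}_{\mathcal U}(k_d)$ into ${\mathcal H}_{\mathcal Y}(k_d)$. For such $S$, ${\mathcal H}(K_S)$ is the reproducing kernel Hilbert space of $K_S(\lambda,\zeta)=\frac{I-S(\lambda)S(\zeta)^*}{1-\langle\lambda,\zeta\rangle}$.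 $M_{\lambda_j}^*$ is the adjoint in ${\mathcal H}_{\mathcal Y}(k_d)$ of multiplication by $\lambda_j$; ${\mathbf M}_\lambda^*$-invariant means invariant under all $M_{\lambda_j}^*$. A realization of $S$: Hilbert space ${\mathcal X}$, $A_j\in{\mathcal L}({\mathcal X})$, $B_j\in{\mathcal L}({\mathcal U},{\mathcal X})$, $C\in{\mathcal L}({\mathcal X},{\mathcal Y})$, $D\in{\mathcal L}({\mathcal U},{\mathcal Y})$ with $S(\lambda)=D+C(I-Z(\lambda)A)^{-1}Z(\lambda)B$, where $A=\mathrm{col}(A_j)$, $B=\mathrm{col}(B_j)$, $Z(\lambda)=[\lambda_1I\ \cdots\ \lambda_dI]$; it is contractive if ${\mathbf U}=\begin{bmatrix}A&B\\C&D\end{bmatrix}:{\mathcal X}\oplus{\mathcal U}\to{\mathcal X}^d\oplus{\mathcal Y}$ is a contraction and commutative if the $A_j$ pairwise commute. *)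

(* Defs.v *)
From HB Require Import structures.
From mathcomp Require Import all_boot all_order all_algebra.
From mathcomp Require Import complex.
From mathcomp Require Import classical_sets reals.
From Stdlib Require Import ClassicalEpsilon.

Set Implicit Arguments.
Unset Strict Implicit.
Unset Printing Implicit Defensive.

Import Order.TTheory GRing.Theory Num.Theory.
Local Open Scope ring_scope.
Local Open Scope complex_scope.

Section Defs.
Variable R : realType.
Local Notation C := R[i].

Record hilb := Hilb {
  hcar :> lmodType C;
  hip : hcar -> hcar -> C;
  hip_linl : forall (a : C) (x y z : hcar), hip (a *: x + y) z = a * hip x z + hip y z;
  hip_sym : forall x y : hcar, hip y x = (hip x y)^*;
  hip_pos : forall x : hcar, 0 <= hip x x;
  hip_def : forall x : hcar, hip x x = 0 -> x = 0;
  hip_complete : forall u : nat -> hcar,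
    (forall e : R, 0 < e -> exists N : nat, forall m n : nat, (N <= m)%N -> (N <= n)%N ->
        complex.Re (hip (u m - u n) (u m - u n)) < e) ->
    exists l : hcar, forall e : R, 0 < e -> exists N : nat, forall n : nat, (N <= n)%N ->
        complex.Re (hip (u n - l) (u n - l)) < e }.

Definition nsq (V : lmodType C) (ip : V -> V -> C) (x : V) : R := complex.Re (ip x x).

Definition ipsum (V W : lmodType C) (ipV : V -> V -> C) (ipW : W -> W -> C)
  (p q : V * W) : C := ipV p.1 q.1 + ipW p.2 q.2.

Definition bop (V W : lmodType C) (ipV : V -> V -> C) (ipW : W -> W -> C) (T : V -> W) :=
  (forall (a : C) (x y : V), T (a *: x + y) = a *: T x + T y) /\
  exists M : R, forall x : V, nsq ipW (T x) <= M * nsq ipV x.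

Definition adj (V W : lmodType C) (ipV : V -> V -> C) (ipW : W -> W -> C) (T : V -> W)
  (w : W) : V :=
  epsilon (inhabits (0 : V)) (fun v => forall x : V, ipW (T x) w = ipV x v).

Variable d : nat.
Definition pt := 'I_d -> C.
Definition dotC (l z : pt) : C := \sum_(j < d) l j * (z j)^*.
Definition inball (l : pt) : Prop := complex.Re (dotC l l) < 1.
Definition pt0 : pt := fun _ => 0.
Definition ptsub (l z : pt) : pt := fun j => l j - z j.
Definition kd (l z : pt) : C := (1 - dotC l z)^-1.

(** * Reproducing kernel Hilbert spaces of Y-valued functions on B^d.
   For an L(Y)-valued kernel K, f lies in H(K) with ||f||^2 <= c iff the
   kernel c K(l,z) - f(l) f(z)^*  is positive, i.e. for all finite families
   (l_i, y_i) of points of the ball and vectors of Y,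
   |sum_i <f(l_i), y_i>|^2 <= c sum_{i,k} <K(l_i,l_k) y_k, y_i>. *)
Section RKHS.
Variables (Y : lmodType C) (ipY : Y -> Y -> C) (K : pt -> pt -> Y -> Y).

Definition rk_bound (f : pt -> Y) (c : R) : Prop :=
  0 <= c /\
  forall (n : nat) (ls : 'I_n -> pt) (ys : 'I_n -> Y), (forall i, inball (ls i)) ->
    `|\sum_(i < n) ipY (f (ls i)) (ys i)| ^+ 2
      <= c%:C * \sum_(i < n) \sum_(k < n) ipY (K (ls i) (ls k) (ys k)) (ys i).

Definition in_rk (f : pt -> Y) : Prop := exists c : R, rk_bound f c.

(** squared norm in H(K) (meaningful for f in H(K)) *)
Definition rk_nsq (f : pt -> Y) : R := inf [set c | rk_bound f c].

(** inner product in H(K), by polarization *)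
Definition rk_ip (f g : pt -> Y) : C :=
  4%:R^-1 * \sum_(k < 4) 'i ^+ k * (rk_nsq (fun l => f l + 'i ^+ k *: g l))%:C.
End RKHS.

Definition kdI (Y : lmodType C) (l z : pt) (y : Y) : Y := kd l z *: y.

Section Schur.
Variables (U Y : lmodType C) (ipU : U -> U -> C) (ipY : Y -> Y -> C).

(** holomorphy on B^d of an L(U,Y)-valued function (Frechet, operator norm) *)
Definition holo (S : pt -> U -> Y) : Prop :=
  forall l0 : pt, inball l0 -> exists L : 'I_d -> U -> Y,
    (forall j, bop ipU ipY (L j)) /\
    forall e : R, 0 < e -> exists delta : R, 0 < delta /\
      forall l : pt, inball l -> complex.Re (dotC (ptsub l l0) (ptsub l l0)) < delta ->
      forall u : U,
        nsq ipY (S l u - S l0 u - \sum_(j < d) (l j - l0 j) *: L j u)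
          <= e * complex.Re (dotC (ptsub l l0) (ptsub l l0)) * nsq ipU u.

Definition mult_contr (S : pt -> U -> Y) : Prop :=
  forall f : pt -> U, in_rk ipU (@kdI U) f ->
    in_rk ipY (@kdI Y) (fun l => S l (f l)) /\
    rk_nsq ipY (@kdI Y) (fun l => S l (f l)) <= rk_nsq ipU (@kdI U) f.

Definition schur (S : pt -> U -> Y) : Prop :=
  (forall l, inball l -> bop ipU ipY (S l)) /\ holo S /\ mult_contr S.

Definition KS (S : pt -> U -> Y) (l z : pt) (y : Y) : Y :=
  kd l z *: (y - S l (adj ipU ipY (S z) y)).
End Schur.

Section Shift.
Variables (Y : lmodType C) (ipY : Y -> Y -> C).

Definition is_Mstar (j : 'I_d) (f g : pt -> Y) : Prop :=
  in_rk ipY (@kdI Y) g /\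
  forall h : pt -> Y, in_rk ipY (@kdI Y) h ->
    rk_ip ipY (@kdI Y) (fun l => l j *: h l) f = rk_ip ipY (@kdI Y) h g.

Definition Mstar (j : 'I_d) (f : pt -> Y) : pt -> Y :=
  epsilon (inhabits (fun _ => 0 : Y)) (is_Mstar j f).
End Shift.

Definition has_ccr (U Y : hilb) (S : pt -> U -> Y) : Prop :=
  exists (X : hilb) (A : 'I_d -> X -> X) (B : 'I_d -> U -> X) (Cc : X -> Y) (D : U -> Y),
    (forall j, bop (@hip X) (@hip X) (A j)) /\
    (forall j, bop (@hip U) (@hip X) (B j)) /\
    bop (@hip X) (@hip Y) Cc /\ bop (@hip U) (@hip Y) D /\
    (* contractivity of [A B; C D] : X (+) U -> X^d (+) Y *)
    (forall (x : X) (u : U),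
       \sum_(j < d) nsq (@hip X) (A j x + B j u) + nsq (@hip Y) (Cc x + D u)
         <= nsq (@hip X) x + nsq (@hip U) u) /\
    (forall i j (x : X), A i (A j x) = A j (A i x)) /\
    (* S(l) = D + C (I - Z(l)A)^{-1} Z(l) B *)
    (forall l : pt, inball l ->
       injective (fun x : X => x - \sum_(j < d) l j *: A j x) /\
       forall u : U, exists x : X,
         x - \sum_(j < d) l j *: A j x = \sum_(j < d) l j *: B j u /\
         S l u = D u + Cc x).

End Defs.

Arguments pt0 {R d} _.

(* Main.v *)
From HB Require Import structures.
Require Import Defs.
From mathcomp Require Import all_boot all_order all_algebra.
From mathcomp Require Import complex.
From mathcomp Require Import boolp classical_sets functions reals.
From mathcomp Require Import ring lra.
From Stdlib Require Import ClassicalEpsilon.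

Set Implicit Arguments.
Unset Strict Implicit.
Unset Printing Implicit Defensive.

Import Order.TTheory GRing.Theory Num.Theory.
Local Open Scope ring_scope.
Local Open Scope complex_scope.

(** Given a contractive commutative realization with colligation [V = [A B; C D]], factor
    [1 - V V^* = T T^*] through a Hilbert space [F] and append [T] to the input: the extended
    colligation is coisometric with the same commuting [A], so [K_Sh(l, z) = G(l) G(z)^*] with
    [G(l) = C (1 - Z(l) A)^-1].  Hence [H(K_Sh)] is the range of [x |-> G x] with the quotient norm.
    Commutativity gives [M_j^* G x = G A_j x], and the inequality is [A^* A + C^* C <= 1].

    Conversely take [X = H(K_Sh)], [A_j = M_j^*], [C = ] evaluation at [0].  The Gleason identity
    [f(z) - f(0) = sum_j z_j (M_j^* f)(z)] says that [[A; C]^*] maps [(conj z_j K_z y, y)] to [K_z y],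
    and the kernel identity makes [(conj z_j K_z y, y) |-> Sh(z)^* y] isometric for the defect form
    of [[A; C]^*].  Extending this map contractively yields the adjoint of [[B; D]]; restricting
    the inputs to [U] gives a realization of [S]. *)

(** The norm of [H(K)] is given only as an infimum of bounds and its inner product only by
    polarization, so [H(K)] has yet to be made a Hilbert space: [rk_boundE] turns the infimum into a
    supremum over finite families, the parallelogram law is read off there, and Jordan-von Neumann
    supplies the inner product.

    Operators prescribed on spanning vectors (adjoints, contractive extensions, the lift of [f] to a
    state) all come from [rel_adjoint], stated for a bounded linear relation: the bound already
    makes it single valued, so well-definedness is never checked. The defect operator [T] is
    obtained from a kernel on a one-point ball, not from a spectral square root.

    The delicate step is [M_j^* G x = G A_j x]. Functions are known by their values on the ball,
    without power series; the identity is recast as invariance of an unobservable subspace under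
    commuting operators and proved with difference quotients of resolvents. *)

Section ComplexNumbers.
Variable R : realType.
Local Notation C := R[i].
Implicit Types (a b : C).

(** Real-valued squared modulus: norm estimates stay in the ordered field [R], where [lra] and [nra]
    apply. *)
Definition csq (a : C) : R := complex.Re a ^+ 2 + complex.Im a ^+ 2.

Lemma csq_ge0 a : 0 <= csq a.
Proof. by rewrite addr_ge0 // sqr_ge0. Qed.

Lemma csqE a : `|a| ^+ 2 = (csq a)%:C.
Proof. by rewrite -add_Re2_Im2. Qed.

Lemma csqM a b : csq (a * b) = csq a * csq b.
Proof. by case: a => a1 a2; case: b => b1 b2; rewrite /csq /=; ring. Qed.

Lemma csq_conj a : csq a^*%C = csq a.
Proof. by case: a => a1 a2; rewrite /csq /= sqrrN. Qed.

Lemma csqN a : csq (- a) = csq a.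
Proof. by case: a => a1 a2; rewrite /csq /= !sqrrN. Qed.

Lemma csq_real (r : R) : csq r%:C = r ^+ 2.
Proof. by rewrite /csq /= expr0n addr0. Qed.

Lemma csqi : csq 'i%C = 1 :> R.
Proof. by rewrite /csq /= expr0n expr1n add0r. Qed.

Lemma csq_Re a : complex.Re a ^+ 2 <= csq a.
Proof. by rewrite lerDl sqr_ge0. Qed.

Lemma mul_conjC a : a * a^*%C = (csq a)%:C.
Proof. by case: a => x y; apply/eqP; rewrite eq_complex /= /csq /=; apply/andP; split; apply/eqP; ring. Qed.

Lemma ReD a b : complex.Re (a + b) = complex.Re a + complex.Re b.
Proof. by case: a; case: b. Qed.

Lemma ReN a : complex.Re (- a) = - complex.Re a.
Proof. by case: a. Qed.

Lemma ReB a b : complex.Re (a - b) = complex.Re a - complex.Re b.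
Proof. by case: a; case: b. Qed.

Lemma Re_conjc a : complex.Re a^*%C = complex.Re a.
Proof. by case: a. Qed.

Lemma Re_realM (r : R) a : complex.Re (r%:C * a) = r * complex.Re a.
Proof. by case: a => x y /=; rewrite mul0r subr0. Qed.

Lemma Re_iM a : complex.Re ('i%C * a) = - complex.Im a.
Proof. by case: a => x y /=; rewrite mul0r mul1r sub0r. Qed.

Lemma Re_sum (I : Type) (r : seq I) (P : pred I) (F : I -> C) :
  complex.Re (\sum_(i <- r | P i) F i) = \sum_(i <- r | P i) complex.Re (F i).
Proof. by apply: (big_morph (@complex.Re R)) => // x y; rewrite ReD. Qed.

Lemma conj_sum (I : Type) (r : seq I) (P : pred I) (F : I -> C) :
  (\sum_(i <- r | P i) F i)^*%C = \sum_(i <- r | P i) (F i)^*%C.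
Proof. exact: (raddf_sum (@conjc R)). Qed.

Lemma conjK a : (a^*%C)^*%C = a.
Proof. by case: a => x y /=; rewrite opprK. Qed.

Lemma conjM a b : (a * b)^*%C = a^*%C * b^*%C.
Proof. exact: (rmorphM (@conjc R)). Qed.

Lemma conjD a b : (a + b)^*%C = a^*%C + b^*%C.
Proof. exact: (raddfD (@conjc R)). Qed.

Lemma conjB a b : (a - b)^*%C = a^*%C - b^*%C.
Proof. exact: (raddfB (@conjc R)). Qed.

Lemma complex_eqP a b :
  complex.Re a = complex.Re b -> complex.Im a = complex.Im b -> a = b.
Proof. by case: a; case: b => /= ? ? ? ? -> ->. Qed.

Lemma complex_eq_Re a b :
  complex.Re a = complex.Re b -> complex.Re ('i%C * a) = complex.Re ('i%C * b) -> a = b.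
Proof. by move=> h; rewrite !Re_iM => /oppr_inj; apply: complex_eqP. Qed.

End ComplexNumbers.

Section RealLemmas.
Variable R : realType.
Implicit Types a b c t : R.

(** Phrased with [t ^+ 2], so that a Cauchy-Schwarz bound can be fed in without square roots. *)
Lemma amgm a b t : 0 <= a -> 0 <= b -> t ^+ 2 <= a * b -> 2 * t <= a + b.
Proof.
move=> a0 b0 h; have [t0|/ltW t0] := leP t 0; first by lra.
rewrite -(@ler_pXn2r _ 2) ?nnegrE ?addr_ge0 ?mulr_ge0 //.
have := sqr_ge0 (a - b); nra.
Qed.

(** Evaluation at the minimizer [- b / c] gives the bound; for [c = 0] the polynomial is affine and
    would reach [-1] unless [b = 0]. *)
Lemma quadratic_disc a b c :
  0 <= c -> (forall t, 0 <= a + 2 * t * b + t ^+ 2 * c) -> b ^+ 2 <= a * c.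
Proof.
move=> c0 h; have [c1|] := ltP 0 c.
  have := h (- b / c); have cn : c != 0 by rewrite gt_eqF.
  have -> : a + 2 * (- b / c) * b + (- b / c) ^+ 2 * c = (a * c - b ^+ 2) / c by field.
  by rewrite pmulr_lge0 ?invr_gt0 // subr_ge0.
move=> c1; have c2 : c = 0 by apply/eqP; rewrite eq_le c1 c0.
have [->|bn] := eqVneq b 0; first by rewrite c2 expr0n mulr0.
have := h (- (a + 1) / (2 * b)); rewrite c2 mulr0 addr0.
have -> : a + 2 * (- (a + 1) / (2 * b)) * b = -1 by field.
by rewrite lerNr oppr0 ler10.
Qed.

Lemma ler_eps a b : (forall e, 0 < e -> a <= b + e) -> a <= b.
Proof. by move=> h; apply/ler_addgt0Pr => e e0; apply: h. Qed.

(** The sign of [c] is left free, so an error constant can be passed along without a proof that it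
    is nonnegative. *)
Lemma ler_eps_mul a b c : (forall e, 0 < e -> a <= b + e * c) -> a <= b.
Proof.
move=> h; apply: ler_eps => e e0.
have [c1|c1] := leP c 0.
  apply: (le_trans (h 1 ltr01)); rewrite lerD2l mul1r; exact: (le_trans c1 (ltW e0)).
have := h (e / c) (divr_gt0 e0 c1); by rewrite divfK // gt_eqF.
Qed.

End RealLemmas.

(** * Inner product calculus in a Hilbert space *)

Section HilbertSpace.
Variable R : realType.
Local Notation C := R[i].
Variable H : hilb R.
Implicit Types (x y z : H) (a : C).
Local Notation ip := (@hip R H).
Local Notation ns := (nsq ip).

Lemma hipDl x y z : ip (x + y) z = ip x z + ip y z.
Proof. by have := hip_linl 1 x y z; rewrite scale1r mul1r. Qed.

Lemma hip0l x : ip 0 x = 0.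
Proof. by apply: (addrI (ip 0 x)); rewrite -hipDl !addr0. Qed.

Lemma hipZl a x z : ip (a *: x) z = a * ip x z.
Proof. by have := hip_linl a x 0 z; rewrite !addr0 hip0l addr0. Qed.

Lemma hipNl x z : ip (- x) z = - ip x z.
Proof. by rewrite -scaleN1r hipZl mulN1r. Qed.

Lemma hipBl x y z : ip (x - y) z = ip x z - ip y z.
Proof. by rewrite hipDl hipNl. Qed.

Lemma hipDr x y z : ip z (x + y) = ip z x + ip z y.
Proof. by rewrite [LHS]hip_sym hipDl conjD !(hip_sym z) !conjK. Qed.

Lemma hip0r x : ip x 0 = 0.
Proof. by rewrite hip_sym hip0l conjc0. Qed.

Lemma hipZr a x z : ip z (a *: x) = a^*%C * ip z x.
Proof. by rewrite [LHS]hip_sym hipZl conjM (hip_sym z) conjK. Qed.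

Lemma hipNr x z : ip z (- x) = - ip z x.
Proof. by apply: (addrI (ip z x)); rewrite -hipDr !subrr hip0r. Qed.

Lemma hipBr x y z : ip z (x - y) = ip z x - ip z y.
Proof. by rewrite hipDr hipNr. Qed.

Lemma hip_suml (I : Type) (r : seq I) (P : pred I) (F : I -> H) z :
  ip (\sum_(i <- r | P i) F i) z = \sum_(i <- r | P i) ip (F i) z.
Proof. by apply: (big_morph (fun x => ip x z)) => [x y|]; rewrite ?hipDl ?hip0l. Qed.

Lemma hip_sumr (I : Type) (r : seq I) (P : pred I) (F : I -> H) z :
  ip z (\sum_(i <- r | P i) F i) = \sum_(i <- r | P i) ip z (F i).
Proof. by apply: (big_morph (ip z)) => [x y|]; rewrite ?hipDr ?hip0r. Qed.

(** The underlying real inner product; [hip_eq_rip] recovers the complex one by also testing on the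
    multiple by ['i]. *)
Definition rip x y : R := complex.Re (ip x y).

Lemma ripC x y : rip x y = rip y x.
Proof. by rewrite /rip hip_sym Re_conjc. Qed.

Lemma ripDl x y z : rip (x + y) z = rip x z + rip y z.
Proof. by rewrite /rip hipDl ReD. Qed.

Lemma ripBl x y z : rip (x - y) z = rip x z - rip y z.
Proof. by rewrite /rip hipBl ReB. Qed.

Lemma ripDr x y z : rip z (x + y) = rip z x + rip z y.
Proof. by rewrite /rip hipDr ReD. Qed.

Lemma ripBr x y z : rip z (x - y) = rip z x - rip z y.
Proof. by rewrite /rip hipBr ReB. Qed.

Lemma ripZl (r : R) x y : rip (r%:C *: x) y = r * rip x y.
Proof. by rewrite /rip hipZl Re_realM. Qed.

Lemma nsq_ge0 x : 0 <= ns x.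
Proof. by have := hip_pos x; rewrite lecE => /andP[_]. Qed.

Lemma hipxx x : ip x x = (ns x)%:C.
Proof.
by apply: complex_eqP => //=; apply: ger0_Im; apply: hip_pos.
Qed.

Lemma nsq_rip x : ns x = rip x x. Proof. by []. Qed.

Lemma nsq0 : ns 0 = 0.
Proof. by rewrite /nsq hip0l. Qed.

Lemma nsq_eq0 x : ns x = 0 -> x = 0.
Proof. by move=> h; apply: hip_def; rewrite hipxx h. Qed.

Lemma nsq_le0 x : ns x <= 0 -> x = 0.
Proof. by move=> h; apply: nsq_eq0; apply/eqP; rewrite eq_le h nsq_ge0. Qed.

Lemma nsqD x y : ns (x + y) = ns x + ns y + 2 * rip x y.
Proof. by rewrite !nsq_rip !ripDl !ripDr (ripC y x); lra. Qed.

Lemma nsqB x y : ns (x - y) = ns x + ns y - 2 * rip x y.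
Proof. by rewrite !nsq_rip !ripBl !ripBr (ripC y x); lra. Qed.

Lemma nsqZ a x : ns (a *: x) = csq a * ns x.
Proof.
by rewrite /nsq hipZl hipZr mulrA mul_conjC Re_realM.
Qed.

Lemma nsqN x : ns (- x) = ns x.
Proof. by rewrite -scaleN1r nsqZ csqN csq_real expr1n mul1r. Qed.

Lemma rip_CS x y : rip x y ^+ 2 <= ns x * ns y.
Proof.
apply: quadratic_disc => [|t]; first exact: nsq_ge0.
have := nsq_ge0 (x + t%:C *: y); rewrite nsqD nsqZ csq_real (ripC x) ripZl (ripC y).
by rewrite [2 * t * _]mulrAC -!mulrA (mulrC (rip x y)) addrAC.
Qed.

Lemma nsqD_le2 x y : ns (x + y) <= 2 * ns x + 2 * ns y.
Proof. by have := nsq_ge0 (x - y); rewrite nsqB nsqD; lra. Qed.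

Lemma nsqB_le2 x y : ns (x - y) <= 2 * ns x + 2 * ns y.
Proof. by have := nsq_ge0 (x + y); rewrite nsqB nsqD; lra. Qed.

(** The weights [t^-1] and [t] have product 1, so Cauchy-Schwarz still bounds the cross term. The
    free [t] lets one coefficient come as close to 1 as an absorption argument needs. *)
Lemma nsqD_young (t : R) x y : 0 < t ->
  ns (x + y) <= (1 + t^-1) * ns x + (1 + t) * ns y.
Proof.
move=> t0; rewrite nsqD.
have tn : t != 0 by rewrite gt_eqF.
have := @amgm R (t^-1 * ns x) (t * ns y) (rip x y).
rewrite !mulr_ge0 ?nsq_ge0 ?invr_ge0 ?(ltW t0) //.
have -> : t^-1 * ns x * (t * ns y) = ns x * ns y by field.
by move=> /(_ isT isT (rip_CS x y)); lra.
Qed.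

Lemma nsq_eq_hip x y : (forall z, ip z x = ip z y) -> x = y.
Proof.
move=> h; apply/eqP; rewrite -subr_eq0; apply/eqP; apply: hip_def.
by rewrite hipBr h subrr.
Qed.

End HilbertSpace.

Lemma hip_eq_rip (R : realType) (H H' : hilb R) (x y : H) (x' y' : H') :
  rip x y = rip x' y' -> rip ('i%C *: x) y = rip ('i%C *: x') y' -> hip x y = hip x' y'.
Proof. by rewrite /rip !hipZl; apply: complex_eq_Re. Qed.

(* Proves linear identities in a Hilbert space by pairing with a test vector. *)
Ltac hilb_ring := apply: nsq_eq_hip => ?;
  rewrite ?(hipDr, hipBr, hipNr, hipZr, hip0r, conjD, conjM, conjB); ring.

Section Linear.
Variable R : realType.
Local Notation C := R[i].

Definition lin (V W : lmodType C) (T : V -> W) :=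
  forall (a : C) (x y : V), T (a *: x + y) = a *: T x + T y.

Variables (V W : lmodType C) (T : V -> W).
Hypothesis linT : lin T.

Lemma linD x y : T (x + y) = T x + T y.
Proof. by have := linT 1 x y; rewrite !scale1r. Qed.

Lemma lin0 : T 0 = 0.
Proof. by apply: (addrI (T 0)); rewrite -linD !addr0. Qed.

Lemma linZ a x : T (a *: x) = a *: T x.
Proof. by have := linT a x 0; rewrite lin0 !addr0. Qed.

Lemma linN x : T (- x) = - T x.
Proof. by rewrite -scaleN1r linZ scaleN1r. Qed.

Lemma linB x y : T (x - y) = T x - T y.
Proof. by rewrite linD linN. Qed.

Lemma lin_sum (I : Type) (r : seq I) (P : pred I) (F : I -> V) :
  T (\sum_(i <- r | P i) F i) = \sum_(i <- r | P i) T (F i).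
Proof. by apply: (big_morph T) => [x y|]; rewrite ?linD ?lin0. Qed.

End Linear.

(** * Adjoints of bounded linear relations and of bounded operators *)

Section RelationAdjoint.
Variable R : realType.
Local Notation C := R[i].
Variables (H H' : hilb R) (Gr : H -> H' -> Prop) (M : R).
Hypothesis M0 : 0 <= M.
Hypothesis Gr0 : Gr 0 0.
Hypothesis GrL : forall (a : C) v w v' w', Gr v w -> Gr v' w' -> Gr (a *: v + v') (a *: w + w').
Hypothesis GrM : forall v w, Gr v w -> nsq (@hip R H') w <= M * nsq (@hip R H) v.
Local Notation ns := (nsq (@hip R H)).
Local Notation ns' := (nsq (@hip R H')).

Let GrD v w v' w' : Gr v w -> Gr v' w' -> Gr (v + v') (w + w').
Proof. by move=> h h'; have := GrL 1 h h'; rewrite !scale1r. Qed.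

Let GrZ a v w : Gr v w -> Gr (a *: v) (a *: w).
Proof. by move=> h; have := GrL a h Gr0; rewrite !addr0. Qed.

(* [h] is the limit of a minimizing sequence of [|v|^2 - 2 Re <w, u>] over [Gr]. *)
Lemma rel_riesz (u : H') : exists h : H,
  [/\ forall v w, Gr v w -> hip v h = hip w u,
      forall e : R, 0 < e -> exists v w, Gr v w /\ ns (v - h) < e
    & ns h <= M * ns' u].
Proof.
pose J v w := ns v - 2 * rip w u.
pose S : set R := [set r | exists v w, Gr v w /\ r = J v w]%classic.
have Jlb v w : Gr v w -> - (M * ns' u) <= J v w.
  move=> g; rewrite /J.
  have := @amgm R (ns v) (M * ns' u) (rip w u).
  rewrite nsq_ge0 mulr_ge0 ?nsq_ge0 // => /(_ isT isT) h.
  have : rip w u ^+ 2 <= ns v * (M * ns' u).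
    apply: (le_trans (rip_CS _ _)); rewrite mulrCA mulrA.
    by apply: ler_wpM2r; rewrite ?nsq_ge0 ?GrM.
  by move/h; lra.
have Sinf : has_inf S.
  split; first by exists (J 0 0), 0, 0.
  by exists (- (M * ns' u)) => _ [v [w [g ->]]]; apply: Jlb.
pose m := inf S.
have mle v w : Gr v w -> m <= J v w.
  by move=> g; apply: ge_inf; [exact: (proj2 Sinf) | exists v, w].
have mlb : - (M * ns' u) <= m.
  by apply: lb_le_inf; [exact: (proj1 Sinf) | move=> _ [v [w [g ->]]]; apply: Jlb].
have mad (e : R) : 0 < e -> exists p : H * H', Gr p.1 p.2 /\ J p.1 p.2 < m + e.
  move=> e0; have [_ [v [w [g ->]]] lt] := inf_adherent e0 Sinf.
  by exists (v, w).
(* The midpoint of two pairs is again in [Gr], so its [J] is at least [m]; the parallelogram law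
   then forces near-minimizers to be close. *)
have key v w v' w' : Gr v w -> Gr v' w' ->
    ns (v - v') <= 2 * (J v w - m) + 2 * (J v' w' - m).
  move=> g g'; have := mle _ _ (GrZ (2^-1)%:C (GrD g g')).
  rewrite /J nsqZ csq_real ripZl ripDl nsqB nsqD; lra.
have mad' (n : nat) : exists p : H * H', Gr p.1 p.2 /\ J p.1 p.2 < m + n.+1%:R^-1.
  by apply: mad; rewrite invr_gt0 ltr0n.
have {mad'} [p hp] := boolp.choice mad'.
have inve (e : R) : 0 < e -> exists N : nat, forall n, (N <= n)%N -> n.+1%:R^-1 < e.
  move=> e0; exists (Num.truncn e^-1) => n Nn.
  rewrite invf_plt ?posrE ?ltr0n //.
  apply: (lt_le_trans (truncnS_gt _)); by rewrite ler_nat ltnS.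
have [h hh] : exists l : H, forall e : R, 0 < e -> exists N : nat, forall n : nat, (N <= n)%N ->
        complex.Re (hip ((p n).1 - l) ((p n).1 - l)) < e.
  apply: (@hip_complete R H (fun n => (p n).1)) => e e0.
  have [N hN] := inve (e / 4) ltac:(lra).
  exists N => i j Ni Nj; rewrite -[X in X < e]/(ns _).
  have := key _ _ _ _ (hp i).1 (hp j).1.
  have := (hp i).2; have := (hp j).2; have := hN _ Ni; have := hN _ Nj.
  move: (j.+1%:R^-1 : R) (i.+1%:R^-1 : R) (J (p j).1 (p j).2) (J (p i).1 (p i).2) (ns _).
  by move=> *; lra.
have app (e : R) : 0 < e -> exists v w, [/\ Gr v w, ns (v - h) < e & J v w < m + e].
  move=> e0; have [N hN] := inve e e0; have [N' hN'] := hh e e0.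
  exists (p (N + N')%N).1, (p (N + N')%N).2; split; first exact: (hp _).1.
    by apply: hN'; rewrite leq_addl.
  by apply: (lt_trans (hp _).2); rewrite ltrD2l hN // leq_addr.
have ripE v0 w0 : Gr v0 w0 -> rip v0 h = rip w0 u.
  move=> g0; apply/eqP; rewrite -subr_eq0 -sqrf_eq0 eq_le sqr_ge0 andbT.
  apply: (@ler_eps_mul _ _ _ (4 * ns v0)) => e e0; rewrite add0r.
  have [v [w [g vh Jm]]] := app e e0.
  (* Along [t |-> v + t v0] the value of [J] stays above [m] while [J v w < m + e]: a nonnegative
     quadratic in [t] whose discriminant bounds the first variation. *)
  have d1 : (rip v v0 - rip w0 u) ^+ 2 <= e * ns v0.
    apply: quadratic_disc; first exact: nsq_ge0.
    move=> t; have := mle _ _ (GrD g (GrZ t%:C g0)).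
    rewrite /J nsqD nsqZ csq_real ripDl ripZl (ripC v) ripZl (ripC v0).
    by move: Jm; rewrite /J; lra.
  have d2 : rip (v - h) v0 ^+ 2 <= e * ns v0.
    by apply: (le_trans (rip_CS _ _)); apply: ler_wpM2r; rewrite ?nsq_ge0 // ltW.
  move: d1 d2; rewrite ripBl (ripC v0 h).
  move: (rip v v0) (rip h v0) (rip w0 u) => x y z d1 d2.
  have := sqr_ge0 ((x - z) + (x - y)); nra.
exists h; split.
- move=> v w g; apply: hip_eq_rip; first exact: ripE.
  by apply: ripE; apply: GrZ.
- by move=> e e0; have [v [w [g ? _]]] := app e e0; exists v, w.
(* Since [rip w u = rip v h], [J v w] equals [|v - h|^2 - |h|^2]; hence [|h|^2 <= e - m], and [mlb]
   bounds [- m]. *)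
- apply: ler_eps => e e0; have [v [w [g vh _]]] := app e e0.
  have := mle _ _ g; rewrite /J -(ripE _ _ g).
  by move: vh mlb; rewrite nsqB; lra.
Qed.

(** The density clause of [rel_riesz] is what makes the chosen [h] depend linearly on [u]: the
    linearity defect [k] is orthogonal to the domain of [Gr] and also lies in its closure, so it
    vanishes. *)
Lemma rel_adjoint : exists T : H' -> H,
  [/\ lin T, forall v w u, Gr v w -> hip v (T u) = hip w u
   & forall u, ns (T u) <= M * ns' u].
Proof.
have [T hT] := boolp.choice rel_riesz; exists T; split; last first.
- by move=> u; have [] := hT u.
- by move=> v w u; have [h _ _] := hT u; apply: h.
move=> a x y; apply/eqP; rewrite -subr_eq0; apply/eqP.
set k := _ - _; apply: nsq_le0.
apply: (@ler_eps_mul _ _ _ (4 + 4 * (1 + csq a))) => e e0; rewrite add0r.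
have [h1 /(_ e e0) [v1 [w1 [g1 c1]]] _] := hT (a *: x + y).
have [h2 /(_ e e0) [v2 [w2 [g2 c2]]] _] := hT x.
have [h3 /(_ e e0) [v3 [w3 [g3 c3]]] _] := hT y.
have kort v w : Gr v w -> hip v k = 0.
  by move=> g; rewrite /k hipBr hipDr hipZr (h1 _ _ g) (h2 _ _ g) (h3 _ _ g) hipDr hipZr subrr.
have g := GrL (-1) (GrL a g2 g3) g1.
have : ns k <= ns ((-1 *: (a *: v2 + v3) + v1) - k).
  by rewrite (nsqB _ k) /rip (kort _ _ g) mulr0 subr0 lerDr nsq_ge0.
move=> /le_trans; apply.
have -> : -1 *: (a *: v2 + v3) + v1 - k =
    (v1 - T (a *: x + y)) - (a *: (v2 - T x) + (v3 - T y)).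
  by rewrite /k; hilb_ring.
apply: (le_trans (nsqB_le2 _ _)).
have := nsqD_le2 (a *: (v2 - T x)) (v3 - T y); rewrite nsqZ.
have : csq a * ns (v2 - T x) <= csq a * e by apply: ler_wpM2l; rewrite ?csq_ge0 // ltW.
by move: c1 c3; lra.
Qed.

End RelationAdjoint.

Section Adjoint.
Variable R : realType.
Local Notation C := R[i].

Lemma bop_ge0 (V W : hilb R) (T : V -> W) : bop (@hip R V) (@hip R W) T ->
  exists2 M, 0 <= M & forall x, nsq (@hip R W) (T x) <= M * nsq (@hip R V) x.
Proof.
move=> [_ [M hM]]; exists `|M| => [|x]; first exact: normr_ge0.
by apply: (le_trans (hM x)); apply: ler_wpM2r; rewrite ?nsq_ge0 ?ler_norm.
Qed.

(** [Ts] is fixed before [M], so the bound for an arbitrary admissible [M] is derived afterwards,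
    from [|Ts w|^2 = <T (Ts w), w>] and Cauchy-Schwarz. *)
Lemma adj_ex (V W : hilb R) (T : V -> W) : bop (@hip R V) (@hip R W) T ->
  exists Ts : W -> V, [/\ lin Ts, forall x w, hip (T x) w = hip x (Ts w) &
   forall M, 0 <= M -> (forall x, nsq (@hip R W) (T x) <= M * nsq (@hip R V) x) ->
     forall w, nsq (@hip R V) (Ts w) <= M * nsq (@hip R W) w].
Proof.
move=> bT; have [M0 M00 hM0] := bop_ge0 bT; have linT : lin T by case: bT.
pose Gr (v : V) (w : W) := w = T v.
have [Ts [l a _]] : exists Ts : W -> V,
  [/\ lin Ts, forall v w u, Gr v w -> hip v (Ts u) = hip w u
   & forall u, nsq (@hip R V) (Ts u) <= M0 * nsq (@hip R W) u].
  apply: rel_adjoint => //; rewrite /Gr.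
  - by rewrite (lin0 linT).
  - by move=> c v _ v' _ -> ->; rewrite linT.
  - by move=> v _ ->.
have a' x w : hip (T x) w = hip x (Ts w) by rewrite (a x (T x)).
exists Ts; split => // M M0' hM w.
have [z|z] := eqVneq (nsq (@hip R V) (Ts w)) 0; first by rewrite z mulr_ge0 // nsq_ge0.
have p : 0 < nsq (@hip R V) (Ts w) by rewrite lt_def z nsq_ge0.
rewrite -(ler_pM2l p).
have := rip_CS (T (Ts w)) w; rewrite {1}/rip a' -/(nsq _ _) -expr2 => /le_trans; apply.
by rewrite [X in _ <= X]mulrA; apply: ler_wpM2r; rewrite ?nsq_ge0 // mulrC hM.
Qed.

Lemma adjP (V W : hilb R) (T : V -> W) : bop (@hip R V) (@hip R W) T ->
  forall x w, hip (T x) w = hip x (adj (@hip R V) (@hip R W) T w).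
Proof.
move=> /adj_ex[Ts [_ h _]] x w; rewrite /adj.
by apply: (epsilon_spec (inhabits (0 : V)) (fun v => forall x, hip (T x) w = hip x v)); exists (Ts w).
Qed.

Lemma adj_uniq (V W : hilb R) (T : V -> W) (w : W) (v : V) :
  bop (@hip R V) (@hip R W) T -> (forall x, hip (T x) w = hip x v) ->
  adj (@hip R V) (@hip R W) T w = v.
Proof. by move=> b h; apply: nsq_eq_hip => x; rewrite -adjP. Qed.

Lemma adj_lin (V W : hilb R) (T : V -> W) : bop (@hip R V) (@hip R W) T ->
  lin (adj (@hip R V) (@hip R W) T).
Proof.
move=> b a x y; apply: nsq_eq_hip => z.
by rewrite -adjP // !(hipDr, hipZr) -!adjP.
Qed.

Lemma adj_bound (V W : hilb R) (T : V -> W) (M : R) : bop (@hip R V) (@hip R W) T -> 0 <= M ->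
  (forall x, nsq (@hip R W) (T x) <= M * nsq (@hip R V) x) ->
  forall w, nsq (@hip R V) (adj (@hip R V) (@hip R W) T w) <= M * nsq (@hip R W) w.
Proof.
move=> b M0 hM w; have [Ts [_ h /(_ M M0 hM w)]] := adj_ex b.
by rewrite (adj_uniq b (v := Ts w)).
Qed.

End Adjoint.

(** * Orthogonal sums and finite powers of Hilbert spaces *)

Section ProductSpace.
Variable R : realType.
Local Notation C := R[i].
Variables U F : hilb R.
Local Notation ip := (ipsum (@hip R U) (@hip R F)).

Let ps_lin (a : C) (x y z : (U * F)%type) : ip (a *: x + y) z = a * ip x z + ip y z.
Proof. by rewrite /ipsum /= !hipDl !hipZl; ring. Qed.

Let ps_sym (x y : (U * F)%type) : ip y x = conjc (ip x y).
Proof. by rewrite /ipsum conjD -!hip_sym. Qed.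

Let ps_pos (x : (U * F)%type) : 0 <= ip x x.
Proof. by rewrite addr_ge0 // hip_pos. Qed.

Let ps_def (x : (U * F)%type) : ip x x = 0 -> x = 0.
Proof.
move/eqP; rewrite /ipsum paddr_eq0 ?hip_pos // => /andP[/eqP h1 /eqP h2].
by case: x h1 h2 => x1 x2 /= /hip_def -> /hip_def ->.
Qed.

Lemma nsq_pair (x : (U * F)%type) : nsq ip x = nsq (@hip R U) x.1 + nsq (@hip R F) x.2.
Proof. by rewrite /nsq ReD. Qed.

Let ps_complete (u : nat -> (U * F)%type) :
    (forall e : R, 0 < e -> exists N : nat, forall m n : nat, (N <= m)%N -> (N <= n)%N ->
        complex.Re (ip (u m - u n) (u m - u n)) < e) ->
    exists l, forall e : R, 0 < e -> exists N : nat, forall n : nat, (N <= n)%N ->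
        complex.Re (ip (u n - l) (u n - l)) < e.
Proof.
move=> h.
have [l1 h1] : exists l : U, forall e : R, 0 < e -> exists N : nat, forall n : nat, (N <= n)%N ->
        complex.Re (hip ((u n).1 - l) ((u n).1 - l)) < e.
  apply: (@hip_complete R U (fun n => (u n).1)) => e /h[N hN]; exists N => m n Nm Nn.
  apply: le_lt_trans (hN m n Nm Nn); rewrite -[X in _ <= X]/(nsq ip _) nsq_pair.
  by rewrite lerDl nsq_ge0.
have [l2 h2] : exists l : F, forall e : R, 0 < e -> exists N : nat, forall n : nat, (N <= n)%N ->
        complex.Re (hip ((u n).2 - l) ((u n).2 - l)) < e.
  apply: (@hip_complete R F (fun n => (u n).2)) => e /h[N hN]; exists N => m n Nm Nn.
  apply: le_lt_trans (hN m n Nm Nn); rewrite -[X in _ <= X]/(nsq ip _) nsq_pair.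
  by rewrite lerDr nsq_ge0.
exists (l1, l2) => e e0.
have [N1 hN1] := h1 (e / 2) ltac:(lra); have [N2 hN2] := h2 (e / 2) ltac:(lra).
exists (N1 + N2)%N => n Nn; rewrite -[X in X < _]/(nsq ip _) nsq_pair /=.
have := hN1 n (leq_trans (leq_addr _ _) Nn); have := hN2 n (leq_trans (leq_addl _ _) Nn).
by rewrite /nsq; lra.
Qed.

Definition hprod : hilb R := Hilb ps_lin ps_sym ps_pos ps_def ps_complete.

End ProductSpace.

Section PowerSpace.
Variable R : realType.
Local Notation C := R[i].
Variables (d : nat) (X : hilb R).
Local Notation pw := {ffun 'I_d -> X}.

Definition pw_ip (f g : pw) : C := \sum_(j < d) hip (f j) (g j).

Let pw_lin (a : C) (x y z : pw) : pw_ip (a *: x + y) z = a * pw_ip x z + pw_ip y z.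
Proof.
rewrite /pw_ip mulr_sumr -big_split /=; apply: eq_bigr => j _.
by rewrite !ffunE hipDl hipZl.
Qed.

Let pw_sym (x y : pw) : pw_ip y x = conjc (pw_ip x y).
Proof. by rewrite /pw_ip conj_sum; apply: eq_bigr => j _; rewrite -hip_sym. Qed.

Let pw_pos (x : pw) : 0 <= pw_ip x x.
Proof. by apply: sumr_ge0 => j _; apply: hip_pos. Qed.

Let pw_def (x : pw) : pw_ip x x = 0 -> x = 0.
Proof.
move=> h; apply/ffunP => j; rewrite ffunE; apply: hip_def.
by apply: (@psumr_eq0P _ _ predT (fun j => hip (x j) (x j))) => // i _; apply: hip_pos.
Qed.

Lemma nsq_pw (x : pw) : nsq pw_ip x = \sum_(j < d) nsq (@hip R X) (x j).
Proof. by rewrite /nsq Re_sum. Qed.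

Lemma nsq_pw_ge (x : pw) j : nsq (@hip R X) (x j) <= nsq pw_ip x.
Proof. by rewrite nsq_pw (bigD1 j) //= lerDl sumr_ge0 // => i _; apply: nsq_ge0. Qed.

Let pw_complete (u : nat -> pw) :
    (forall e : R, 0 < e -> exists N : nat, forall m n : nat, (N <= m)%N -> (N <= n)%N ->
        complex.Re (pw_ip (u m - u n) (u m - u n)) < e) ->
    exists l, forall e : R, 0 < e -> exists N : nat, forall n : nat, (N <= n)%N ->
        complex.Re (pw_ip (u n - l) (u n - l)) < e.
Proof.
move=> h.
have hl j : exists l : X, forall e : R, 0 < e -> exists N : nat,
     forall n : nat, (N <= n)%N -> nsq (@hip R X) (u n j - l) < e.
  apply: (@hip_complete R X (fun n => u n j)).
  move=> e /h[N hN]; exists N => m n Nm Nn.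
  apply: le_lt_trans (hN m n Nm Nn).
  by have := nsq_pw_ge (u m - u n) j; rewrite !ffunE.
have {hl} [l hl] := boolp.choice hl.
exists [ffun j => l j] => e e0.
(* Dividing by [d.+1] instead of [d] covers [d = 0] and leaves the total strictly below [e]. *)
have e1 : 0 < e / d.+1%:R by rewrite divr_gt0 // ltr0n.
have [N hN] := boolp.choice (fun j => hl j _ e1).
exists (\max_j N j) => n Nn; rewrite -[X in X < _]/(nsq pw_ip _) nsq_pw.
apply: (@le_lt_trans _ _ (\sum_(j < d) e / d.+1%:R)).
  apply: ler_sum => j _; rewrite !ffunE ltW // hN //.
  exact: leq_trans (leq_bigmax j) Nn.
rewrite sumr_const card_ord -[X in X < _]mulr_natr mulrAC ltr_pdivrMr ?ltr0n //.
by rewrite ltr_pM2l // ltr_nat.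
Qed.

Definition hpow : hilb R := Hilb pw_lin pw_sym pw_pos pw_def pw_complete.

(** Cauchy-Schwarz in [X^d] between [w] and the column [conj (l_j) x], where [x] is the sum itself;
    one factor [|x|^2] then cancels. *)
Lemma nsq_row (l : 'I_d -> C) (w : 'I_d -> X) :
  nsq (@hip R X) (\sum_(j < d) l j *: w j) <=
  (\sum_(j < d) csq (l j)) * \sum_(j < d) nsq (@hip R X) (w j).
Proof.
set x := \sum_(j < d) _.
have [z|z] := eqVneq (nsq (@hip R X) x) 0.
  by rewrite z mulr_ge0 // sumr_ge0 // => j _; rewrite ?csq_ge0 ?nsq_ge0.
have p : 0 < nsq (@hip R X) x by rewrite lt_def z nsq_ge0.
pose a : hpow := [ffun j => w j]; pose b : hpow := [ffun j => conjc (l j) *: x].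
have E : hip a b = hip x x.
  rewrite /x hip_suml; apply: eq_bigr => j _.
  by rewrite !ffunE hipZr conjK -hipZl.
have := rip_CS a b; rewrite /rip E -/(nsq _ x).
have -> : nsq (@hip R hpow) b = (\sum_(j < d) csq (l j)) * nsq (@hip R X) x.
  rewrite nsq_pw mulr_suml; apply: eq_bigr => j _.
  by rewrite ffunE nsqZ csq_conj.
have -> : nsq (@hip R hpow) a = \sum_(j < d) nsq (@hip R X) (w j).
  by rewrite nsq_pw; apply: eq_bigr => j _; rewrite ffunE.
by rewrite mulrA expr2 ler_pM2r // mulrC.
Qed.

End PowerSpace.

(** * Geometry of the ball and resolvents of a row contraction *)

Section Points.
Variables (R : realType) (d : nat).
Local Notation C := R[i].

Definition psq (l : pt R d) : R := \sum_(j < d) csq (l j).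

Lemma psqE l : complex.Re (dotC l l) = psq l.
Proof.
rewrite /dotC Re_sum; apply: eq_bigr => j _.
by rewrite -[X in complex.Re X]/(l j * conjc (l j)) mul_conjC.
Qed.

Lemma inballE l : inball l <-> psq l < 1.
Proof. by rewrite /inball psqE. Qed.

Lemma psq_ge0 l : 0 <= psq l.
Proof. by apply: sumr_ge0 => j _; apply: csq_ge0. Qed.

Lemma psq0 : psq pt0 = 0.
Proof. by apply: big1 => j _; rewrite /csq expr0n addr0. Qed.

Lemma inball0 : inball (pt0 : pt R d).
Proof. by apply/inballE; rewrite psq0 ltr01. Qed.

Lemma csqD_young (t : R) (a b : C) : 0 < t ->
  csq (a + b) <= (1 + t) * csq a + (1 + t^-1) * csq b.
Proof.
move=> t0; case: a => a1 a2; case: b => b1 b2; rewrite /csq /=.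
have tn : t != 0 by rewrite gt_eqF.
have h (x y : R) : (x + y) ^+ 2 <= (1 + t) * x ^+ 2 + (1 + t^-1) * y ^+ 2.
  have -> : (1 + t) * x ^+ 2 + (1 + t^-1) * y ^+ 2 =
     (x + y) ^+ 2 + t * (x - t^-1 * y) ^+ 2 by field.
  by rewrite lerDl mulr_ge0 ?sqr_ge0 // ltW.
have := h a1 b1; have := h a2 b2; lra.
Qed.

Lemma psqD_young (t : R) (l z : pt R d) : 0 < t ->
  psq (fun j => l j + z j) <= (1 + t) * psq l + (1 + t^-1) * psq z.
Proof.
move=> t0; rewrite /psq !mulr_sumr -big_split /=; apply: ler_sum => j _.
exact: csqD_young.
Qed.

(** The target [(1 + rho) / 2] is halfway from [rho] to 1. Young's inequality with weight [eps] adds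
    at most [eps + eps + eps ^+ 2 <= 3 eps], which explains the 6. *)
Lemma psq_near (rho eps : R) (l z : pt R d) : psq l <= rho -> rho < 1 -> 0 < eps ->
  eps <= (1 - rho) / 6 -> psq z <= eps ^+ 2 ->
  psq (fun j => l j + z j) <= (1 + rho) / 2.
Proof.
move=> hl r1 e0 e1 hz; apply: (le_trans (psqD_young _ _ e0)).
have l0 := psq_ge0 l.
have h1 : eps^-1 * psq z <= eps.
  by rewrite mulrC ler_pdivrMr // -expr2.
have h2 : eps * psq l <= eps * 1 by apply: ler_wpM2l; lra.
have h3 : eps ^+ 2 <= eps * 1 by rewrite expr2; apply: ler_wpM2l; lra.
lra.
Qed.

End Points.

Section Resolvent.
Variables (R : realType) (d : nat).
Local Notation C := R[i].
Variables (X : hilb R) (A : 'I_d -> X -> X).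
Hypothesis linA : forall j, lin (A j).
Hypothesis contrA : forall x, \sum_(j < d) nsq (@hip R X) (A j x) <= nsq (@hip R X) x.
Local Notation ns := (nsq (@hip R X)).

Definition ZA (l : pt R d) (x : X) : X := \sum_(j < d) l j *: A j x.

Lemma ZA_lin l : lin (ZA l).
Proof.
move=> a x y; rewrite /ZA scaler_sumr -big_split /=; apply: eq_bigr => j _.
by rewrite linA scalerDr !scalerA mulrC.
Qed.

Lemma nsq_ZA l x : ns (ZA l x) <= psq l * ns x.
Proof.
apply: (le_trans (nsq_row _ _)); apply: ler_wpM2l; first exact: psq_ge0.
exact: contrA.
Qed.

Lemma ZA_sub l z x : ZA (fun j => l j - z j) x = ZA l x - ZA z x.
Proof. by rewrite /ZA -sumrB; apply: eq_bigr => j _; rewrite scalerBl. Qed.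

Lemma ZA_scale (a : C) l x : ZA (fun j => a * l j) x = a *: ZA l x.
Proof. by rewrite /ZA scaler_sumr; apply: eq_bigr => j _; rewrite scalerA. Qed.

(** The constant dominates the sharp [(1 - sqrt rho)^-2] and avoids the square root. *)
Lemma contraction_coercive (E : X -> X) (rho : R) : 0 <= rho -> rho < 1 ->
  (forall x, ns (E x) <= rho * ns x) ->
  forall x, ns x <= 4 / (1 - rho) ^+ 2 * ns (x - E x).
Proof.
(* This weight gives [(1 + t) rho = 2 rho / (1 + rho) < 1], so the [E x] term is absorbed in the
   left side. *)
move=> r0 r1 hE x; pose t := (1 - rho) / (1 + rho).
have t0 : 0 < t by rewrite divr_gt0; lra.
have := nsqD_young (x - E x) (E x) t0; rewrite subrK.
have n1 : 1 - rho != 0 by rewrite gt_eqF; lra.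
have n2 : 1 + rho != 0 by rewrite gt_eqF; lra.
have -> : 1 + t^-1 = 2 / (1 - rho) by rewrite /t; field; rewrite n1 n2.
have -> : 1 + t = 2 / (1 + rho) by rewrite /t; field.
move=> h.
have h1 : ns x <= 2 / (1 - rho) * ns (x - E x) + 2 / (1 + rho) * (rho * ns x).
  apply: (le_trans h); rewrite lerD2l; apply: ler_wpM2l; rewrite ?hE //.
  by rewrite divr_ge0; lra.
have h2 : (1 - rho) / (1 + rho) * ns x <= 2 / (1 - rho) * ns (x - E x).
  have -> : (1 - rho) / (1 + rho) * ns x = ns x - 2 / (1 + rho) * (rho * ns x) by field.
  lra.
have h3 : ns x <= 2 * (1 + rho) / (1 - rho) ^+ 2 * ns (x - E x).
  have -> : 2 * (1 + rho) / (1 - rho) ^+ 2 * ns (x - E x) =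
    (1 + rho) / (1 - rho) * (2 / (1 - rho) * ns (x - E x)) by field.
  rewrite -(ler_pM2l t0); apply: (le_trans h2).
  by rewrite /t le_eqVlt; apply/orP; left; apply/eqP; field; rewrite n1 n2.
apply: (le_trans h3); apply: ler_wpM2r; first exact: nsq_ge0.
apply: ler_wpM2r; first by rewrite invr_ge0 sqr_ge0.
lra.
Qed.

Definition res_const (rho : R) : R := 4 / (1 - rho) ^+ 2.

Lemma res_const_ge0 rho : 0 <= res_const rho.
Proof. by rewrite divr_ge0 ?sqr_ge0. Qed.

Lemma res_const_le rho rho' : rho <= rho' -> rho' < 1 -> res_const rho <= res_const rho'.
Proof.
move=> h h1; have a1 : 0 < 1 - rho' by lra.
have a2 : 0 < 1 - rho by lra.
rewrite /res_const ler_wpM2l // lef_pV2 ?posrE ?exprn_gt0 //.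
by apply: lerXn2r; rewrite ?nnegrE; lra.
Qed.

(* The adjoint of [1 - Z(l) A] is bounded below, so the adjoint of the relation inverse to it
   is a right inverse of [1 - Z(l) A]. *)
Lemma res_ex l : inball l -> exists T : X -> X,
  [/\ lin T, forall x, T x - ZA l (T x) = x & forall x, ns (T x) <= res_const (psq l) * ns x].
Proof.
move=> /inballE l1.
have bZ : bop (@hip R X) (@hip R X) (ZA l).
  by split; [exact: ZA_lin | exists (psq l) => x; apply: nsq_ZA].
pose E := adj (@hip R X) (@hip R X) (ZA l).
have linE : lin E := adj_lin bZ.
pose Gr (v w : X) := v = w - E w.
have [T [lT aT nT]] : exists T : X -> X, [/\ lin T,
   forall v w u, Gr v w -> hip v (T u) = hip w u & forall u, ns (T u) <= res_const (psq l) * ns u].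
  apply: rel_adjoint.
  - exact: res_const_ge0.
  - by rewrite /Gr (lin0 linE) subr0.
  - by move=> a _ w _ w' -> ->; rewrite /Gr linE; hilb_ring.
  - move=> _ w ->; apply: contraction_coercive => //; first exact: psq_ge0.
    by apply: adj_bound => //; [exact: psq_ge0 | exact: nsq_ZA].
exists T; split => // x; apply: nsq_eq_hip => w.
rewrite -(aT _ _ x (erefl (w - E w))) hipBr hipBl; congr (_ - _).
by rewrite hip_sym (adjP bZ) -hip_sym.
Qed.

Definition res (l : pt R d) : X -> X := epsilon (inhabits (fun x : X => x)) (fun T =>
  [/\ lin T, forall x, T x - ZA l (T x) = x & forall x, ns (T x) <= res_const (psq l) * ns x]).

Lemma resP l : inball l ->
  [/\ lin (res l), forall x, res l x - ZA l (res l x) = x &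
     forall x, ns (res l x) <= res_const (psq l) * ns x].
Proof.
move=> /res_ex h.
exact: (epsilon_spec (inhabits (fun x : X => x)) (fun T =>
  [/\ lin T, forall x, T x - ZA l (T x) = x & forall x, ns (T x) <= res_const (psq l) * ns x])).
Qed.

Lemma res_lin l : inball l -> lin (res l). Proof. by case/resP. Qed.

Lemma resK l x : inball l -> res l x - ZA l (res l x) = x. Proof. by case/resP. Qed.

Lemma nsq_res l x : inball l -> ns (res l x) <= res_const (psq l) * ns x.
Proof. by case/resP. Qed.

Lemma nsq_res_le rho l x : psq l <= rho -> rho < 1 -> ns (res l x) <= res_const rho * ns x.
Proof.
move=> h h1; have b : inball l by apply/inballE; apply: le_lt_trans h1.
apply: (le_trans (nsq_res x b)); apply: ler_wpM2r; first exact: nsq_ge0.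
exact: res_const_le.
Qed.

Lemma Q_inj l : inball l -> injective (fun x : X => x - ZA l x).
Proof.
move=> b x y h; apply/eqP; rewrite -subr_eq0; apply/eqP; apply: nsq_le0.
have := contraction_coercive (psq_ge0 l) (proj1 (inballE l) b) (nsq_ZA l) (x - y).
rewrite (linB (@ZA_lin l)).
have -> : x - y - (ZA l x - ZA l y) = 0.
  by move/eqP: h; rewrite -subr_eq0 => /eqP h; rewrite -[RHS]h; hilb_ring.
by rewrite nsq0 mulr0.
Qed.

Lemma Kres l x : inball l -> res l (x - ZA l x) = x.
Proof. by move=> b; apply: (Q_inj b); rewrite /= resK. Qed.

Lemma res_uniq l x y : inball l -> y - ZA l y = x -> y = res l x.
Proof. by move=> b <-; rewrite Kres. Qed.

Lemma res0 x : res pt0 x = x.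
Proof.
rewrite [RHS](@res_uniq pt0 x); first by [].
  exact: inball0.
by rewrite /ZA big1 ?subr0 // => j _; rewrite scale0r.
Qed.

(** The resolvent identity, by applying [1 - Z(l) A] to the left side; it supplies difference
    quotients where a power series would give coefficients. *)
Lemma res_diff l z x : inball l -> inball z ->
  res l x - res z x = res l (ZA (fun j => l j - z j) (res z x)).
Proof.
move=> bl bz; apply: res_uniq => //; rewrite (linB (@ZA_lin l)) ZA_sub.
set a := res l x; set b := res z x.
have E1 : a - ZA l a = b - ZA z b by rewrite /a /b !resK.
transitivity ((a - ZA l a) - (b - ZA l b)); first by hilb_ring.
by rewrite E1; hilb_ring.
Qed.

Hypothesis commA : forall i j (x : X), A i (A j x) = A j (A i x).

Lemma ZA_comm l j x : A j (ZA l x) = ZA l (A j x).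
Proof. by rewrite /ZA (lin_sum (linA j)); apply: eq_bigr => i _; rewrite (linZ (linA j)) commA. Qed.

(** Commutativity acts through this exchange: both sides solve the same resolvent equation. *)
Lemma res_comm l j x : inball l -> A j (res l x) = res l (A j x).
Proof. by move=> b; apply: res_uniq => //; rewrite -ZA_comm -(linB (linA j)) resK. Qed.

Variables (Y : hilb R) (Cc : X -> Y).
Hypothesis bC : bop (@hip R X) (@hip R Y) Cc.

(** The observability operator evaluated at [l]; the vectors killed for every [l] form the
    unobservable subspace. *)
Definition Gam (l : pt R d) (x : X) : Y := Cc (res l x).

Lemma Gam_lin l : inball l -> lin (Gam l).
Proof. by move=> b a x y; rewrite /Gam (res_lin b) (proj1 bC). Qed.

Lemma Gam_bop l : inball l -> bop (@hip R X) (@hip R Y) (Gam l).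
Proof.
move=> b; split; first exact: Gam_lin.
have [M M0 hM] := bop_ge0 bC; exists (M * res_const (psq l)) => x.
apply: (le_trans (hM _)); rewrite -mulrA; apply: ler_wpM2l => //; exact: nsq_res.
Qed.

Lemma Gam0 x : Gam pt0 x = Cc x.
Proof. by rewrite /Gam res0. Qed.

Let linC : lin Cc. Proof. by case: bC. Qed.

Lemma nsq_A j x : ns (A j x) <= ns x.
Proof.
apply: le_trans (contrA x); rewrite (bigD1 j) //= lerDl.
by apply: sumr_ge0 => i _; apply: nsq_ge0.
Qed.

(* Differentiating [Gam l x = 0] in the direction [j]. *)
Lemma Gam_ker_deriv x j : (forall l, inball l -> Gam l x = 0) ->
  forall l, inball l -> Gam l (res l (A j x)) = 0.
Proof.
move=> hx l b; have l1 := proj1 (inballE l) b.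
set w := A j (res l x); set y := Gam l _.
have ew : res l (A j x) = w by rewrite /w res_comm.
have [M M0 hM] := bop_ge0 bC.
apply: nsq_le0.
apply: (@ler_eps_mul _ _ _ (M * (res_const ((1 + psq l) / 2) * ns (A j (res l w))))) => e e0.
rewrite add0r.
(* [h <= e] and [h <= 1] give [h ^+ 2 <= e]; the third bound keeps [l'] within squared radius
   [(1 + psq l) / 2], where the resolvents are uniformly bounded. *)
pose h : R := Num.min e (Num.min 1 ((1 - psq l) / 6)).
have h0 : 0 < h by rewrite !lt_min e0 ltr01 divr_gt0 // subr_gt0.
have h_e : h <= e by rewrite /h ge_min lexx.
have h_1 : h <= 1 by rewrite /h !ge_min lexx orbT.
have he : h ^+ 2 <= e.
  by rewrite expr2; apply: (le_trans _ h_e); rewrite ler_piMr // ltW.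
pose v : pt R d := fun i => if i == j then h%:C else 0.
have pv : psq v <= h ^+ 2.
  rewrite /psq (bigD1 j) //= /v eqxx csq_real big1 ?addr0 // => i /negbTE ->.
  by rewrite csq_real expr0n.
have ZAv u : ZA v u = h%:C *: A j u.
  rewrite /ZA (bigD1 j) //= /v eqxx big1 ?addr0 // => i /negbTE ->.
  by rewrite scale0r.
pose l' : pt R d := fun i => l i + v i.
have pl' : psq l' <= (1 + psq l) / 2.
  by apply: (@psq_near _ _ (psq l) h) => //; rewrite /h !ge_min lexx !orbT.
have b' : inball l' by apply/inballE; apply: (le_lt_trans pl'); lra.
have hc : h%:C != 0 :> C by rewrite (inj_eq (@complexI R)) gt_eqF.
have dl u : res l' u - res l u = h%:C *: res l' (A j (res l u)).
  rewrite res_diff // -(linZ (res_lin b')) -ZAv; congr (res l' _).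
  by apply: eq_bigr => i _; rewrite /l' addrC addKr.
have w0 : Gam l' w = 0.
  have := congr1 Cc (dl x); rewrite (linB linC) (linZ linC).
  have := hx _ b'; have := hx _ b; rewrite /Gam => -> ->; rewrite subrr => /esym/eqP.
  by rewrite scaler_eq0 (negbTE hc) => /eqP.
(* A second exact difference, from [l'] back to [l]: since [Gam l' w = 0], the value at [l] is [h]
   times a bounded vector. *)
have -> : y = - (h%:C *: Gam l' (A j (res l w))).
  have := congr1 Cc (dl w); rewrite (linB linC) (linZ linC) /y ew.
  by move: w0; rewrite /Gam => -> <-; rewrite sub0r opprK.
rewrite nsqN nsqZ csq_real; apply: ler_pM => //; rewrite ?sqr_ge0 ?nsq_ge0 //.
apply: (le_trans (hM _)); apply: ler_wpM2l => //.
by apply: nsq_res_le => //; lra.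
Qed.

(* [v s = s Gam (s l) (A j x)] vanishes at [0] and has increments of second order in [s]. *)
Lemma Gam_ker_inv x j : (forall l, inball l -> Gam l x = 0) ->
  forall l, inball l -> Gam l (A j x) = 0.
Proof.
move=> hx l b; have l1 := proj1 (inballE l) b.
set x' := A j x; pose sl (s : R) : pt R d := fun i => s%:C * l i.
have psl s : 0 <= s <= 1 -> psq (sl s) <= psq l.
  move=> /andP[s0 s1]; apply: ler_sum => i _; rewrite csqM csq_real.
  by rewrite ler_piMl ?csq_ge0 // exprn_ile1.
have bs s : 0 <= s <= 1 -> inball (sl s).
  by move=> /psl h; apply/inballE; apply: (le_lt_trans h).
have ZAs s u : ZA (sl s) u = s%:C *: ZA l u by rewrite -ZA_scale.
have [M M0 hM] := bop_ge0 bC.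
pose v s : Y := s%:C *: Gam (sl s) x'.
pose k := res_const (psq l); pose K := M * (k * (k * (k * ns x'))).
have k0 : 0 <= k by apply: res_const_ge0.
have K0 : 0 <= K by do 4!(apply: mulr_ge0 => //); exact: nsq_ge0.
have step s s' : 0 <= s <= 1 -> 0 <= s' <= 1 ->
    nsq (@hip R Y) (v s' - v s) <= ((s' - s) ^+ 2) ^+ 2 * K.
  move=> hs hs'; have bs0 := bs _ hs; have bs1 := bs _ hs'.
  (* Discrete form of [d/ds [s (1 - s Z)^-1] = (1 - s Z)^-2], with [Z = Z(l) A]. *)
  have e1 : s'%:C *: res (sl s') x' - s%:C *: res (sl s) x' =
            (s' - s)%:C *: res (sl s) (res (sl s') x').
    rewrite -[RHS](linZ (res_lin bs0)); apply: res_uniq => //.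
    rewrite (linB (@ZA_lin _)) !(linZ (@ZA_lin _)).
    have := resK x' bs1; rewrite -[RHS](resK x' bs0) !ZAs.
    set r := res (sl s) x'; set r' := res (sl s') x' => E.
    have -> : (s' - s)%:C = s'%:C - s%:C :> C by rewrite (raddfB (real_complex R)).
    transitivity (s'%:C *: r' - s%:C *: (r - s%:C *: ZA l r) - (s'%:C * s%:C) *: ZA l r').
      by hilb_ring.
    by rewrite -E; hilb_ring.
  (* Replacing [res (sl s')] by [res (sl s)] costs a second factor [s' - s]; the leading term is
     [Gam] of the doubled resolvent, which is zero by [Gam_ker_deriv]. *)
  have e2 : v s' - v s = ((s' - s) ^+ 2)%:C *:
      Gam (sl s) (ZA l (res (sl s') (res (sl s) x'))).
    have h0 := Gam_ker_deriv j hx bs0; rewrite -/x' in h0.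
    rewrite /v /Gam -!(linZ linC) -(linB linC) e1.
    have -> : res (sl s') x' = res (sl s) x' +
        (s' - s)%:C *: res (sl s') (ZA l (res (sl s) x')).
      rewrite -(linZ (res_lin bs1)) -ZA_scale.
      have -> : ZA (fun i => (s' - s)%:C * l i) (res (sl s) x') =
        ZA (fun i => sl s' i - sl s i) (res (sl s) x').
        apply: eq_bigr => i _; rewrite /sl -mulrBl; congr (_ *: _); congr (_ * _).
        exact: (raddfB (real_complex R)).
      by rewrite -res_diff // addrC subrK.
    rewrite (linD (res_lin bs0)) scalerDr (linD linC) !(linZ linC).
    move: h0; rewrite /Gam => ->; rewrite scaler0 add0r (linZ (res_lin bs0)) (linZ linC).
    rewrite scalerA expr2 (rmorphM (real_complex R)); congr (_ *: Cc (res _ _)).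
    have cm u : ZA l (res (sl s') u) = res (sl s') (ZA l u).
      rewrite /ZA (lin_sum (res_lin bs1)); apply: eq_bigr => i _.
      by rewrite (linZ (res_lin bs1)) res_comm.
    by rewrite cm.
  rewrite e2 nsqZ csq_real; apply: ler_wpM2l; first by rewrite sqr_ge0.
  apply: (le_trans (hM _)); apply: ler_wpM2l => //.
  apply: (le_trans (nsq_res_le _ (psl _ hs) l1)); apply: ler_wpM2l => //.
  apply: (le_trans (nsq_ZA _ _)).
  apply: (@le_trans _ _ (1 * ns (res (sl s') (res (sl s) x')))).
    by apply: ler_wpM2r; [exact: nsq_ge0 | exact: ltW].
  rewrite mul1r; apply: (le_trans (nsq_res_le _ (psl _ hs') l1)); apply: ler_wpM2l => //.
  exact: nsq_res_le _ (psl _ hs) l1.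
have vE : v 1 = Gam l x'.
  rewrite /v scale1r; congr (Gam _ _); apply/funext => i; by rewrite /sl mul1r.
(* With [[0, 1]] cut into [n + 1] steps, each squared increment is at most [K / (n+1)^4] and the
   squared sum at most [(n+1)^2] times that, hence below [K / (n+1)]. *)
have bnd (n : nat) : nsq (@hip R Y) (Gam l x') <= n.+1%:R^-1 * K.
  pose s (m : nat) : R := m%:R / n.+1%:R.
  have n0 : 0 < n.+1%:R :> R by rewrite ltr0n.
  have s01 (m : nat) : (m <= n.+1)%N -> 0 <= s m <= 1.
    by move=> mn; rewrite divr_ge0 ?ler0n //= ler_pdivrMr // mul1r ler_nat.
  have -> : Gam l x' = \sum_(m < n.+1) (1 : C) *: (v (s m.+1) - v (s m)).
    under eq_bigr do rewrite scale1r.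
    rewrite -(big_mkord predT (fun m => v (s m.+1) - v (s m))) telescope_sumr //.
    by rewrite /s mul0r divff ?gt_eqF // vE /v scale0r subr0.
  apply: (le_trans (nsq_row _ _)).
  rewrite sumr_const card_ord csq_real expr1n.
  apply: (@le_trans _ _ (n.+1%:R * \sum_(i < n.+1) ((n.+1%:R^-1) ^+ 2) ^+ 2 * K)).
    apply: ler_wpM2l; first exact: ltW.
    apply: ler_sum => i _.
    have -> : n.+1%:R^-1 = s i.+1 - s i :> R.
      by rewrite /s -mulrBl -natrB // subSnn mul1r.
    by apply: step; apply: s01 => //; apply: ltnW.
  rewrite sumr_const card_ord -[X in _ * X <= _]mulr_natl.
  have -> : n.+1%:R * (n.+1%:R * (n.+1%:R^-1 ^+ 2 ^+ 2 * K)) = n.+1%:R^-1 * (n.+1%:R^-1 * K) :> R.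
    by have := lt0r_neq0 n0; move: (n.+1%:R : R) => q nn; field.
  apply: ler_wpM2l; first by rewrite invr_ge0 ltW.
  by apply: ler_piMl; [| rewrite invf_le1 // ler1n].
apply: nsq_le0; apply: (@ler_eps_mul _ _ _ K) => e e0; rewrite add0r.
apply: (le_trans (bnd (Num.truncn e^-1))); apply: ler_wpM2r.
  exact: K0.
by rewrite -[e]invrK lef_pV2 ?posrE ?invr_gt0 ?ltr0n // ?invrK // ltW // truncnS_gt.
Qed.

End Resolvent.

Section SubmoduleType.
Variables (R : realType) (V : lmodType R[i]).

(** A [Prop]-valued subspace bundled with its closure proofs, from which [sm_type] gets a module
    structure through the Boolean predicate [sm_mem]. *)
Record submodule := SubModule {
  sm_pred : V -> Prop;
  sm_0 : sm_pred 0;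
  sm_lin : forall (a : R[i]) x y, sm_pred x -> sm_pred y -> sm_pred (a *: x + y) }.

Definition sm_mem (S : submodule) : {pred V} := fun x => `[< sm_pred S x >].

Lemma sm_memP S x : reflect (sm_pred S x) (x \in sm_mem S).
Proof. exact: asboolP. Qed.

Lemma sm_closed S : submod_closed (sm_mem S).
Proof.
split; first by apply/sm_memP; apply: sm_0.
by move=> a x y /sm_memP hx /sm_memP hy; apply/sm_memP; apply: sm_lin.
Qed.

HB.instance Definition _ S := GRing.isSubmodClosed.Build R[i] V (sm_mem S) (sm_closed S).

Record sm_type (S : submodule) := SmType { sm_val :> V; _ : sm_val \in sm_mem S }.

HB.instance Definition _ S := [isSub for @sm_val S].
HB.instance Definition _ S := [Choice of sm_type S by <:].
HB.instance Definition _ S := [SubChoice_isSubLmodule of sm_type S by <:].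

Lemma sm_valP S (x : sm_type S) : sm_pred S (sm_val x).
Proof. by case: x => x hx; apply/sm_memP. Qed.

Definition sm_make S x (h : sm_pred S x) : sm_type S := SmType (introT (sm_memP S x) h).

Lemma sm_val_inj S (x y : sm_type S) : sm_val x = sm_val y -> x = y.
Proof. exact: val_inj. Qed.

End SubmoduleType.

(** * Jordan-von Neumann: an inner product from the parallelogram law *)

Section JordanVonNeumann.
Variable R : realType.
Local Notation C := R[i].

(** [delta t = phi t - t * phi 1] is additive and vanishes on integers, so it has period 1 and is
    bounded on the whole line; [n * delta t = delta (n * t)] then forces [delta = 0]. *)
Lemma additive_bounded_linear (phi : R -> R) (B : R) :
  (forall s t, phi (s + t) = phi s + phi t) ->
  (forall t, 0 <= t <= 1 -> `|phi t| <= B) -> forall t, phi t = t * phi 1.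
Proof.
move=> add bnd.
have nat_mul (n : nat) t : phi (n%:R * t) = n%:R * phi t.
  elim: n => [|n IH]; last by rewrite -natr1 !mulrDl !mul1r add IH.
  by rewrite !mul0r; apply: (addrI (phi 0)); rewrite -add !addr0.
have phiN t : phi (- t) = - phi t.
  apply: (addrI (phi t)); rewrite -add !subrr.
  by have := nat_mul 0 0; rewrite !mul0r.
have int_mul (z : int) t : phi (z%:~R * t) = z%:~R * phi t.
  case: z => n; first by rewrite -pmulrn nat_mul.
  by rewrite NegzE mulrNz -pmulrn !mulNr phiN nat_mul.
pose delta t := phi t - t * phi 1.
have dB t : `|delta t| <= B + `|phi 1|.
  pose z := Num.floor t; pose f := t - z%:~R.
  have f01 : 0 <= f <= 1.
    have := floor_itv t; rewrite -/z /f => /andP[h1 h2].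
    by rewrite subr_ge0 h1 /= lerBlDl ltW // -[1]/(1%:~R) -intrD.
  have -> : delta t = delta f.
    have := int_mul z 1; rewrite mulr1 /delta /f add phiN => ->; ring.
  rewrite /delta; apply: (le_trans (ler_normB _ _)); apply: lerD; first exact: bnd.
  by case/andP: f01 => f0 f1; rewrite normrM ler_piMl // ger0_norm.
move=> t; apply/eqP; rewrite -subr_eq0 -normr_le0.
apply: (@ler_eps_mul _ _ _ (B + `|phi 1|)) => e e0; rewrite add0r.
pose n := Num.truncn e^-1.
have n0 : 0 < n.+1%:R :> R by rewrite ltr0n.
have : n.+1%:R * `|delta t| <= B + `|phi 1|.
  rewrite -(ger0_norm (ltW n0)) -normrM.
  have -> : n.+1%:R * delta t = delta (n.+1%:R * t) by rewrite /delta nat_mul; ring.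
  exact: dB.
have B0 : 0 <= B + `|phi 1| by apply: le_trans (dB 0); exact: normr_ge0.
rewrite mulrC -ler_pdivlMr // => /le_trans; apply; rewrite mulrC; apply: ler_wpM2r => //.
by rewrite -[e]invrK lef_pV2 ?posrE ?invr_gt0 // ?invrK // ltW // truncnS_gt.
Qed.

Variables (V : lmodType C) (N : V -> R).
Hypothesis N_ge0 : forall x, 0 <= N x.
Hypothesis NZ : forall (a : C) x, N (a *: x) = csq a * N x.
Hypothesis N_par : forall x y, N (x + y) + N (x - y) = 2 * N x + 2 * N y.

Let r x y := (N (x + y) - N (x - y)) / 4.

Definition jvn (x y : V) : C := (r x y) +i* (r x ('i%C *: y)).

Let NN x : N (- x) = N x.
Proof. by rewrite -scaleN1r NZ csqN csq_real expr1n mul1r. Qed.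

Let rC x y : r x y = r y x.
Proof. by rewrite /r (addrC x y) -(NN (x - y)) opprB. Qed.

Let r0 y : r 0 y = 0.
Proof. by rewrite /r add0r sub0r NN subrr mul0r. Qed.

(** The parallelogram law at [x + y, x' + y] and at [x - y, x' - y]: the terms [N (x - x')] cancel.
    The case [x' = 0] turns this into additivity. *)
Let rD2 x x' y : r (x + x') (y + y) = 2 * (r x y + r x' y).
Proof.
have := N_par (x + y) (x' + y); have := N_par (x - y) (x' - y).
have -> : x + y + (x' + y) = x + x' + (y + y) by rewrite addrACA.
have -> : x - y + (x' - y) = x + x' - (y + y) by rewrite addrACA opprD.
have -> : x + y - (x' + y) = x - x' by rewrite opprD addrACA subrr addr0.
have -> : x - y - (x' - y) = x - x' by rewrite opprD addrACA opprK addNr addr0.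
rewrite /r; lra.
Qed.

Let rD x x' y : r (x + x') y = r x y + r x' y.
Proof.
have := rD2 (x + x') 0 y; have := rD2 x x' y; rewrite addr0 r0; lra.
Qed.

Let rN x y : r (- x) y = - r x y.
Proof. by apply: (addrI (r x y)); rewrite -rD !subrr r0. Qed.

(** [N] is not assumed continuous. Nonnegativity and the parallelogram law bound [r (s x) y] by
    [(N x + N y) / 2] for [s] in [[0, 1]], which is enough for real homogeneity. *)
Let rZ (t : R) x y : r (t%:C *: x) y = t * r x y.
Proof.
have := @additive_bounded_linear (fun t => r (t%:C *: x) y) ((N x + N y) / 2).
move=> /(_ _ _ t) -> //=.
- by rewrite scale1r.
- by move=> s s'; rewrite (raddfD (real_complex R)) /= scalerDl rD.
move=> s /andP[s0 s1].
have h : N (s%:C *: x) <= N x.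
  by rewrite NZ csq_real ler_piMl // exprn_ile1.
rewrite /r; have := N_par (s%:C *: x) y.
have := N_ge0 (s%:C *: x + y); have := N_ge0 (s%:C *: x - y).
rewrite ler_norml; move: h => h h1 h2 h3; apply/andP; split; lra.
Qed.

Let ri x y : r ('i%C *: x) ('i%C *: y) = r x y.
Proof. by rewrite /r -scalerDr -scalerBr !NZ csqi !mul1r. Qed.

Let ri2 x y : r ('i%C *: x) y = - r x ('i%C *: y).
Proof.
rewrite -ri scalerA.
have -> : 'i%C * 'i%C = -1 :> C by rewrite -expr2 sqr_i.
by rewrite scaleN1r rN.
Qed.

Lemma jvn_lin (a : C) x y z : jvn (a *: x + y) z = a * jvn x z + jvn y z.
Proof.
have Ea : a *: x = (complex.Re a)%:C *: x + (complex.Im a)%:C *: ('i%C *: x).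
  rewrite scalerA -scalerDl; congr (_ *: _).
  by case: a => a1 a2; apply: complex_eqP => /=; ring.
rewrite /jvn Ea !rD !rZ !ri2.
have -> : r x ('i%C *: ('i%C *: z)) = - r x z.
  by rewrite scalerA -expr2 sqr_i scaleN1r rC rN rC.
by case: a {Ea} => a1 a2; apply: complex_eqP => /=; ring.
Qed.

Lemma jvn_sym x y : jvn y x = conjc (jvn x y).
Proof. by rewrite /jvn /=; congr (_ +i* _); rewrite rC // ri2. Qed.

Lemma jvnxx x : jvn x x = (N x)%:C.
Proof.
rewrite /jvn /r; apply: complex_eqP => /=.
  have -> : x + x = 2%:C *: x by rewrite rmorph_nat scaler_nat mulr2n.
  have -> : x - x = 0%:C *: x by rewrite subrr scale0r.
  by rewrite !NZ !csq_real; field.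
have -> : x + 'i%C *: x = (1 + 'i%C) *: x by rewrite scalerDl scale1r.
have -> : x - 'i%C *: x = (1 - 'i%C) *: x by rewrite scalerBl scale1r.
by rewrite !NZ /csq /=; field.
Qed.

(** Puts [jvn] in the shape of [rk_ip], so that the polarized form in the definitions is the inner
    product built here. *)
Lemma jvnE x y : jvn x y = 4%:R^-1 * \sum_(k < 4) 'i%R ^+ k * (N (x + 'i%R ^+ k *: y))%:C.
Proof.
rewrite !big_ord_recr big_ord0 /= -complexiE expr0 expr1 sqr_i.
have -> : 'i%C ^+ 3 = - 'i%C :> C by rewrite exprS sqr_i mulrN1.
rewrite scale1r !scaleNr scale1r add0r mul1r.
have -> : (4^-1 : C) = (4^-1 : R)%:C by rewrite (fmorphV (real_complex R)) rmorph_nat.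
by rewrite /jvn /r; apply: complex_eqP => /=; field.
Qed.

End JordanVonNeumann.

(** * The dual norm of a positive operator-valued kernel *)

Section KernelForm.
Variables (R : realType) (d : nat) (Y : hilb R) (K : pt R d -> pt R d -> Y -> Y).
Local Notation C := R[i].
Local Notation ipY := (@hip R Y).
Implicit Types (f g : pt R d -> Y) (c : R).

Definition bpt := {l : pt R d | inball l}.
(** Formal combinations of kernel functions; with lists, concatenation and [famZ] act as addition
    and scaling. *)
Definition fam := seq (bpt * Y).
Implicit Types s t : fam.

Definition ev f s : C := \sum_(p <- s) hip (f (sval p.1)) p.2.
(** The Gram form: in [H(K)], the inner product of the kernel combination of [t] with that of [s],
    hence conjugate-linear in [s]. *)
Definition kf s t : C := \sum_(p <- s) \sum_(p' <- t) hip (K (sval p.1) (sval p'.1) p'.2) p.2.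
Definition kq s : R := complex.Re (kf s s).

(** [pk_bd] bounds each diagonal block [K z z], which is what makes point evaluations continuous on
    [H(K)]. *)
Record pos_kernel : Prop := PosKernel {
  pk_lin : forall l z, inball l -> inball z -> lin (K l z);
  pk_sym : forall l z y y', inball l -> inball z ->
    hip (K l z y) y' = conjc (hip (K z l y') y);
  pk_pos : forall s, 0 <= kq s;
  pk_bd : forall z, inball z -> exists M : R, forall y, complex.Re (hip (K z z y) y) <= M * nsq ipY y }.

Definition famZ (a : C) s : fam := [seq (p.1, a *: p.2) | p <- s].

Lemma ev_cat f s t : ev f (s ++ t) = ev f s + ev f t.
Proof. by rewrite /ev big_cat. Qed.

Lemma ev_famZ f a s : ev f (famZ a s) = conjc a * ev f s.
Proof. by rewrite /ev big_map mulr_sumr; apply: eq_bigr => p _; rewrite hipZr. Qed.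

Lemma ev_lin a f g s : ev (fun l => a *: f l + g l) s = a * ev f s + ev g s.
Proof.
by rewrite /ev mulr_sumr -big_split; apply: eq_bigr => p _; rewrite hipDl hipZl.
Qed.

Lemma ev1 f p : ev f [:: p] = hip (f (sval p.1)) p.2.
Proof. by rewrite /ev big_seq1. Qed.

Lemma ev_eq f g s : (forall l, inball l -> f l = g l) -> ev f s = ev g s.
Proof. by move=> h; apply: eq_bigr => p _; rewrite h //; case: p => -[]. Qed.

Lemma kf_catl s s' t : kf (s ++ s') t = kf s t + kf s' t.
Proof. by rewrite /kf big_cat. Qed.

Lemma kf_catr s t t' : kf s (t ++ t') = kf s t + kf s t'.
Proof. by rewrite /kf -big_split; apply: eq_bigr => p _; rewrite big_cat. Qed.

Lemma kf_famZl a s t : kf (famZ a s) t = conjc a * kf s t.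
Proof.
rewrite /kf big_map mulr_sumr; apply: eq_bigr => p _; rewrite mulr_sumr.
by apply: eq_bigr => p' _; rewrite hipZr.
Qed.

Lemma rk_bound_fam f c : rk_bound ipY K f c <->
  0 <= c /\ forall s, `|ev f s| ^+ 2 <= c%:C * kf s s.
Proof.
split=> -[c0 h]; split=> //.
  move=> s; have := h (size s) (fun i => sval (tnth (in_tuple s) i).1)
    (fun i => (tnth (in_tuple s) i).2) (fun i => svalP (tnth (in_tuple s) i).1).
  have -> : kf s s = \sum_(i < size s) \sum_(k < size s)
      hip (K (sval (tnth (in_tuple s) i).1) (sval (tnth (in_tuple s) k).1)
            (tnth (in_tuple s) k).2) (tnth (in_tuple s) i).2.
    by rewrite /kf big_tnth; apply: eq_bigr => i _; rewrite big_tnth.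
  have -> // : ev f s = \sum_(i < size s)
      hip (f (sval (tnth (in_tuple s) i).1)) (tnth (in_tuple s) i).2.
  by rewrite /ev big_tnth.
move=> n ls ys ok.
have := h [seq (exist _ (ls i) (ok i) : bpt, ys i) | i <- index_enum 'I_n].
rewrite /ev /kf !big_map /= => /le_trans; apply.
rewrite le_eqVlt; apply/orP; left; apply/eqP; congr (_ * _).
by apply: eq_bigr => i _; rewrite big_map.
Qed.

Hypothesis pK : pos_kernel.

Lemma kf_famZr a s t : kf s (famZ a t) = a * kf s t.
Proof.
rewrite /kf mulr_sumr; apply: eq_bigr => p _; rewrite big_map mulr_sumr.
apply: eq_bigr => p' _.
by rewrite (linZ (pk_lin pK (svalP p.1) (svalP p'.1))) hipZl.
Qed.

Lemma kf_sym s t : kf t s = conjc (kf s t).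
Proof.
rewrite /kf conj_sum exchange_big /=; apply: eq_bigr => p _; rewrite conj_sum.
by apply: eq_bigr => p' _; rewrite (pk_sym pK _ _ (svalP _) (svalP _)).
Qed.

Lemma kfxx s : kf s s = (kq s)%:C.
Proof.
apply: complex_eqP => //=.
have := congr1 (@complex.Im R) (kf_sym s s); case: (kf s s) => a b /= h; lra.
Qed.

Lemma kq_cat s t : kq (s ++ t) = kq s + kq t + 2 * complex.Re (kf s t).
Proof.
rewrite /kq kf_catl !kf_catr !ReD (kf_sym s t) Re_conjc; lra.
Qed.

Lemma kq_famZ a s : kq (famZ a s) = csq a * kq s.
Proof. by rewrite /kq kf_famZl kf_famZr mulrA [_ * a]mulrC mul_conjC Re_realM. Qed.

(** Perturbing [t] by the multiple [r * kf s t] of [s] makes the cross term the real number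
    [r * csq (kf s t)]; the discriminant gives the claim multiplied by [csq (kf s t)]. *)
Lemma kf_CS s t : csq (kf s t) <= kq t * kq s.
Proof.
have [z|z] := eqVneq (csq (kf s t)) 0; first by rewrite z mulr_ge0 // (pk_pos pK).
have p : 0 < csq (kf s t) by rewrite lt_def z csq_ge0.
have : csq (kf s t) ^+ 2 <= kq t * (csq (kf s t) * kq s).
  apply: quadratic_disc; first by rewrite mulr_ge0 ?csq_ge0 ?(pk_pos pK).
  move=> r; have := pk_pos pK (t ++ famZ (r%:C * kf s t) s).
  rewrite kq_cat kq_famZ kf_famZr csqM csq_real (kf_sym s t).
  have -> : complex.Re (r%:C * kf s t * conjc (kf s t)) = r * csq (kf s t).
    by rewrite -mulrA mul_conjC Re_realM.
  nra.
by rewrite expr2 mulrCA ler_pM2l.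
Qed.

Lemma rk_bound_csq f c : rk_bound ipY K f c <->
  0 <= c /\ forall s, csq (ev f s) <= c * kq s.
Proof.
rewrite rk_bound_fam; split=> -[c0 h]; split=> // s; move: (h s);
  by rewrite csqE kfxx -(rmorphM (real_complex R)) lecR.
Qed.

(* The squared dual norm of [f] is [sup_s (2 Re f(s) - q(s))]. *)
Lemma rk_boundE f c : rk_bound ipY K f c <->
  forall s, 2 * complex.Re (ev f s) - kq s <= c.
Proof.
rewrite rk_bound_csq; split.
  move=> [c0 h] s; rewrite lerBlDr; apply: amgm => //; first exact: (pk_pos pK).
  exact: (le_trans (csq_Re _) (h s)).
move=> h; split.
  by have := h [::]; rewrite /kq /kf /ev !big_nil /= mulr0 subrr.
move=> s; set a := ev f s.
have [z|z] := eqVneq (csq a) 0.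
  rewrite z mulr_ge0 ?(pk_pos pK) //.
  by have := h [::]; rewrite /kq /kf /ev !big_nil /= mulr0 subrr.
have p : 0 < csq a by rewrite lt_def z csq_ge0.
have : csq a ^+ 2 <= c * (csq a * kq s).
  apply: quadratic_disc; first by rewrite mulr_ge0 ?csq_ge0 ?(pk_pos pK).
  move=> r; have := h (famZ ((- r)%:C * a) s).
  rewrite ev_famZ kq_famZ conjM csqM csq_real conjc_real -/a -mulrA.
  rewrite (mulrC (conjc a)) mul_conjC Re_realM /=; nra.
by rewrite expr2 mulrCA ler_pM2l.
Qed.

Local Notation N := (rk_nsq ipY K).
Local Notation inrk := (in_rk ipY K).

Lemma rk_nsq_le f c : rk_bound ipY K f c -> N f <= c.
Proof. by move=> h; apply: ge_inf => //; exists 0 => r [r0 _]. Qed.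

(** By [rk_boundE] the admissible [c] are the upper bounds of a fixed set of reals, so their infimum
    is again admissible. *)
Lemma rk_nsqP f : inrk f -> rk_bound ipY K f (N f).
Proof.
move=> [c hc]; apply/rk_boundE => s; apply: lb_le_inf; first by exists c.
by move=> r /rk_boundE.
Qed.

Lemma rk_nsq_ge f s : inrk f -> 2 * complex.Re (ev f s) - kq s <= N f.
Proof. by move=> /rk_nsqP/rk_boundE. Qed.

Lemma rk_nsq_ge0 f : inrk f -> 0 <= N f.
Proof. by move=> /rk_nsqP[]. Qed.

Lemma ev_csq f s : inrk f -> csq (ev f s) <= N f * kq s.
Proof. by move=> /rk_nsqP/rk_bound_csq[]. Qed.

Lemma rk_bound_eq f g c : (forall l, inball l -> f l = g l) ->
  rk_bound ipY K f c -> rk_bound ipY K g c.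
Proof. by move=> e; rewrite !rk_boundE => h s; rewrite -(ev_eq s e). Qed.

Lemma in_rk_eq f g : (forall l, inball l -> f l = g l) -> inrk f -> inrk g.
Proof. by move=> e [c hc]; exists c; apply: rk_bound_eq hc. Qed.

Lemma rk_nsq_eq f g : (forall l, inball l -> f l = g l) -> N f = N g.
Proof.
move=> e; rewrite /rk_nsq; congr inf; apply/seteqP; split => c /=; apply: rk_bound_eq => // l b.
by rewrite e.
Qed.

Lemma rk_ip_eq f g f' g' : (forall l, inball l -> f l = f' l) ->
  (forall l, inball l -> g l = g' l) -> rk_ip ipY K f g = rk_ip ipY K f' g'.
Proof.
move=> e e'; rewrite /rk_ip; congr (_ * _); apply: eq_bigr => k _; congr (_ * _%:C).
by apply: rk_nsq_eq => l b; rewrite e ?e'.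
Qed.

Lemma in_rk_lin a f g : inrk f -> inrk g -> inrk (fun l => a *: f l + g l).
Proof.
move=> [c /rk_bound_csq[c0 h]] [c' /rk_bound_csq[c0' h']].
exists (2 * csq a * c + 2 * c'); apply/rk_bound_csq; split.
  by rewrite addr_ge0 // !mulr_ge0 ?csq_ge0.
move=> s; rewrite ev_lin; have := h s; have := h' s.
have : csq (a * ev f s + ev g s) <= 2 * csq (a * ev f s) + 2 * csq (ev g s).
  have := @csqD_young R 1 (a * ev f s) (ev g s) ltr01; rewrite invr1; lra.
rewrite csqM => h1 h2 h3.
have : csq a * csq (ev f s) <= csq a * (c * kq s) by apply: ler_wpM2l => //; apply: csq_ge0.
lra.
Qed.

Lemma in_rk0 : inrk (fun _ => 0).
Proof.
exists 0; apply/rk_boundE => s; rewrite /ev big1 /=; last by move=> p _; rewrite hip0l.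
by rewrite mulr0 sub0r oppr_le0 (pk_pos pK).
Qed.

Lemma in_rkZ a f : inrk f -> inrk (fun l => a *: f l).
Proof. by move=> h; apply: in_rk_eq (in_rk_lin a h in_rk0) => l _; rewrite addr0. Qed.

Lemma in_rkD f g : inrk f -> inrk g -> inrk (fun l => f l + g l).
Proof. by move=> h h'; apply: in_rk_eq (in_rk_lin 1 h h') => l _; rewrite scale1r. Qed.

Lemma in_rkB f g : inrk f -> inrk g -> inrk (fun l => f l - g l).
Proof.
by move=> h h'; apply: in_rk_eq (in_rk_lin (-1) h' h) => l _; rewrite scaleN1r addrC.
Qed.

Let rk_nsqZ_le a f : inrk f -> N (fun l => a *: f l) <= csq a * N f.
Proof.
move=> hf; apply: rk_nsq_le; apply/rk_bound_csq; split.
  by rewrite mulr_ge0 ?csq_ge0 ?rk_nsq_ge0.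
move=> s; have -> : ev (fun l => a *: f l) s = a * ev f s.
  by rewrite /ev mulr_sumr; apply: eq_bigr => p _; rewrite hipZl.
by rewrite csqM -mulrA; apply: ler_wpM2l; rewrite ?csq_ge0 ?ev_csq.
Qed.

Lemma rk_nsqZ a f : inrk f -> N (fun l => a *: f l) = csq a * N f.
Proof.
move=> hf; apply/eqP; rewrite eq_le rk_nsqZ_le //=.
have [->|an] := eqVneq a 0.
  rewrite csq_real expr0n mul0r; apply: rk_nsq_ge0.
  by apply: in_rkZ.
have := rk_nsqZ_le a^-1 (in_rkZ a hf).
have -> : N (fun l => a^-1 *: (a *: f l)) = N f.
  by apply: rk_nsq_eq => l _; rewrite scalerA mulVf // scale1r.
move=> h; apply: (@le_trans _ _ (csq a * (csq a^-1 * N (fun l => a *: f l)))).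
  by apply: ler_wpM2l => //; apply: csq_ge0.
by rewrite mulrA -csqM divff // csq_real expr1n mul1r.
Qed.

(** Given test families [s] for [f + g] and [t] for [f - g], test [f] on [(s + t) / 2] and [g] on
    [(s - t) / 2]; the form [kq] obeys the parallelogram law. *)
Let rk_par_le f g : inrk f -> inrk g ->
  N (fun l => f l + g l) + N (fun l => f l - g l) <= 2 * N f + 2 * N g.
Proof.
move=> hf hg; rewrite -lerBrDr; apply: rk_nsq_le; apply/rk_boundE => s.
rewrite lerBrDr addrC -lerBrDr; apply: rk_nsq_le; apply/rk_boundE => t.
have -> : ev (fun l => f l + g l) s = ev f s + ev g s.
  by rewrite -[ev f s]mul1r -ev_lin; apply: ev_eq => l _; rewrite scale1r.
have -> : ev (fun l => f l - g l) t = ev f t - ev g t.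
  by rewrite addrC -mulN1r -ev_lin; apply: ev_eq => l _; rewrite scaleN1r addrC.
have := rk_nsq_ge (famZ (2^-1)%:C (s ++ t)) hf.
have := rk_nsq_ge (famZ (2^-1)%:C (s ++ famZ (-1) t)) hg.
rewrite !kq_famZ !kq_cat kq_famZ kf_famZr !ev_famZ !ev_cat ev_famZ.
have -> : conjc (-1) = -1 :> C by apply: complex_eqP => /=; ring.
rewrite conjc_real !mulN1r !Re_realM !ReD !ReN csqN !csq_real; lra.
Qed.

(** The reverse inequality is [rk_par_le] at [f + g] and [f - g], whose sum and difference are [2 f]
    and [2 g]. *)
Lemma rk_par f g : inrk f -> inrk g ->
  N (fun l => f l + g l) + N (fun l => f l - g l) = 2 * N f + 2 * N g.
Proof.
move=> hf hg; apply/eqP; rewrite eq_le rk_par_le //=.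
have := rk_par_le (in_rkD hf hg) (in_rkB hf hg).
have -> : N (fun l => f l + g l + (f l - g l)) = 4 * N f.
  have -> : 4 = csq 2%:C :> R by rewrite csq_real; ring.
  rewrite -rk_nsqZ //; apply: rk_nsq_eq => l _.
  by rewrite addrACA subrr addr0 rmorph_nat scaler_nat mulr2n.
have -> : N (fun l => f l + g l - (f l - g l)) = 4 * N g.
  have -> : 4 = csq 2%:C :> R by rewrite csq_real; ring.
  rewrite -rk_nsqZ //; apply: rk_nsq_eq => l _.
  by rewrite rmorph_nat scaler_nat mulr2n; hilb_ring.
lra.
Qed.

Definition Kt t : pt R d -> Y := fun l => \sum_(p <- t) K l (sval p.1) p.2.

Lemma ev_Kt s t : ev (Kt t) s = kf s t.
Proof. by apply: eq_bigr => p _; rewrite hip_suml. Qed.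

Lemma in_rk_Kt t : inrk (Kt t).
Proof.
exists (kq t); apply/rk_bound_csq; split; first exact: (pk_pos pK).
by move=> s; rewrite ev_Kt kf_CS.
Qed.

Lemma Kt_famZ a t l : inball l -> Kt (famZ a t) l = a *: Kt t l.
Proof.
move=> b; rewrite /Kt big_map scaler_sumr; apply: eq_bigr => p _ /=.
by rewrite (linZ (pk_lin pK b (svalP p.1))).
Qed.

Let Kt_le f t : inrk f ->
  N (fun l => f l + Kt t l) <= N f + 2 * complex.Re (ev f t) + kq t.
Proof.
move=> hf; apply: rk_nsq_le; apply/rk_boundE => s.
have -> : ev (fun l => f l + Kt t l) s = ev f s + kf s t.
  by rewrite -ev_Kt -[ev f s]mul1r -ev_lin; apply: ev_eq => l _; rewrite scale1r.
have := rk_nsq_ge (s ++ famZ (-1) t) hf.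
rewrite kq_cat kq_famZ kf_famZr ev_cat ev_famZ.
have -> : conjc (-1) = -1 :> C by apply: complex_eqP => /=; ring.
rewrite !mulN1r csqN csq_real !ReD !ReN; lra.
Qed.

(* Completing the square in the supremum of [rk_boundE]. *)
Lemma rk_nsq_Kt f t : inrk f ->
  N (fun l => f l + Kt t l) = N f + 2 * complex.Re (ev f t) + kq t.
Proof.
move=> hf; apply/eqP; rewrite eq_le Kt_le //=.
have := Kt_le (famZ (-1) t) (in_rkD hf (in_rk_Kt t)).
have -> : N (fun l => f l + Kt t l + Kt (famZ (-1) t) l) = N f.
  by apply: rk_nsq_eq => l b; rewrite Kt_famZ // scaleN1r addrK.
rewrite ev_famZ kq_famZ.
have -> : ev (fun l => f l + Kt t l) t = ev f t + kf t t.
  by rewrite -ev_Kt -[ev f t]mul1r -ev_lin; apply: ev_eq => l _; rewrite scale1r.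
have -> : conjc (-1) = -1 :> C by apply: complex_eqP => /=; ring.
rewrite mulN1r csqN csq_real ReN ReD -/(kq t); lra.
Qed.

(** Test [f] on the single pair [(z, f z)] and cancel one factor [|f z|^2]. *)
Lemma nsq_eval_le z : inball z -> exists2 M : R, 0 <= M &
  forall f, inrk f -> nsq ipY (f z) <= M * N f.
Proof.
move=> b; have [M hM] := pk_bd pK b; exists `|M| => [|f hf]; first exact: normr_ge0.
pose p : bpt * Y := (exist _ z b, f z).
have := ev_csq [:: p] hf; rewrite ev1 /= hipxx csq_real /kq /kf !big_seq1 /= => h.
have [->|nz] := eqVneq (nsq ipY (f z)) 0; first by rewrite mulr_ge0 ?normr_ge0 ?rk_nsq_ge0.
have pos : 0 < nsq ipY (f z) by rewrite lt_def nz nsq_ge0.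
rewrite -(ler_pM2r pos) -expr2; apply: (le_trans h).
rewrite mulrAC mulrC; apply: ler_wpM2r; first exact: rk_nsq_ge0.
by apply: (le_trans (hM _)); apply: ler_wpM2r; rewrite ?nsq_ge0 ?ler_norm.
Qed.

End KernelForm.

(** * [H(K)] as a Hilbert space with reproducing kernel *)

Section RKHSpace.
Variables (R : realType) (d : nat) (Y : hilb R) (K : pt R d -> pt R d -> Y -> Y).
Hypothesis pK : pos_kernel K.
Local Notation C := R[i].
Local Notation ipY := (@hip R Y).
Local Notation N := (rk_nsq ipY K).
Local Notation inrk := (in_rk ipY K).
Implicit Types (f g : pt R d -> Y).

(* Members of [H(K)] are only determined on the ball, so representatives vanishing off it are used. *)
Definition rk_submodule : submodule (pt R d -> Y).
Proof.
apply: (@SubModule R (pt R d -> Y) (fun f => inrk f /\ forall l, ~ inball l -> f l = 0)).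
  by split=> //; apply: in_rk0.
move=> a f g [hf f0] [hg g0]; split; first exact: (in_rk_lin pK).
by move=> l b; rewrite -[LHS]/(a *: f l + g l) (f0 l b) (g0 l b) scaler0 addr0.
Defined.

Local Notation V := (sm_type rk_submodule).

Let inV (x : V) : inrk (sm_val x). Proof. by case: (sm_valP x). Qed.

Let NV (x : V) : R := N (sm_val x).

Let NV_ge0 x : 0 <= NV x. Proof. exact (rk_nsq_ge0 pK (inV x)). Qed.

Let NVZ (a : C) x : NV (a *: x) = csq a * NV x.
Proof. exact (rk_nsqZ pK a (inV x)). Qed.

Let NV_par x y : NV (x + y) + NV (x - y) = 2 * NV x + 2 * NV y.
Proof. exact (rk_par pK (inV x) (inV y)). Qed.

Definition rk_sp_ip (x y : V) : C := rk_ip ipY K (sm_val x) (sm_val y).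

Let ipE x y : rk_sp_ip x y = jvn NV x y.
Proof. by rewrite jvnE. Qed.

Let sp_lin (a : C) (x y z : V) : rk_sp_ip (a *: x + y) z = a * rk_sp_ip x z + rk_sp_ip y z.
Proof. by rewrite !ipE; apply: jvn_lin. Qed.

Let sp_sym (x y : V) : rk_sp_ip y x = conjc (rk_sp_ip x y).
Proof. by rewrite !ipE; apply: jvn_sym. Qed.

Let spxx (x : V) : rk_sp_ip x x = (NV x)%:C.
Proof. by rewrite ipE; apply: jvnxx. Qed.

Let sp_pos (x : V) : 0 <= rk_sp_ip x x.
Proof. by rewrite spxx ler0c. Qed.

Let sp_def (x : V) : rk_sp_ip x x = 0 -> x = 0.
Proof.
rewrite spxx => /(@complexI R) h; apply: sm_val_inj; apply/funext => l.
have [b|nb] := pselect (inball l); last by case: (sm_valP x) => _ ->.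
have [M _ /(_ _ (inV x))] := nsq_eval_le pK b.
by rewrite -/(NV x) h mulr0; apply: nsq_le0.
Qed.

Let sp_complete (u : nat -> V) :
    (forall e : R, 0 < e -> exists N : nat, forall m n : nat, (N <= m)%N -> (N <= n)%N ->
        complex.Re (rk_sp_ip (u m - u n) (u m - u n)) < e) ->
    exists l, forall e : R, 0 < e -> exists N : nat, forall n : nat, (N <= n)%N ->
        complex.Re (rk_sp_ip (u n - l) (u n - l)) < e.
Proof.
move=> cau.
have cau' e : 0 < e -> exists n0 : nat, forall m n : nat, (n0 <= m)%N -> (n0 <= n)%N ->
   N (fun l => sm_val (u m) l - sm_val (u n) l) < e.
  by move=> /cau[n0 h]; exists n0 => m n hm hn; have := h m n hm hn; rewrite spxx.
have lim l : exists y : Y, (inball l -> forall e : R, 0 < e -> exists n0 : nat,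
     forall n, (n0 <= n)%N -> nsq ipY (sm_val (u n) l - y) < e) /\ (~ inball l -> y = 0).
  have [b|nb] := pselect (inball l); last by exists 0.
  have [M M0 hM] := nsq_eval_le pK b.
  have [y hy] : exists y : Y, forall e : R, 0 < e -> exists n0 : nat,
     forall n, (n0 <= n)%N -> nsq ipY (sm_val (u n) l - y) < e.
    apply: (@hip_complete R Y (fun n => sm_val (u n) l)) => e e0.
    have e1 : 0 < e / (M + 1) by rewrite divr_gt0 //; lra.
    have [n0 h] := cau' _ e1; exists n0 => m n hm hn.
    have := hM _ (in_rkB pK (inV (u m)) (inV (u n))) => /le_lt_trans; apply.
    have := h m n hm hn; rewrite ltr_pdivlMr; last by lra.
    have := rk_nsq_ge0 pK (in_rkB pK (inV (u m)) (inV (u n))); lra.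
  by exists y.
have {lim} [f hf] := boolp.choice lim.
(* A norm bound on [u m - u n] survives the pointwise limit in [n], because each test [ev _ s]
   involves finitely many points. *)
have key e n0 : (forall m n : nat, (n0 <= m)%N -> (n0 <= n)%N ->
   N (fun l => sm_val (u m) l - sm_val (u n) l) < e) -> forall m, (n0 <= m)%N ->
   rk_bound ipY K (fun l => sm_val (u m) l - f l) e.
  move=> h m hm; apply/(rk_boundE pK) => s.
  apply: ler_eps => eta eta0.
  have [n1 h1] : exists n1 : nat, forall n, (n1 <= n)%N ->
      2 * complex.Re (ev (fun l => sm_val (u n) l - f l) s) <= eta.
    elim: s eta eta0 => [|p s IH] eta eta0.
      by exists 0%N => n _; rewrite /ev big_nil mulr0 ltW.
    have [n1 h1] := IH (eta / 2) ltac:(lra).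
    (* Chosen so that Cauchy-Schwarz gives at most [eta / 4]; the [+ 1] covers [p.2 = 0]. *)
    have e2 : 0 < (eta / 4) ^+ 2 / (nsq ipY p.2 + 1).
      by rewrite divr_gt0 ?exprn_gt0 //; have := nsq_ge0 p.2; lra.
    have [n2 h2] := (hf (sval p.1)).1 (svalP p.1) _ e2.
    exists (n1 + n2)%N => n hn.
    rewrite -cat1s ev_cat ReD ev1 -/(rip _ _).
    have := h1 n (leq_trans (leq_addr _ _) hn).
    have : rip (sm_val (u n) (sval p.1) - f (sval p.1)) p.2 <= eta / 4.
      have [//|le0] := leP (rip (sm_val (u n) (sval p.1) - f (sval p.1)) p.2) (eta / 4).
      have := rip_CS (sm_val (u n) (sval p.1) - f (sval p.1)) p.2.
      have := h2 n (leq_trans (leq_addl _ _) hn).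
      have q0 := nsq_ge0 p.2; rewrite ltr_pdivlMr; last by lra.
      have := nsq_ge0 (sm_val (u n) (sval p.1) - f (sval p.1)).
      move: le0; move: (rip _ _) (nsq _ (_ - _)) (nsq _ p.2) q0 => x a q q0 h3 h4 h5 h6.
      exfalso; nra.
    lra.
  pose n := maxn n0 n1.
  have := h1 n (leq_maxr _ _).
  have := rk_nsq_ge pK s (in_rkB pK (inV (u m)) (inV (u n))).
  have -> : ev (fun l => sm_val (u m) l - f l) s =
     ev (fun l => sm_val (u m) l - sm_val (u n) l) s + ev (fun l => sm_val (u n) l - f l) s.
    rewrite -[X in X + _]mul1r -ev_lin; apply: ev_eq => l _.
    by rewrite scale1r addrA subrK.
  have := h m n hm (leq_maxl _ _).
  rewrite ReD; lra.
have inf_ : inrk f.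
  have [n0 h] := cau' 1 ltr01.
  have hb : inrk (fun l => sm_val (u n0) l - f l) by exists 1; apply: (key _ _ h).
  apply: in_rk_eq (in_rkB pK (inV (u n0)) hb) => // l _.
  by rewrite opprB addrC subrK.
have fV : sm_pred rk_submodule f by split=> // l nb; apply: (hf l).2.
exists (sm_make fV) => e e0.
(* Half of [e], because the bound obtained in the limit is not strict. *)
have [n0 h] := cau' (e / 2) ltac:(lra); exists n0 => n hn.
rewrite spxx /=; apply: (@le_lt_trans _ _ (e / 2)); last by lra.
by apply: rk_nsq_le; apply: (key _ _ h).
Qed.

Definition rkhs_model : hilb R := Hilb sp_lin sp_sym sp_pos sp_def sp_complete.

Definition model_fun (x : rkhs_model) : pt R d -> Y := sm_val (x : V).

Lemma model_fun_in (x : rkhs_model) : inrk (model_fun x). Proof. exact: inV. Qed.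

Lemma model_fun_lin (a : C) (x y : rkhs_model) l : model_fun (a *: x + y) l = a *: model_fun x l + model_fun y l.
Proof. by []. Qed.

Lemma model_fun_off (x : rkhs_model) l : ~ inball l -> model_fun x l = 0.
Proof. by case: (sm_valP (x : V)) => _; apply. Qed.

Lemma model_fun_inj (x y : rkhs_model) : (forall l, inball l -> model_fun x l = model_fun y l) -> x = y.
Proof.
move=> h; apply: sm_val_inj; apply/funext => l.
have [b|nb] := pselect (inball l); first exact: h.
by rewrite -!/(model_fun _ l) !model_fun_off.
Qed.

Lemma model_hip (x y : rkhs_model) : hip x y = rk_ip ipY K (model_fun x) (model_fun y).
Proof. by []. Qed.

Lemma model_nsq (x : rkhs_model) : nsq (@hip R rkhs_model) x = N (model_fun x).
Proof. by rewrite /nsq /= spxx. Qed.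

Definition model_cut f : pt R d -> Y := fun l => if `[< inball l >] then f l else 0.

Lemma model_cutE f l : inball l -> model_cut f l = f l.
Proof. by rewrite /model_cut => /asboolP ->. Qed.

Lemma model_cut_pred f : inrk f -> sm_pred rk_submodule (model_cut f).
Proof.
move=> h; split; first by apply: in_rk_eq h => // l b; rewrite model_cutE.
by move=> l /asboolPn/negbTE nb; rewrite /model_cut nb.
Qed.

Definition model_elt f (h : inrk f) : rkhs_model := sm_make (model_cut_pred h).

Lemma model_eltE f (h : inrk f) l : inball l -> model_fun (model_elt h) l = f l.
Proof. exact: model_cutE. Qed.

Lemma model_nsq_elt f (hf : inrk f) : nsq (@hip R rkhs_model) (model_elt hf) = N f.
Proof. by rewrite model_nsq; apply: rk_nsq_eq => // l b; rewrite model_eltE. Qed.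

Definition model_ker (t : fam d Y) : rkhs_model := model_elt (in_rk_Kt pK t).

Lemma model_kerE t l : inball l -> model_fun (model_ker t) l = Kt K t l.
Proof. exact: model_eltE. Qed.

(** [rk_nsq_Kt] expands the norm of [x + model_ker t] with [2 Re (ev x t)] as cross term, which
    identifies the real part; scaling [t] by ['i] gives the imaginary part. *)
Lemma model_reproducing (x : rkhs_model) t : hip x (model_ker t) = ev (model_fun x) t.
Proof.
have q (t' : fam d Y) : nsq (@hip R rkhs_model) (x + model_ker t') = nsq (@hip R rkhs_model) x +
     2 * complex.Re (ev (model_fun x) t') + kq K t'.
  rewrite !model_nsq -(rk_nsq_Kt pK _ (model_fun_in x)); apply: rk_nsq_eq => // l b.
  by rewrite -model_kerE // -[x in LHS]scale1r model_fun_lin scale1r.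
have kn (t' : fam d Y) : nsq (@hip R rkhs_model) (model_ker t') = kq K t'.
  rewrite model_nsq_elt; have := rk_nsq_Kt pK t' (in_rk0 pK).
  have -> : ev (fun _ : pt R d => 0 : Y) t' = 0.
    by rewrite /ev big1 // => p _; rewrite hip0l.
  have -> : rk_nsq ipY K (fun _ => 0) = 0.
    by have := rk_nsqZ pK 0 (in_rk0 pK); rewrite csq_real expr0n mul0r => <-;
       apply: rk_nsq_eq => // l _; rewrite scaler0.
  rewrite /= mulr0 !add0r => <-; apply: rk_nsq_eq => // l _; by rewrite add0r.
have re (t' : fam d Y) : rip x (model_ker t') = complex.Re (ev (model_fun x) t').
  by have := q t'; rewrite nsqD kn; lra.
apply: complex_eqP; first exact: re.
have iker : model_ker (famZ 'i%C t) = 'i%C *: model_ker t.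
  apply: model_fun_inj => l b; rewrite model_kerE // (Kt_famZ pK) // -model_kerE //.
have := re (famZ 'i%C t); rewrite iker /rip hipZr ev_famZ.
by case: (hip _ _) => a b; case: (ev _ _) => a' b' /=; lra.
Qed.

End RKHSpace.


Section RKHSInterface.
Variables (R : realType) (d : nat) (Y : hilb R) (K : pt R d -> pt R d -> Y -> Y).
Local Notation C := R[i].
Local Notation ipY := (@hip R Y).
Local Notation N := (rk_nsq ipY K).
Local Notation inrk := (in_rk ipY K).

(** [rks_rep] speaks of any [k] that agrees with the kernel combination on the ball, so no
    particular kernel vector of the model is mentioned. *)
Record is_rkhs (H : hilb R) (fn : H -> pt R d -> Y) : Prop := IsRKHS {
  rks_lin : forall (a : C) x y l, fn (a *: x + y) l = a *: fn x l + fn y l;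
  rks_in : forall x, inrk (fn x);
  rks_inj : forall x y, (forall l, inball l -> fn x l = fn y l) -> x = y;
  rks_surj : forall f, inrk f -> exists x, forall l, inball l -> fn x l = f l;
  rks_hip : forall x y, hip x y = rk_ip ipY K (fn x) (fn y);
  rks_nsq : forall x, nsq (@hip R H) x = N (fn x);
  rks_rep : forall x k t, (forall l, inball l -> fn k l = Kt K t l) -> hip x k = ev (fn x) t }.

Hypothesis pK : pos_kernel K.

(* The concrete model is hidden behind an opaque existence proof, to keep conversion checks cheap. *)
Lemma rkhs_exists : exists p : {H : hilb R & H -> pt R d -> Y}, is_rkhs (projT2 p).
Proof.
exists (existT (fun H : hilb R => H -> pt R d -> Y) (rkhs_model pK) (@model_fun R d Y K pK)).
split => /=.
- exact: model_fun_lin.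
- exact: model_fun_in.
- exact: model_fun_inj.
- by move=> f h; exists (model_elt pK h) => l; apply: model_eltE.
- exact: model_hip.
- exact: model_nsq.
- move=> x k t h; rewrite -model_reproducing.
  have -> // : k = model_ker pK t.
  by apply: model_fun_inj => l b; rewrite model_kerE // h.
Qed.

Definition rkhs : hilb R := projT1 (sval (cid rkhs_exists)).

Definition rk_fun : rkhs -> pt R d -> Y := projT2 (sval (cid rkhs_exists)).

Lemma rkhsP : is_rkhs rk_fun.
Proof. exact: (svalP (cid rkhs_exists)). Qed.

Lemma rk_fun_lin (a : C) (x y : rkhs) l : rk_fun (a *: x + y) l = a *: rk_fun x l + rk_fun y l.
Proof. exact: (rks_lin rkhsP). Qed.

Lemma rk_fun_linl l : lin (fun x => rk_fun x l).
Proof. by move=> a x y; rewrite rk_fun_lin. Qed.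

Lemma rk_fun_sum (I : Type) (r : seq I) (F : I -> rkhs) l :
  rk_fun (\sum_(i <- r) F i) l = \sum_(i <- r) rk_fun (F i) l.
Proof. exact: (lin_sum (rk_fun_linl l)). Qed.

Lemma rk_funZ (a : C) (x : rkhs) l : rk_fun (a *: x) l = a *: rk_fun x l.
Proof. exact: (linZ (rk_fun_linl l)). Qed.

Lemma rk_funB (x y : rkhs) l : rk_fun (x - y) l = rk_fun x l - rk_fun y l.
Proof. exact: (linB (rk_fun_linl l)). Qed.

Lemma rk_fun_in (x : rkhs) : inrk (rk_fun x).
Proof. exact: (rks_in rkhsP). Qed.

Lemma rk_fun_inj (x y : rkhs) : (forall l, inball l -> rk_fun x l = rk_fun y l) -> x = y.
Proof. exact: (rks_inj rkhsP). Qed.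

Lemma rkhs_hip (x y : rkhs) : hip x y = rk_ip ipY K (rk_fun x) (rk_fun y).
Proof. exact: (rks_hip rkhsP). Qed.

Lemma rkhs_nsq (x : rkhs) : nsq (@hip R rkhs) x = N (rk_fun x).
Proof. exact: (rks_nsq rkhsP). Qed.

Definition rk_elt f (h : inrk f) : rkhs := sval (cid (rks_surj rkhsP h)).

Lemma rk_eltE f (h : inrk f) l : inball l -> rk_fun (rk_elt h) l = f l.
Proof. by move=> b; apply: (svalP (cid (rks_surj rkhsP h))). Qed.

Lemma rk_ip_elt f g (hf : inrk f) (hg : inrk g) :
  rk_ip ipY K f g = hip (rk_elt hf) (rk_elt hg).
Proof. by rewrite rkhs_hip; apply: rk_ip_eq => // l b; rewrite rk_eltE. Qed.

Lemma rk_nsq_elt f (hf : inrk f) : nsq (@hip R rkhs) (rk_elt hf) = N f.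
Proof. by rewrite rkhs_nsq; apply: rk_nsq_eq => // l b; rewrite rk_eltE. Qed.

Definition rk_ker (t : fam d Y) : rkhs := rk_elt (in_rk_Kt pK t).

Lemma rk_kerE t l : inball l -> rk_fun (rk_ker t) l = Kt K t l.
Proof. exact: rk_eltE. Qed.

Lemma rk_reproducing (x : rkhs) t : hip x (rk_ker t) = ev (rk_fun x) t.
Proof. by apply: (rks_rep rkhsP) => l; apply: rk_kerE. Qed.

Lemma rk_reproducing1 (x : rkhs) (z : bpt R d) y :
  hip x (rk_ker [:: (z, y)]) = hip (rk_fun x (sval z)) y.
Proof. by rewrite rk_reproducing ev1. Qed.

Lemma rk_ker1E (z : bpt R d) y l : inball l -> rk_fun (rk_ker [:: (z, y)]) l = K l (sval z) y.
Proof. by move=> b; rewrite rk_kerE // /Kt big_seq1. Qed.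

End RKHSInterface.

(** A substitute for the square root of [1 - W^* W]: this operator is a positive kernel on a
    one-point set, the ball for [d = 0], and [tau] sends [g] to its kernel function there. *)
Lemma defect_space (R : realType) (G X : hilb R) (W : G -> X) : lin W ->
  (forall g, nsq (@hip R X) (W g) <= nsq (@hip R G) g) ->
  exists (F : hilb R) (tau : G -> F), lin tau /\
    forall g g', hip (tau g) (tau g') = hip g g' - hip (W g) (W g').
Proof.
move=> linW cW.
have bW : bop (@hip R G) (@hip R X) W by split=> //; exists 1 => g; rewrite mul1r.
pose K (l z : pt R 0) (y : G) : G := y - adj (@hip R G) (@hip R X) W (W y).
have KE l z y y' : hip (K l z y) y' = hip y y' - hip (W y) (W y').
  by rewrite hipBl; congr (_ - _); rewrite hip_sym -(adjP bW) -hip_sym.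
have linK l z : lin (K l z).
  move=> a x y; apply: nsq_eq_hip => v; rewrite hip_sym [RHS]hip_sym; congr conjc.
  by rewrite [RHS]hipDl [in RHS]hipZl !KE linW !hipDl !hipZl; ring.
have pK : pos_kernel K.
  split.
  - by move=> l z _ _.
  - by move=> l z y y' _ _; rewrite !KE conjB -!hip_sym.
  - move=> s; rewrite /kq /kf.
    have -> : \sum_(p <- s) \sum_(p' <- s) hip (K (sval p.1) (sval p'.1) p'.2) p.2 =
       hip (K pt0 pt0 (\sum_(p <- s) p.2)) (\sum_(p <- s) p.2).
      rewrite hip_sumr; apply: eq_bigr => p _; rewrite (lin_sum (linK _ _)) hip_suml.
      by apply: eq_bigr.
    by rewrite KE ReB subr_ge0; apply: cW.
  - move=> z _; exists 1 => y; rewrite KE ReB mul1r lerBlDr lerDl; exact: nsq_ge0.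
exists (rkhs pK); pose z0 : bpt R 0 := exist _ pt0 (inball0 R 0).
exists (fun g => rk_ker pK [:: (z0, g)]); split.
  move=> a x y; apply: rk_fun_inj => l b.
  by rewrite rk_fun_lin !rk_ker1E // linK.
by move=> g g'; rewrite rk_reproducing1 rk_ker1E ?KE //; apply: inball0.
Qed.

(** * The Drury-Arveson kernel, its shifts and backward shifts *)

Section DruryArvesonKernel.
Variables (R : realType) (d : nat).
Local Notation C := R[i].
Implicit Types l z : pt R d.

Lemma dotCE l z : dotC l z = \sum_(j < d) l j * conjc (z j).
Proof. by []. Qed.

Lemma dotC_conj l z : dotC z l = conjc (dotC l z).
Proof.
rewrite !dotCE conj_sum; apply: eq_bigr => j _.
by rewrite conjM conjK mulrC.
Qed.

Lemma Re_dotC l z : 2 * complex.Re (dotC l z) <= psq l + psq z.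
Proof.
rewrite dotCE Re_sum mulr_sumr -big_split /=; apply: ler_sum => j _.
case: (l j) => a b; case: (z j) => a' b'; rewrite /csq /=.
have := sqr_ge0 (a - a'); have := sqr_ge0 (b - b'); nra.
Qed.

Lemma dotC_neq1 l z : inball l -> inball z -> 1 - dotC l z != 0.
Proof.
move=> /inballE hl /inballE hz; apply/negP => /eqP h.
have := congr1 (@complex.Re R) h; rewrite ReB /=.
by have := Re_dotC l z; lra.
Qed.

Lemma kd_mul l z : inball l -> inball z -> kd l z * (1 - dotC l z) = 1.
Proof. by move=> hl hz; rewrite /kd mulVf // dotC_neq1. Qed.

(** One step of the geometric series; positivity, the row bound for the shifts and the Gleason
    identity all reduce to it. *)
Lemma kd_rec l z : inball l -> inball z -> kd l z = 1 + dotC l z * kd l z.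
Proof. by move=> hl hz; rewrite -[X in _ = X + _](kd_mul hl hz); ring. Qed.

Lemma kd_conj l z : kd z l = conjc (kd l z).
Proof.
rewrite /kd dotC_conj [RHS]conjc_inv conjB; congr (_ - _)^-1.
by apply: complex_eqP => /=; rewrite ?oppr0.
Qed.

Lemma kd0 l : kd l pt0 = 1.
Proof.
rewrite /kd dotCE big1 ?subr0 ?invr1 // => j _.
by rewrite /pt0 conjc0 mulr0.
Qed.

(** In [1 - rho^n = (1 - rho) (1 + ... + rho^(n-1))] each of the [n] powers is at least [rho^n], so
    [rho^n <= 1 / (n (1 - rho))]. *)
Lemma expr_arbitrarily_small (rho e : R) : 0 <= rho -> rho < 1 -> 0 < e ->
  exists n : nat, rho ^+ n <= e.
Proof.
move=> r0 r1 e0.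
have key (n : nat) : n%:R * ((1 - rho) * rho ^+ n) <= 1 - rho ^+ n.
  elim: n => [|n IH]; first by rewrite mul0r expr0 subrr.
  rewrite exprS -natr1; have p0 : 0 <= rho ^+ n by apply: exprn_ge0.
  have p1 : rho * rho ^+ n <= 1 by rewrite -exprS; apply: exprn_ile1 => //; apply: ltW.
  have : rho * (n%:R * ((1 - rho) * rho ^+ n)) <= rho * (1 - rho ^+ n) by apply: ler_wpM2l.
  have : 0 <= (1 - rho) * (1 - rho * rho ^+ n) by apply: mulr_ge0; lra.
  lra.
pose n := Num.truncn (e * (1 - rho))^-1; exists n.+1.
have c0 : 0 < e * (1 - rho) by rewrite mulr_gt0 //; lra.
have h : (e * (1 - rho))^-1 < n.+1%:R by apply: truncnS_gt.
rewrite -[X in _ <= X]mulr1 -ler_pdivrMl //.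
have p0 : 0 <= rho ^+ n.+1 by apply: exprn_ge0.
have n1 : 1 - rho != 0 by rewrite gt_eqF; lra.
have en : e != 0 by rewrite gt_eqF.
have -> : e^-1 * rho ^+ n.+1 = (e * (1 - rho))^-1 * ((1 - rho) * rho ^+ n.+1).
  by field; rewrite n1 en.
apply: (@le_trans _ _ (n.+1%:R * ((1 - rho) * rho ^+ n.+1))).
  by apply: ler_wpM2r; [apply: mulr_ge0 => //; lra | exact: ltW].
by have := key n.+1; lra.
Qed.

Variable Y : hilb R.
Local Notation ipY := (@hip R Y).
Local Notation ns := (nsq ipY).

(* The form [F] of [kd] satisfies [F y = |sum_i y_i|^2 + sum_j F (conj (l_j) y)]; iterating this
   shrinks the arguments geometrically. *)
Lemma kd_positive (n : nat) (l : 'I_n -> pt R d) (ys : 'I_n -> Y) : (forall i, inball (l i)) ->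
  0 <= complex.Re (\sum_(i < n) \sum_(k < n) hip (kd (l i) (l k) *: ys k) (ys i)).
Proof.
move=> bl.
pose F (y : 'I_n -> Y) := complex.Re (\sum_(i < n) \sum_(k < n) hip (kd (l i) (l k) *: y k) (y i)).
pose E (y : 'I_n -> Y) := \sum_(i < n) ns (y i).
rewrite -/(F ys).
have E0 y : 0 <= E y by apply: sumr_ge0 => i _; apply: nsq_ge0.
have Frec y : F y = ns (\sum_(i < n) y i) + \sum_(j < d) F (fun i => conjc (l i j) *: y i).
  rewrite /F /nsq -Re_sum -ReD; congr complex.Re.
  rewrite [X in _ = _ + X]exchange_big /= hip_sumr -big_split; apply: eq_bigr => i _ /=.
  rewrite [X in _ = _ + X]exchange_big /= hip_suml -big_split; apply: eq_bigr => k _ /=.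
  under eq_bigr do rewrite !hipZl hipZr conjK.
  rewrite hipZl {1}(kd_rec (bl i) (bl k)) mulrDl mul1r; congr (_ + _).
  by rewrite dotCE !mulr_suml; apply: eq_bigr => j _; ring.
have [rho [r0 r1 hr]] : exists rho, [/\ 0 <= rho, rho < 1 & forall i, psq (l i) <= rho].
  exists (\big[Num.max/0]_(i < n) psq (l i)); split.
  - by elim/big_ind: _ => // [x y x0 y0|i _]; rewrite ?le_max ?x0 // psq_ge0.
  - elim/big_ind: _ => // [x y x0 y0|i _]; first by rewrite gt_max x0 y0.
    exact: (proj1 (inballE _) (bl i)).
  - by move=> i; apply: (@le_bigmax _ _ _ _ (fun i => psq (l i))).
have Esum y : \sum_(j < d) E (fun i => conjc (l i j) *: y i) <= rho * E y.
  rewrite /E exchange_big /= mulr_sumr; apply: ler_sum => i _.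
  under eq_bigr do rewrite nsqZ csq_conj.
  by rewrite -mulr_suml; apply: ler_wpM2r; [exact: nsq_ge0 | exact: hr].
pose B : R := \sum_(i < n) \sum_(k < n) (csq (kd (l i) (l k)) + 1).
have B0 : 0 <= B.
  by do 2!(apply: sumr_ge0 => ? _); rewrite addr_ge0 ?csq_ge0.
have nsE y i : ns (y i) <= E y.
  by rewrite /E (bigD1 i) //= lerDl sumr_ge0 // => k _; apply: nsq_ge0.
(* An a priori bound from [|a y_k + y_i|^2 >= 0]; any multiple of [E y] would do, since the
   iteration multiplies it by [rho ^+ m]. *)
have base y : - (B * E y) <= F y.
  rewrite /F Re_sum /B mulr_suml -sumrN; apply: ler_sum => i _.
  rewrite Re_sum mulr_suml -sumrN; apply: ler_sum => k _; rewrite -/(rip _ _).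
  have := nsq_ge0 (kd (l i) (l k) *: y k + y i); rewrite nsqD nsqZ.
  have := nsE y i; have := nsE y k; have c0 := csq_ge0 (kd (l i) (l k)).
  move=> /(ler_wpM2l c0); have := nsq_ge0 (y i).
  have := E0 y; have : 0 <= csq (kd (l i) (l k)) * ns (y k) by rewrite mulr_ge0 ?nsq_ge0.
  lra.
have iter (m : nat) : forall y, - (B * rho ^+ m * E y) <= F y.
  elim: m => [|m IH] y; first by rewrite expr0 mulr1.
  rewrite Frec; apply: (@le_trans _ _ (\sum_(j < d) F (fun i => conjc (l i j) *: y i))); last first.
    by rewrite lerDr nsq_ge0.
  apply: (@le_trans _ _ (\sum_(j < d) - (B * rho ^+ m * E (fun i => conjc (l i j) *: y i)))).
    rewrite sumrN -mulr_sumr lerN2.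
    have -> : B * rho ^+ m.+1 * E y = B * rho ^+ m * (rho * E y) by rewrite exprS; ring.
    by apply: ler_wpM2l; rewrite ?Esum // mulr_ge0 ?exprn_ge0.
  by apply: ler_sum => j _.
apply: (@ler_eps_mul _ _ _ (B * E ys)) => e e0.
have [m hm] := expr_arbitrarily_small r0 r1 e0.
have h1 : rho ^+ m * (B * E ys) <= e * (B * E ys) by apply: ler_wpM2r => //; rewrite mulr_ge0.
by have := iter m ys; lra.
Qed.

Lemma pos_kernel_kd : pos_kernel (@kdI R d Y).
Proof.
split.
- by move=> l z _ _ a x y; rewrite /kdI scalerDr !scalerA mulrC.
- move=> l z y y' _ _; rewrite /kdI !hipZl kd_conj conjM; congr (_ * _).
  by rewrite -hip_sym.
- move=> s; rewrite /kq.
  have -> : kf (@kdI R d Y) s s = \sum_(i < size s) \sum_(k < size s)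
      hip (kd (sval (tnth (in_tuple s) i).1) (sval (tnth (in_tuple s) k).1) *:
            (tnth (in_tuple s) k).2) (tnth (in_tuple s) i).2.
    by rewrite /kf big_tnth; apply: eq_bigr => i _; rewrite big_tnth.
  by apply: kd_positive => i; apply: (svalP (tnth (in_tuple s) i).1).
- move=> z _; exists (complex.Re (kd z z)) => y.
  by rewrite /kdI hipZl hipxx mulrC Re_realM mulrC.
Qed.

(** The adjoint of the [j]-th shift on kernel combinations: [k_z y] goes to [conj (z_j) k_z y]. *)
Definition famJ (j : 'I_d) (s : fam d Y) : fam d Y :=
  [seq (p.1, conjc (sval p.1 j) *: p.2) | p <- s].

Lemma kf_kd_rec s t : kf (@kdI R d Y) s t =
  hip (\sum_(p <- t) p.2) (\sum_(p <- s) p.2) + \sum_(j < d) kf (@kdI R d Y) (famJ j s) (famJ j t).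
Proof.
rewrite /kf; under eq_bigr do under eq_bigr do rewrite /kdI.
rewrite hip_sumr.
under [X in _ = _ + X]eq_bigr => j _ do rewrite big_map.
rewrite [X in _ = _ + X]exchange_big /= -big_split; apply: eq_bigr => p _ /=.
under [X in _ = _ + X]eq_bigr => j _ do rewrite big_map.
rewrite [X in _ = _ + X]exchange_big /= hip_suml -big_split; apply: eq_bigr => p' _ /=.
under [X in _ = _ + X]eq_bigr => j _ do rewrite /kdI !hipZl hipZr conjK.
rewrite hipZl {1}(kd_rec (svalP p.1) (svalP p'.1)) mulrDl mul1r; congr (_ + _).
by rewrite dotCE !mulr_suml; apply: eq_bigr => j _; ring.
Qed.

Lemma kq_famJ s : \sum_(j < d) kq (@kdI R d Y) (famJ j s) <= kq (@kdI R d Y) s.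
Proof.
by rewrite /kq kf_kd_rec ReD Re_sum lerDr nsq_ge0.
Qed.

Local Notation inrk := (in_rk ipY (@kdI R d Y)).
Local Notation N := (rk_nsq ipY (@kdI R d Y)).

Lemma ev_shift (f : pt R d -> Y) j s : ev (fun l => l j *: f l) s = ev f (famJ j s).
Proof. by rewrite /ev big_map; apply: eq_bigr => p _; rewrite hipZl hipZr conjK. Qed.

(** Dual to [kq_famJ]: after moving the shifts onto the test family, the supremum formula splits
    into one test for each [hs j]. *)
Lemma shift_row_bound (hs : 'I_d -> pt R d -> Y) : (forall j, inrk (hs j)) ->
  rk_bound ipY (@kdI R d Y) (fun l => \sum_(j < d) l j *: hs j l) (\sum_(j < d) N (hs j)).
Proof.
move=> h; apply/(rk_boundE pos_kernel_kd) => s.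
have -> : ev (fun l => \sum_(j < d) l j *: hs j l) s = \sum_(j < d) ev (hs j) (famJ j s).
  under [RHS]eq_bigr do rewrite -ev_shift.
  by rewrite /ev exchange_big /=; apply: eq_bigr => p _; rewrite hip_suml.
have := kq_famJ s; rewrite Re_sum mulr_sumr => q.
apply: (@le_trans _ _ (\sum_(j < d) 2 * complex.Re (ev (hs j) (famJ j s)) -
    \sum_(j < d) kq (@kdI R d Y) (famJ j s))); first by rewrite lerB.
by rewrite -sumrB; apply: ler_sum => j _; apply: (rk_nsq_ge pos_kernel_kd).
Qed.

Lemma shift_bound j f : inrk f -> rk_bound ipY (@kdI R d Y) (fun l => l j *: f l) (N f).
Proof.
move=> h; apply/(rk_boundE pos_kernel_kd) => s; rewrite ev_shift.
have := rk_nsq_ge pos_kernel_kd (famJ j s) h.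
have : kq (@kdI R d Y) (famJ j s) <= kq (@kdI R d Y) s.
  apply: le_trans (kq_famJ s); rewrite (bigD1 j) //= lerDl.
  by apply: sumr_ge0 => i _; apply: (pk_pos pos_kernel_kd).
lra.
Qed.

Definition HY : hilb R := rkhs pos_kernel_kd.
Local Notation rkf := (@rk_fun R d Y _ pos_kernel_kd).

Lemma shift_in j f : inrk f -> inrk (fun l => l j *: f l).
Proof. by move=> h; exists (N f); apply: shift_bound. Qed.

Definition shift (j : 'I_d) (x : HY) : HY := rk_elt pos_kernel_kd (shift_in j (rk_fun_in x)).

Lemma shiftE j x l : inball l -> rkf (shift j x) l = l j *: rkf x l.
Proof. exact: rk_eltE. Qed.

Lemma shift_bop j : bop (@hip R HY) (@hip R HY) (shift j).
Proof.
split.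
  move=> a x y; apply: rk_fun_inj => l b.
  by rewrite rk_fun_lin !shiftE // rk_fun_lin scalerDr !scalerA mulrC.
exists 1 => x; rewrite mul1r rk_nsq_elt rkhs_nsq; apply: rk_nsq_le.
by apply: shift_bound; apply: rk_fun_in.
Qed.

Lemma bshift_exists : exists T : 'I_d -> HY -> HY,
  (forall j x y, hip (shift j x) y = hip x (T j y)) /\ forall j, lin (T j).
Proof.
exists (fun j => adj (@hip R HY) (@hip R HY) (shift j)); split=> j.
  exact: (adjP (shift_bop j)).
exact: (adj_lin (shift_bop j)).
Qed.

Definition bshift : 'I_d -> HY -> HY := sval (cid bshift_exists).

Lemma bshiftP j x y : hip (shift j x) y = hip x (bshift j y).
Proof. exact: (proj1 (svalP (cid bshift_exists))). Qed.

Lemma bshift_lin j : lin (bshift j).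
Proof. exact: (proj2 (svalP (cid bshift_exists))). Qed.

Lemma bshift_comm i j x : bshift i (bshift j x) = bshift j (bshift i x).
Proof.
apply: nsq_eq_hip => z.
rewrite -(bshiftP i z) -(bshiftP j _ x) -(bshiftP j z) -(bshiftP i _ x).
suff -> : shift j (shift i z) = shift i (shift j z) by [].
by apply: rk_fun_inj => l b; rewrite !shiftE // !scalerA mulrC.
Qed.

(** For [v = sum_j M_j M_j^* x] one has [<v, x> = T], and the row bound gives [|v|^2 <= T];
    Cauchy-Schwarz then yields [T^2 <= T |x|^2]. *)
Lemma bshift_contr x : \sum_(j < d) nsq (@hip R HY) (bshift j x) <= nsq (@hip R HY) x.
Proof.
set T := \sum_(j < d) _.
have T0 : 0 <= T by apply: sumr_ge0 => j _; apply: nsq_ge0.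
pose v : HY := \sum_(j < d) shift j (bshift j x).
have vx : rip v x = T.
  by rewrite /rip hip_suml Re_sum; apply: eq_bigr => j _; rewrite bshiftP.
have vle : nsq (@hip R HY) v <= T.
  rewrite rkhs_nsq; apply: rk_nsq_le.
  have := shift_row_bound (fun j => rk_fun_in (bshift j x)).
  have -> : \sum_(j < d) N (rkf (bshift j x)) = T.
    by apply: eq_bigr => j _; rewrite rkhs_nsq.
  apply: (rk_bound_eq pos_kernel_kd) => l b.
  by rewrite rk_fun_sum; apply: eq_bigr => j _; rewrite shiftE.
have [->|Tn] := eqVneq T 0; first exact: nsq_ge0.
have Tp : 0 < T by rewrite lt_def Tn.
have := rip_CS v x; rewrite vx expr2 => h.
rewrite -(ler_pM2l Tp); apply: (le_trans h); apply: ler_wpM2r => //; exact: nsq_ge0.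
Qed.

(** Paired with [y], this is [k_z y - k_0 y = sum_j conj (z_j) M_j k_z y], that is, [kd_rec]. *)
Lemma bshift_gleason x z : inball z ->
  rkf x z - rkf x pt0 = \sum_(j < d) z j *: rkf (bshift j x) z.
Proof.
move=> b; apply: nsq_eq_hip => y; rewrite hip_sym [RHS]hip_sym; congr conjc.
pose zb : bpt R d := exist _ z b; pose z0 : bpt R d := exist _ pt0 (inball0 R d).
rewrite hipBl -(rk_reproducing1 _ zb) -(rk_reproducing1 _ z0) -hipBr hip_suml.
have -> : \sum_(j < d) hip (z j *: rkf (bshift j x) z) y =
    hip x (\sum_(j < d) conjc (z j) *: shift j (rk_ker pos_kernel_kd [:: (zb, y)])).
  rewrite hip_sumr; apply: eq_bigr => j _; rewrite hipZl hipZr conjK; congr (_ * _).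
  by rewrite -(rk_reproducing1 _ zb) hip_sym -bshiftP -hip_sym.
congr (hip _ _); apply: rk_fun_inj => l bl.
rewrite rk_fun_sum rk_funB !rk_ker1E // /kdI /= kd0.
under eq_bigr do rewrite rk_funZ shiftE // rk_ker1E // /kdI /= !scalerA [conjc _ * _]mulrC.
rewrite -scaler_suml -mulr_suml -dotCE.
by rewrite {1}(kd_rec bl b) scalerDl; hilb_ring.
Qed.

(** [Mstar] is an epsilon choice among functions that the adjoint relation determines only on the
    ball; agreement with [bshift] is therefore asserted there alone. *)
Lemma MstarE j f (hf : inrk f) : is_Mstar ipY j f (rkf (bshift j (rk_elt pos_kernel_kd hf))) /\
  forall l, inball l -> Mstar ipY j f l = rkf (bshift j (rk_elt pos_kernel_kd hf)) l.
Proof.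
set x := rk_elt pos_kernel_kd hf.
have is_x : is_Mstar ipY j f (rkf (bshift j x)).
  split; first exact: rk_fun_in.
  move=> h hh; rewrite (rk_ip_elt pos_kernel_kd (shift_in j hh) hf) -/x.
  rewrite (rk_ip_elt pos_kernel_kd hh (rk_fun_in (bshift j x))).
  have -> : rk_elt pos_kernel_kd (rk_fun_in (bshift j x)) = bshift j x.
    by apply: rk_fun_inj => l b; rewrite rk_eltE.
  rewrite -bshiftP; congr (hip _ _); apply: rk_fun_inj => l b.
  by rewrite shiftE // !rk_eltE.
split=> // l b.
have [gin hg] : is_Mstar ipY j f (Mstar ipY j f).
  exact: (epsilon_spec (inhabits (fun _ => 0 : Y)) (is_Mstar ipY j f)
    (ex_intro _ _ is_x)).
rewrite -(rk_eltE pos_kernel_kd gin b); congr (rk_fun _ _).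
apply: nsq_eq_hip => v.
have := hg _ (rk_fun_in v); rewrite is_x.2; last exact: rk_fun_in.
rewrite -rkhs_hip => ->; rewrite rkhs_hip.
by apply: (rk_ip_eq pos_kernel_kd) => // l' b'; rewrite rk_eltE.
Qed.

End DruryArvesonKernel.

(** * The kernel [K_S] and contractive multipliers *)

Section DeBrangesRovnyak.
Variables (R : realType) (d : nat) (U Y : hilb R) (S : pt R d -> U -> Y).
Local Notation C := R[i].
Hypothesis bS : forall l, inball l -> bop (@hip R U) (@hip R Y) (S l).
Local Notation Ss := (fun z => adj (@hip R U) (@hip R Y) (S z)).
Local Notation KK := (KS (@hip R U) (@hip R Y) S).
Local Notation kdY := (@kdI R d Y).
Local Notation kdU := (@kdI R d U).

Lemma hip_KS l z y y' : inball l ->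
  hip (KK l z y) y' = kd l z * (hip y y' - hip (Ss z y) (Ss l y')).
Proof. by move=> bl; rewrite /KS hipZl hipBl (adjP (bS bl)). Qed.

(** The adjoint of multiplication by [S] on kernel combinations: [k_z y] goes to [k_z (Ss z y)]. *)
Definition fam_adj (s : fam d Y) : fam d U := [seq (p.1, Ss (sval p.1) p.2) | p <- s].

Lemma kf_KS s t : kf KK s t = kf kdY s t - kf kdU (fam_adj s) (fam_adj t).
Proof.
rewrite /kf big_map -sumrB; apply: eq_bigr => p _; rewrite big_map -sumrB.
apply: eq_bigr => p' _ /=; rewrite hip_KS; last exact: (svalP p.1).
by rewrite /kdI !hipZl mulrBr.
Qed.

Lemma kq_KS s : kq KK s = kq kdY s - kq kdU (fam_adj s).
Proof. by rewrite /kq kf_KS ReB. Qed.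

Lemma ev_mult (f : pt R d -> U) s : ev (fun l => S l (f l)) s = ev f (fam_adj s).
Proof.
by rewrite /ev big_map; apply: eq_bigr => p _; rewrite (adjP (bS (svalP p.1))).
Qed.

(** Multiply the kernel combination of [fam_adj s] by [S] and test the product on [s]: this gives
    [Q^2 <= Q * kq s], where [Q] is the left side of the claim. *)
Lemma mult_contr_pos : mult_contr (@hip R U) (@hip R Y) S ->
  forall s, kq kdU (fam_adj s) <= kq kdY s.
Proof.
move=> mc s; set t := fam_adj s; set Q := kq kdU t.
have Q0 : 0 <= Q := pk_pos (pos_kernel_kd d U) t.
have [hin hle] := mc _ (in_rk_Kt (pos_kernel_kd d U) t).
have gle : rk_nsq (@hip R U) kdU (Kt kdU t) <= Q.
  apply: rk_nsq_le; apply/(rk_bound_csq (pos_kernel_kd d U)); split=> // s'.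
  by rewrite ev_Kt kf_CS //; apply: pos_kernel_kd.
have := ev_csq (pos_kernel_kd d Y) s hin.
rewrite ev_mult ev_Kt (kfxx (pos_kernel_kd d U)) csq_real -/t -/Q => h.
have [->|Qn] := eqVneq Q 0; first exact: (pk_pos (pos_kernel_kd d Y)).
have Qp : 0 < Q by rewrite lt_def Qn.
rewrite -(ler_pM2l Qp) -expr2; apply: (le_trans h); apply: ler_wpM2r.
  exact: (pk_pos (pos_kernel_kd d Y)).
exact: (le_trans hle gle).
Qed.

Hypothesis posS : forall s, kq kdU (fam_adj s) <= kq kdY s.

Lemma pos_mult_contr : mult_contr (@hip R U) (@hip R Y) S.
Proof.
move=> f hf.
have h : rk_bound (@hip R Y) kdY (fun l => S l (f l)) (rk_nsq (@hip R U) kdU f).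
  apply/(rk_boundE (pos_kernel_kd d Y)) => s; rewrite ev_mult.
  have := rk_nsq_ge (pos_kernel_kd d U) (fam_adj s) hf; have := posS s; lra.
by split; [exists (rk_nsq (@hip R U) kdU f) | apply: rk_nsq_le].
Qed.

Lemma pos_kernel_KS : pos_kernel KK.
Proof.
split.
- move=> l z bl bz a x y; rewrite /KS (adj_lin (bS bz)) (proj1 (bS bl)); hilb_ring.
- move=> l z y y' bl bz; rewrite !hip_KS // kd_conj conjM conjB; congr (_ * (_ - _)).
    by rewrite -hip_sym.
  by rewrite -hip_sym.
- by move=> s; rewrite kq_KS subr_ge0.
- move=> z bz; have [M hM] := pk_bd (pos_kernel_kd d Y) bz; exists M => y.
  apply: le_trans (hM y); pose p : bpt R d * Y := (exist _ z bz, y).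
  have : kq KK [:: p] <= kq kdY [:: p].
    by rewrite kq_KS lerBlDr lerDl (pk_pos (pos_kernel_kd d U)).
  by rewrite /kq /kf !big_seq1.
Qed.

(** The form of [K_S] lies below that of [k_d], and subtracting a smaller form makes the supremum in
    [rk_boundE] larger; so [H(K_S)] sits contractively in [H(k_d)]. *)
Lemma rk_bound_KS_kd f c : rk_bound (@hip R Y) KK f c -> rk_bound (@hip R Y) kdY f c.
Proof.
move/(rk_boundE pos_kernel_KS) => h; apply/(rk_boundE (pos_kernel_kd d Y)) => s.
have := h s; rewrite kq_KS; have := pk_pos (pos_kernel_kd d U) (fam_adj s); lra.
Qed.

Lemma in_rk_KS_kd f : in_rk (@hip R Y) KK f -> in_rk (@hip R Y) kdY f.
Proof. by move=> [c /rk_bound_KS_kd h]; exists c. Qed.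

End DeBrangesRovnyak.

(** * Realization on the functional model [H(K_S)] *)

Section FunctionalModel.
Variables (R : realType) (d : nat) (U Y : hilb R) (S : pt R d -> U -> Y).
Local Notation C := R[i].
Local Notation ipU := (@hip R U).
Local Notation ipY := (@hip R Y).
Local Notation Ss := (fun z => adj ipU ipY (S z)).
Local Notation KK := (KS ipU ipY S).
Hypothesis bS : forall l, inball l -> bop ipU ipY (S l).
Hypothesis posS : forall s, kq (@kdI R d U) (fam_adj S s) <= kq (@kdI R d Y) s.
Local Notation pKS := (pos_kernel_KS bS posS).
Local Notation pkd := (pos_kernel_kd d Y).
Local Notation X := (rkhs pKS).
Local Notation xf := (@rk_fun R d Y _ pKS).
Local Notation hf := (@rk_fun R d Y _ pkd).

Variables (emb : X -> HY d Y) (A : 'I_d -> X -> X).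
Hypothesis embE : forall x l, inball l -> hf (emb x) l = xf x l.
Hypothesis emb_A : forall j x, emb (A j x) = bshift j (emb x).
Hypothesis AC_contr : forall x,
  \sum_(j < d) nsq (@hip R X) (A j x) + nsq ipY (xf x pt0) <= nsq (@hip R X) x.

Let emb_inj x y : emb x = emb y -> x = y.
Proof. by move=> h; apply: rk_fun_inj => l b; rewrite -!embE // h. Qed.

Let emb_lin : lin emb.
Proof. by move=> a x y; apply: rk_fun_inj => l b; rewrite rk_fun_lin !embE // rk_fun_lin. Qed.

Let A_lin j : lin (A j).
Proof.
by move=> a x y; apply: emb_inj; rewrite emb_lin !emb_A emb_lin (bshift_lin j).
Qed.

Let A_comm i j x : A i (A j x) = A j (A i x).
Proof. by apply: emb_inj; rewrite !emb_A bshift_comm. Qed.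

Let A_gleason x z : inball z -> xf x z - xf x pt0 = \sum_(j < d) z j *: xf (A j x) z.
Proof.
move=> b; have := bshift_gleason (emb x) b; rewrite !embE //; last exact: inball0.
by move=> ->; apply: eq_bigr => j _; rewrite -emb_A embE.
Qed.

Let Cc (x : X) : Y := xf x pt0.

Let Cc_lin : lin Cc. Proof. exact: rk_fun_linl. Qed.

Let G := hprod (hpow d X) Y.

Let V (x : X) : G := ([ffun j => A j x], Cc x).

Let nsqG (g : G) : nsq (@hip R G) g = \sum_(j < d) nsq (@hip R X) (g.1 j) + nsq ipY g.2.
Proof. by rewrite nsq_pair nsq_pw. Qed.

Let hipG (g g' : G) : hip g g' = \sum_(j < d) hip (g.1 j) (g'.1 j) + hip g.2 g'.2.
Proof. by []. Qed.

Let V_lin : lin V.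
Proof.
move=> a x y; rewrite /V Cc_lin; congr (_, _); apply/ffunP => j.
by rewrite !ffunE A_lin.
Qed.

Let V_contr x : nsq (@hip R G) (V x) <= nsq (@hip R X) x.
Proof.
rewrite nsqG /=; under eq_bigr do rewrite ffunE.
exact: AC_contr.
Qed.

Let V_bop : bop (@hip R X) (@hip R G) V.
Proof. by split=> //; exists 1 => x; rewrite mul1r. Qed.

Let W := adj (@hip R X) (@hip R G) V.

Let W_contr g : nsq (@hip R X) (W g) <= nsq (@hip R G) g.
Proof.
rewrite -[X in _ <= X]mul1r; apply: adj_bound => // x.
by rewrite mul1r.
Qed.

Let ker (z : bpt R d) y : X := rk_ker pKS [:: (z, y)].

Let ker_lin z : lin (ker z).
Proof.
move=> a x y; apply: rk_fun_inj => l b; rewrite rk_fun_lin !rk_ker1E //.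
exact: (pk_lin pKS b (svalP z)).
Qed.

Let vv (z : bpt R d) (y : Y) : G := ([ffun j => conjc (sval z j) *: ker z y], y).

Let vv_lin z : lin (vv z).
Proof.
move=> a x y; rewrite /vv ker_lin; congr (_, _); apply/ffunP => j.
by rewrite !ffunE scalerDr !scalerA mulrC.
Qed.

Let W_vv z y : W (vv z y) = ker z y.
Proof.
apply: adj_uniq => // x; rewrite hipG /= rk_reproducing1.
under eq_bigr do rewrite !ffunE hipZr conjK rk_reproducing1 -hipZl.
by rewrite -hip_suml -(A_gleason x (svalP z)) -(hipDl _ (Cc x)) subrK.
Qed.

Let vv_gram z y z' y' :
  hip (vv z y) (vv z' y') - hip (ker z y) (ker z' y') = hip (Ss (sval z) y) (Ss (sval z') y').
Proof.
have bz := svalP z; have bz' := svalP z'.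
rewrite hipG /=; under eq_bigr do rewrite !ffunE hipZl hipZr conjK mulrA [conjc _ * _]mulrC.
rewrite -mulr_suml -dotCE rk_reproducing1 rk_ker1E // hip_KS //.
move: (hip y y') (hip (Ss _ y) _) => a b.
have -> : dotC (sval z') (sval z) * (kd (sval z') (sval z) * (a - b)) + a -
   kd (sval z') (sval z) * (a - b) = a - (kd (sval z') (sval z) * (1 - dotC (sval z') (sval z))) * (a - b).
  by ring.
by rewrite kd_mul // mul1r opprB addrC subrK.
Qed.

Lemma model_has_ccr : has_ccr S.
Proof.
have W_lin : lin W := adj_lin V_bop.
have [F [tau [tau_lin tauE]]] := defect_space W_lin W_contr.
have tau_nsq g : nsq (@hip R F) (tau g) = nsq (@hip R G) g - nsq (@hip R X) (W g).
  by rewrite /nsq tauE ReB.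
have tau_bop : bop (@hip R G) (@hip R F) tau.
  by split=> //; exists 1 => g; rewrite mul1r tau_nsq lerBlDr lerDl nsq_ge0.
(* Sums of pairs of [tau (vv z y)] and [S(z)^* y]; by [vv_gram] the relation is isometric, which
   supplies the bound with constant 1. *)
pose Gr (a : F) (w : U) := exists s : fam d Y,
  a = \sum_(p <- s) tau (vv p.1 p.2) /\ w = \sum_(p <- s) Ss (sval p.1) p.2.
have [T0 [T0_lin T0E T0_contr]] : exists T : U -> F, [/\ lin T,
   forall v w u, Gr v w -> hip v (T u) = hip w u & forall u, nsq (@hip R F) (T u) <= 1 * nsq ipU u].
  apply: rel_adjoint => //.
  - by exists [::]; rewrite !big_nil.
  - move=> a _ _ _ _ [s [-> ->]] [s' [-> ->]]; exists (famZ a s ++ s').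
    rewrite !big_cat /= !big_map !scaler_sumr; split; congr (_ + _); apply: eq_bigr => p _ /=.
      by rewrite (linZ (vv_lin _)) (linZ tau_lin).
    by rewrite (linZ (adj_lin (bS (svalP p.1)))).
  - move=> _ _ [s [-> ->]]; rewrite mul1r /nsq le_eqVlt; apply/orP; left; apply/eqP.
    congr complex.Re; rewrite !hip_suml; apply: eq_bigr => p _; rewrite !hip_sumr.
    by apply: eq_bigr => p' _; rewrite tauE !W_vv vv_gram.
(* [BD] is [tau^* T0]: its adjoint sends [vv z y] to [S(z)^* y], which is the realization formula
   tested on kernel vectors. *)
pose BD u : G := adj (@hip R G) (@hip R F) tau (T0 u).
have BDE g u : hip (tau g) (T0 u) = hip g (BD u) by apply: adjP.
have BD_lin : lin BD by move=> a x y; rewrite /BD T0_lin (adj_lin tau_bop).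
(* With [g = V x + BD u], [|g|^2] is the real part of [<x, W g> + <T0 u, tau g>], while
   [|W g|^2 + |tau g|^2 = |g|^2]; AM-GM on both products leaves the claim. *)
have contr x u : nsq (@hip R G) (V x + BD u) <= nsq (@hip R X) x + nsq ipU u.
  set g := V x + BD u.
  have e : nsq (@hip R G) g = rip x (W g) + rip (T0 u) (tau g).
    rewrite nsq_rip {1}/g ripDl; congr (_ + _); first by rewrite /rip (adjP V_bop).
    by rewrite ripC /rip -BDE -/(rip _ _) ripC.
  have h1 := amgm (nsq_ge0 x) (nsq_ge0 (W g)) (rip_CS x (W g)).
  have h2 := amgm (nsq_ge0 (T0 u)) (nsq_ge0 (tau g)) (rip_CS (T0 u) (tau g)).
  have := T0_contr u; rewrite mul1r; move: h2; rewrite tau_nsq; lra.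
pose B j u : X := (BD u).1 j; pose D u : Y := (BD u).2.
have B_lin j : lin (B j) by move=> a x y; rewrite /B BD_lin /= !ffunE.
have D_lin : lin D by move=> a x y; rewrite /D BD_lin.
have colE x u : \sum_(j < d) nsq (@hip R X) (A j x + B j u) + nsq ipY (Cc x + D u) =
    nsq (@hip R G) (V x + BD u).
  by rewrite nsqG /=; congr (_ + _); apply: eq_bigr => j _; rewrite !ffunE.
have BD_contr u : \sum_(j < d) nsq (@hip R X) (B j u) + nsq ipY (D u) <= nsq ipU u.
  have := contr 0 u; rewrite -colE nsq0 add0r (lin0 Cc_lin) add0r.
  by under eq_bigr do rewrite (lin0 (A_lin _)) add0r.
have sumge0 (w : 'I_d -> X) : 0 <= \sum_(j < d) nsq (@hip R X) (w j).
  by apply: sumr_ge0 => j _; apply: nsq_ge0.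
have termle (w : 'I_d -> X) j : nsq (@hip R X) (w j) <= \sum_(j < d) nsq (@hip R X) (w j).
  by rewrite (bigD1 j) //= lerDl; apply: sumr_ge0 => i _; apply: nsq_ge0.
have A_contr x : \sum_(j < d) nsq (@hip R X) (A j x) <= nsq (@hip R X) x.
  by apply: le_trans (AC_contr x); rewrite lerDl nsq_ge0.
have SE l u : inball l -> S l u = \sum_(j < d) l j *: xf (B j u) l + D u.
  move=> b; apply: nsq_eq_hip => y; pose lb : bpt R d := exist _ l b.
  have -> : hip y (S l u) = hip (Ss l y) u by rewrite hip_sym (adjP (bS b)) -hip_sym.
  have <- : hip (tau (vv lb y)) (T0 u) = hip (Ss l y) u.
    by apply: T0E; exists [:: (lb, y)]; rewrite !big_seq1.
  rewrite BDE hipG /= hipDr hip_sumr; congr (_ + _); apply: eq_bigr => j _.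
  by rewrite ffunE hipZl hipZr hip_sym rk_reproducing1 -hip_sym.
exists X, A, B, Cc, D; split; [|split; [|split; [|split; [|split; [|split]]]]].
- move=> j; split; first exact: A_lin.
  exists 1 => x; rewrite mul1r; have h := termle (fun j => A j x) j.
  exact: le_trans h (A_contr x).
- move=> j; split; first exact: B_lin.
  exists 1 => u; rewrite mul1r; apply: le_trans (BD_contr u).
  by have h := termle (fun j => B j u) j; apply: (le_trans h); rewrite lerDl nsq_ge0.
- split=> //; exists 1 => x; rewrite mul1r; apply: le_trans (AC_contr x).
  by rewrite lerDr.
- split=> //; exists 1 => u; rewrite mul1r; apply: le_trans (BD_contr u).
  by rewrite lerDr.
- by move=> x u; rewrite colE.
- exact: A_comm.
- move=> l b; split; first exact: (Q_inj A_lin A_contr b).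
  move=> u; exists (res A l (\sum_(j < d) l j *: B j u)).
  have eq := resK A_lin A_contr (\sum_(j < d) l j *: B j u) b.
  split; first exact: eq.
  (* Evaluate [x - Z(l) A x = Z(l) B u] at [l]: the Gleason identity collapses the left side to
     [x(0) = Cc x]. *)
  have := congr1 (fun x => xf x l) eq; rewrite rk_funB !rk_fun_sum SE //.
  set x := res _ _ _ => h.
  have e1 : \sum_(j < d) l j *: xf (B j u) l = \sum_(j < d) xf (l j *: B j u) l.
    by apply: eq_bigr => j _; rewrite rk_funZ.
  have e2 : \sum_(j < d) xf (l j *: A j x) l = xf x l - xf x pt0.
    by rewrite A_gleason //; apply: eq_bigr => j _; rewrite rk_funZ.
  by rewrite e1 -h e2 /Cc; hilb_ring.
Qed.

End FunctionalModel.

(** [A j] is [Mstar j] read on [H(K_S)], where invariance lets it act; the inclusion [emb] into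
    [H(k_d)] passes linearity, commutation and the Gleason identity of [bshift] on to it. *)
Lemma functional_model (R : realType) (d : nat) (U Y : hilb R) (S : pt R d -> U -> Y) :
  let KK := KS (@hip R U) (@hip R Y) S in
  (forall l, inball l -> bop (@hip R U) (@hip R Y) (S l)) ->
  mult_contr (@hip R U) (@hip R Y) S ->
  (forall f, in_rk (@hip R Y) KK f -> forall j, in_rk (@hip R Y) KK (Mstar (@hip R Y) j f)) ->
  (forall f, in_rk (@hip R Y) KK f -> \sum_(j < d) rk_nsq (@hip R Y) KK (Mstar (@hip R Y) j f)
      <= rk_nsq (@hip R Y) KK f - nsq (@hip R Y) (f pt0)) ->
  has_ccr S.
Proof.
move=> KK bS mc invM ineqM; have posS := mult_contr_pos bS mc.
pose pKS := pos_kernel_KS bS posS; pose pkd := pos_kernel_kd d Y.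
pose inx (x : rkhs pKS) := in_rk_KS_kd bS posS (rk_fun_in x).
pose emb (x : rkhs pKS) : HY d Y := rk_elt pkd (inx x).
pose A j (x : rkhs pKS) : rkhs pKS := rk_elt pKS (invM _ (rk_fun_in x) j).
have embE x l : inball l -> rk_fun (emb x) l = rk_fun x l by move=> b; rewrite rk_eltE.
apply: (@model_has_ccr R d U Y S bS posS emb A embE).
- move=> j x; apply: rk_fun_inj => l b; rewrite embE // rk_eltE //.
  exact: (proj2 (MstarE j (inx x))).
- move=> x; have := ineqM _ (rk_fun_in x); rewrite -rkhs_nsq lerBrDr.
  suff -> : \sum_(j < d) nsq (@hip R (rkhs pKS)) (A j x) =
    \sum_(j < d) rk_nsq (@hip R Y) KK (Mstar (@hip R Y) j (rk_fun x)) by [].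
  by apply: eq_bigr => j _; rewrite rk_nsq_elt.
Qed.

Section BoundedOperators.
Variable R : realType.
Local Notation C := R[i].

Lemma bopD (V W : hilb R) (T T' : V -> W) :
  bop (@hip R V) (@hip R W) T -> bop (@hip R V) (@hip R W) T' ->
  bop (@hip R V) (@hip R W) (fun x => T x + T' x).
Proof.
move=> [l [M h]] [l' [M' h']]; split; first by move=> a x y; rewrite l l'; hilb_ring.
exists (2 * M + 2 * M') => x; apply: (le_trans (nsqD_le2 _ _)).
by have := h x; have := h' x; lra.
Qed.

Lemma bopZ (V W : hilb R) (T : V -> W) (a : C) :
  bop (@hip R V) (@hip R W) T -> bop (@hip R V) (@hip R W) (fun x => a *: T x).
Proof.
move=> [l [M h]]; split; first by move=> b x y; rewrite l; hilb_ring.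
exists (csq a * M) => x; rewrite nsqZ -mulrA; apply: ler_wpM2l => //; exact: csq_ge0.
Qed.

Lemma bop0 (V W : hilb R) : bop (@hip R V) (@hip R W) (fun _ => 0).
Proof.
split; first by move=> a x y; rewrite scaler0 addr0.
by exists 0 => x; rewrite nsq0 mul0r.
Qed.

Lemma bop_sum (V W : hilb R) (I : Type) (r : seq I) (T : I -> V -> W) :
  (forall i, bop (@hip R V) (@hip R W) (T i)) ->
  bop (@hip R V) (@hip R W) (fun x => \sum_(i <- r) T i x).
Proof.
move=> h; elim: r => [|i r IH].
  have -> : (fun x => \sum_(i <- [::]) T i x) = (fun _ => 0) :> (V -> W).
    by apply/funext => x; rewrite big_nil.
  exact: bop0.
have -> : (fun x => \sum_(k <- i :: r) T k x) = (fun x => T i x + \sum_(k <- r) T k x).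
  by apply/funext => x; rewrite big_cons.
exact: bopD.
Qed.

Lemma bop_comp (V W X : hilb R) (T : V -> W) (T' : W -> X) :
  bop (@hip R V) (@hip R W) T -> bop (@hip R W) (@hip R X) T' ->
  bop (@hip R V) (@hip R X) (fun x => T' (T x)).
Proof.
move=> [l [M h]] b'; have [l' _] := b'; have [M' M0' h'] := bop_ge0 b'.
split; first by move=> a x y; rewrite l l'.
exists (M' * M) => x; apply: (le_trans (h' _)); rewrite -mulrA; exact: ler_wpM2l.
Qed.

End BoundedOperators.

(** * Coisometric colligations with commuting state operators *)

Section CoisometricColligation.
Variables (R : realType) (d : nat) (X U Y : hilb R).
Local Notation C := R[i].
Local Notation ipX := (@hip R X).
Local Notation ipU := (@hip R U).
Local Notation ipY := (@hip R Y).
Variables (A : 'I_d -> X -> X) (B : 'I_d -> U -> X) (Cc : X -> Y) (D : U -> Y).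
Variable S : pt R d -> U -> Y.
Hypothesis linA : forall j, lin (A j).
Hypothesis bB : forall j, bop ipU ipX (B j).
Hypothesis bC : bop ipX ipY Cc.
Hypothesis bD : bop ipU ipY D.
Hypothesis AC_contr : forall x, \sum_(j < d) nsq ipX (A j x) + nsq ipY (Cc x) <= nsq ipX x.
Hypothesis commA : forall i j (x : X), A i (A j x) = A j (A i x).
Local Notation Gm := (Gam A Cc).
Local Notation Zb := (fun (l : pt R d) u => \sum_(j < d) l j *: B j u).
Hypothesis SE : forall l u, inball l -> S l u = D u + Gm l (Zb l u).

(* Isometry of the adjoint of the colligation, with adjoint vectors given by their defining property. *)
Hypothesis coisometric : forall (w w' : 'I_d -> X) (y y' : Y) (a a' : X) (u u' : U),
  (forall x v, \sum_(j < d) hip (A j x + B j v) (w j) + hip (Cc x + D v) y = hip x a + hip v u) ->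
  (forall x v, \sum_(j < d) hip (A j x + B j v) (w' j) + hip (Cc x + D v) y' = hip x a' + hip v u') ->
  hip a a' + hip u u' = \sum_(j < d) hip (w j) (w' j) + hip y y'.

Let contrA x : \sum_(j < d) nsq ipX (A j x) <= nsq ipX x.
Proof. by apply: le_trans (AC_contr x); rewrite lerDl nsq_ge0. Qed.

Let bA j : bop ipX ipX (A j).
Proof.
split; first exact: linA.
by exists 1 => x; rewrite mul1r; apply: (nsq_A contrA).
Qed.

Let bRes l : inball l -> bop ipX ipX (res A l).
Proof.
move=> b; split; first exact: (res_lin linA contrA).
by exists (res_const (psq l)) => x; apply: (nsq_res linA contrA).
Qed.

Let bZb l : bop ipU ipX (Zb l).
Proof. by apply: bop_sum => j; apply: bopZ; apply: bB. Qed.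

Let bGm l : inball l -> bop ipX ipY (Gm l).
Proof. exact: (Gam_bop linA contrA bC). Qed.

Lemma coiso_bop l : inball l -> bop ipU ipY (S l).
Proof.
move=> b.
have h : bop ipU ipY (fun u => D u + Gm l (Zb l u)).
  by apply: (bopD bD); apply: (bop_comp (bZb l)); apply: bGm.
have -> // : S l = fun u => D u + Gm l (Zb l u).
by apply/funext => u; apply: SE.
Qed.

(** The derivative in direction [j] is [Gam l0 (A_j x0 + B_j u)], with [x0] the state at [l0]. Two
    resolvent differences show the remainder to be quadratic in [dl], so its squared norm is
    [O(|dl|^4)]. *)
Lemma coiso_holo : holo ipU ipY S.
Proof.
move=> l0 b0; have r1 := proj1 (inballE l0) b0; set rho := psq l0 in r1.
pose x0 u := res A l0 (Zb l0 u).
have bx0 : bop ipU ipX x0 by apply: (bop_comp (bZb l0)); apply: bRes.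
pose w j u := A j (x0 u) + B j u.
have bw j : bop ipU ipX (w j).
  by apply: bopD; [apply: (bop_comp bx0); apply: bA | apply: bB].
exists (fun j u => Gm l0 (w j u)); split.
  by move=> j; apply: (bop_comp (bw j)); apply: bGm.
move=> e e0.
have [Mc Mc0 hMc] := bop_ge0 bC.
have hw j : exists M : R, 0 <= M /\ forall u, nsq ipX (w j u) <= M * nsq ipU u.
  by have [M ? ?] := bop_ge0 (bw j); exists M.
have [Mw hMw] := boolp.choice hw.
pose k0 := res_const rho; pose k1 := res_const ((1 + rho) / 2).
pose KK := Mc * (k1 * (k0 * \sum_(j < d) Mw j)).
have k00 : 0 <= k0 by apply: res_const_ge0.
have k10 : 0 <= k1 by apply: res_const_ge0.
have sM0 : 0 <= \sum_(j < d) Mw j by apply: sumr_ge0 => j _; case: (hMw j).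
have KK0 : 0 <= KK by do 3!(apply: mulr_ge0 => //).
pose eps := (1 - rho) / 6.
have eps0 : 0 < eps by rewrite divr_gt0 // subr_gt0.
(* [eps ^+ 2] keeps [l] within squared radius [(1 + rho) / 2]; the other bound gives
   [KK * psq dl <= e], the [+ 1] guarding against [KK = 0]. *)
exists (Num.min (eps ^+ 2) (e / (KK + 1))); split.
  rewrite lt_min exprn_gt0 //= divr_gt0 //; lra.
move=> l b; rewrite psqE lt_min => /andP[d1 d2] u.
pose dl : pt R d := fun j => l j - l0 j.
rewrite -/dl in d1 d2; have pd0 := psq_ge0 dl.
have pl : psq l <= (1 + rho) / 2.
  have -> : l = fun j => l0 j + dl j by apply/funext => j; rewrite /dl addrC subrK.
  by apply: (@psq_near _ _ rho eps) => //; apply: ltW.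
have rho1 : (1 + rho) / 2 < 1 by lra.
pose v := \sum_(j < d) dl j *: w j u.
have linC : lin Cc by case: bC.
have e1 : res A l (Zb l u) - x0 u = res A l v.
  apply: (res_uniq linA contrA b); rewrite (linB (@ZA_lin _ _ _ _ linA l)).
  have h1 := resK linA contrA (Zb l u) b; have h2 := resK linA contrA (Zb l0 u) b0.
  rewrite -/(x0 u) in h2.
  have ve : v = ZA A l (x0 u) - ZA A l0 (x0 u) + (Zb l u - Zb l0 u).
    rewrite -ZA_sub -sumrB /ZA -big_split; apply: eq_bigr => j _ /=.
    by rewrite /w /dl scalerDr !scalerBl.
  by rewrite ve -[in RHS]h1 -[in RHS]h2; hilb_ring.
have rem : S l u - S l0 u - \sum_(j < d) dl j *: Gm l0 (w j u) =
    Cc (res A l (ZA A dl (res A l0 v))).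
  have -> : \sum_(j < d) dl j *: Gm l0 (w j u) = Cc (res A l0 v).
    rewrite /v /Gam (lin_sum (res_lin linA contrA b0)) (lin_sum linC).
    by apply: eq_bigr => j _; rewrite (linZ (res_lin linA contrA b0)) (linZ linC).
  rewrite !SE // -(res_diff linA contrA) // (linB linC) -e1 (linB linC) /Gam -/(x0 u).
  by hilb_ring.
rewrite rem.
have b1 : nsq ipY (Cc (res A l (ZA A dl (res A l0 v)))) <=
    Mc * (k1 * (psq dl * (k0 * (psq dl * ((\sum_(j < d) Mw j) * nsq ipU u))))).
  apply: (le_trans (hMc _)); apply: ler_wpM2l => //.
  apply: (le_trans (nsq_res_le linA contrA _ pl rho1)); apply: ler_wpM2l => //.
  apply: (le_trans (nsq_ZA contrA _ _)); apply: ler_wpM2l => //.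
  apply: (le_trans (nsq_res_le linA contrA _ (lexx rho) r1)); apply: ler_wpM2l => //.
  apply: (le_trans (nsq_row _ _)); apply: ler_wpM2l => //.
  by rewrite mulr_suml; apply: ler_sum => j _; case: (hMw j).
apply: (le_trans b1).
have -> : Mc * (k1 * (psq dl * (k0 * (psq dl * ((\sum_(j < d) Mw j) * nsq ipU u))))) =
   KK * psq dl * psq dl * nsq ipU u by rewrite /KK; ring.
apply: ler_wpM2r; first exact: nsq_ge0.
apply: ler_wpM2r => //.
have : psq dl * (KK + 1) <= e by rewrite -ler_pdivlMr ?ltW //; lra.
lra.
Qed.

Local Notation gs := (fun l => adj ipX ipY (Gm l)).
Local Notation Ss := (fun l => adj ipU ipY (S l)).

Let gsP l x y : inball l -> hip (Gm l x) y = hip x (gs l y).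
Proof. by move=> b; apply: (adjP (bGm b)). Qed.

(** Dual to [Gam l (Z(l) A x) + Cc x = Gam l x] and [Gam l (Z(l) B v) + D v = S l v]: the adjoint
    colligation carries the column of the [conj (l_j) gs l y], together with [y], to [gs l y] and
    [Ss l y]. *)
Let adj_col l y : inball l -> forall x v,
  \sum_(j < d) hip (A j x + B j v) (conjc (l j) *: gs l y) + hip (Cc x + D v) y =
  hip x (gs l y) + hip v (Ss l y).
Proof.
move=> b x v.
under eq_bigr do rewrite hipZr conjK -hipZl.
rewrite -hip_suml -gsP // -[X in _ = X + _]gsP // -(adjP (coiso_bop b)) -!hipDl; congr (hip _ _).
have -> : \sum_(j < d) l j *: (A j x + B j v) = ZA A l x + Zb l v.
  by rewrite /ZA -big_split; apply: eq_bigr => j _; rewrite scalerDr.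
rewrite SE // (linD (proj1 (bGm b))).
have -> : Gm l (ZA A l x) = Gm l x - Cc x.
  rewrite /Gam -(linB (proj1 bC)); congr (Cc _).
  by rewrite -[X in _ - X](Kres linA contrA x b) (linB (res_lin linA contrA b)) opprB addrC subrK.
by hilb_ring.
Qed.

(** Two columns of [adj_col] in [coisometric] give [h + <Ss z y, Ss l y'> = <l, z> h + <y, y'>];
    solving for [h] yields the kernel. *)
Lemma coiso_KS l z y y' : inball l -> inball z ->
  hip (KS ipU ipY S l z y) y' = hip (gs z y) (gs l y').
Proof.
move=> bl bz; rewrite (hip_KS coiso_bop) //.
have := coisometric (adj_col y bz) (adj_col y' bl).
under eq_bigr do rewrite hipZl hipZr conjK mulrA [conjc _ * _]mulrC.
rewrite -mulr_suml -dotCE; move: (hip (gs z y) _) => h e.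
have -> : hip y y' - hip (Ss z y) (Ss l y') = (1 - dotC l z) * h.
  by rewrite mulrBl mul1r; apply/eqP; rewrite subr_eq addrAC eq_sym subr_eq e addrC.
by rewrite mulrA kd_mul // mul1r.
Qed.

Let fs (s : fam d Y) : X := \sum_(p <- s) gs (sval p.1) p.2.

Let kf_fs s t : kf (KS ipU ipY S) s t = hip (fs t) (fs s).
Proof.
rewrite /fs hip_sumr; apply: eq_bigr => p _; rewrite hip_suml.
by apply: eq_bigr => p' _; rewrite coiso_KS //; apply: svalP.
Qed.

Lemma coiso_pos s : kq (@kdI R d U) (fam_adj S s) <= kq (@kdI R d Y) s.
Proof.
rewrite -subr_ge0 -(kq_KS coiso_bop) /kq kf_fs; exact: nsq_ge0.
Qed.

Local Notation pKS := (pos_kernel_KS coiso_bop coiso_pos).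

Lemma coiso_schur : schur ipU ipY S.
Proof.
split; first exact: coiso_bop.
by split; [exact: coiso_holo | apply: (pos_mult_contr coiso_bop coiso_pos)].
Qed.

Let ev_Gm x s : ev (fun l => Gm l x) s = hip x (fs s).
Proof. by rewrite /fs hip_sumr; apply: eq_bigr => p _; rewrite gsP //; apply: svalP. Qed.

Lemma coiso_Gam_bound x : rk_bound ipY (KS ipU ipY S) (fun l => Gm l x) (nsq ipX x).
Proof.
apply/(rk_boundE pKS) => s; rewrite ev_Gm /kq kf_fs -/(rip _ _) -/(nsq _ _).
have := nsq_ge0 (x - fs s); rewrite nsqB; lra.
Qed.

(** By [coiso_KS], matching [fs s] with [rk_ker s] is isometric. Its adjoint [T] sends [f] to a
    state representing [f] whose norm is no larger, so the quotient norm is attained. *)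
Lemma coiso_range f : in_rk ipY (KS ipU ipY S) f ->
  exists x, nsq ipX x <= rk_nsq ipY (KS ipU ipY S) f /\ forall l, inball l -> f l = Gm l x.
Proof.
move=> hf; pose H := rkhs pKS.
pose Gr (v : X) (w : H) := exists s, v = fs s /\ w = rk_ker pKS s.
have [T [_ TE Tn]] : exists T : H -> X, [/\ lin T,
   forall v w u, Gr v w -> hip v (T u) = hip w u & forall u, nsq ipX (T u) <= 1 * nsq (@hip R H) u].
  apply: rel_adjoint => //.
  - exists [::]; split; first by rewrite /fs big_nil.
    apply: rk_fun_inj => l b; rewrite rk_kerE // /Kt big_nil.
    by have /= -> := lin0 (@rk_fun_linl R d Y _ pKS l).
  - move=> a _ _ _ _ [s [-> ->]] [s' [-> ->]]; exists (famZ a s ++ s'); split.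
      rewrite /fs big_cat big_map scaler_sumr; congr (_ + _); apply: eq_bigr => p _ /=.
      by rewrite (linZ (adj_lin (bGm (svalP p.1)))).
    apply: rk_fun_inj => l b; rewrite rk_fun_lin !rk_kerE // -(Kt_famZ pKS) //.
    by rewrite /Kt big_cat.
  - move=> _ _ [s [-> ->]]; rewrite mul1r /nsq rk_reproducing.
    have -> : ev (rk_fun (rk_ker pKS s)) s = ev (Kt (KS ipU ipY S) s) s.
      by apply: ev_eq => l b; rewrite rk_kerE.
    by rewrite ev_Kt kf_fs.
exists (T (rk_elt pKS hf)); split.
  by have := Tn (rk_elt pKS hf); rewrite mul1r rk_nsq_elt.
move=> l b; apply: nsq_eq_hip => y; rewrite hip_sym [RHS]hip_sym; congr conjc.
pose lb : bpt R d := exist _ l b.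
rewrite gsP // [RHS]hip_sym (TE _ (rk_ker pKS [:: (lb, y)])); last first.
  by exists [:: (lb, y)]; rewrite /fs big_seq1.
by rewrite -hip_sym rk_reproducing1 rk_eltE.
Qed.

(* [Mstar] acts on [Gam x] as [A] acts on [x]: the pair [(x, Gam x)] lies in the kernel of the
   observability operator of [A (+) bshift], which is invariant. *)
Lemma coiso_Mstar f x j : in_rk ipY (@kdI R d Y) f ->
  (forall l, inball l -> f l = Gm l x) ->
  forall l, inball l -> Mstar ipY j f l = Gm l (A j x).
Proof.
move=> hf fx l b; rewrite (proj2 (MstarE j hf)) //.
pose pkd := pos_kernel_kd d Y.
pose H := HY d Y; pose XH := hprod X H.
pose AA i (p : XH) : XH := (A i p.1, bshift i p.2).
pose CC (p : XH) : Y := Cc p.1 - rk_fun p.2 pt0.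
have linAA i : lin (AA i).
  by move=> a p q; rewrite /AA /= linA (bshift_lin i).
have contrAA p : \sum_(i < d) nsq (@hip R XH) (AA i p) <= nsq (@hip R XH) p.
  rewrite nsq_pair; under eq_bigr do rewrite nsq_pair.
  by rewrite big_split /=; apply: lerD; [exact: contrA | exact: bshift_contr].
have commAA i i' (p : XH) : AA i (AA i' p) = AA i' (AA i p).
  by rewrite /AA /= commA bshift_comm.
have bCC : bop (@hip R XH) ipY CC.
  have [Mc Mc0 hMc] := bop_ge0 bC.
  have [M M0 hM] := nsq_eval_le pkd (inball0 R d).
  split.
    by move=> a p q; rewrite /CC /= (proj1 bC) rk_fun_lin; hilb_ring.
  exists (2 * Mc + 2 * M) => p; apply: (le_trans (nsqB_le2 _ _)); rewrite nsq_pair.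
  have := hMc p.1; have := hM _ (rk_fun_in p.2); rewrite -rkhs_nsq.
  have : 0 <= Mc * nsq (@hip R H) p.2 by rewrite mulr_ge0 ?nsq_ge0.
  have : 0 <= M * nsq ipX p.1 by rewrite mulr_ge0 ?nsq_ge0.
  lra.
(* For [bshift] with evaluation at 0, the observability operator is the identity on functions, by
   the Gleason identity. *)
have GamE l' (p : XH) : inball l' -> Gam AA CC l' p = Gm l' p.1 - rk_fun p.2 l'.
  move=> b'.
  have -> : Gam AA CC l' p = CC (res A l' p.1, res (@bshift R d Y) l' p.2).
    rewrite /Gam; congr CC; symmetry; apply: (res_uniq linAA contrAA b').
    have -> : ZA AA l' (res A l' p.1, res (@bshift R d Y) l' p.2) =
       (ZA A l' (res A l' p.1), ZA (@bshift R d Y) l' (res (@bshift R d Y) l' p.2)).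
      rewrite /ZA; elim/big_rec3: _ => // i x1 x2 x3 _ ->.
      by [].
    rewrite [p in RHS]surjective_pairing; congr (_, _).
      exact: (resK linA contrA).
    exact: (resK (@bshift_lin R d Y) (@bshift_contr R d Y)).
  rewrite /CC /=; congr (_ - _).
  set h := res _ _ _.
  have := bshift_gleason h b'.
  have e := resK (@bshift_lin R d Y) (@bshift_contr R d Y) p.2 b'.
  have := congr1 (fun q => rk_fun q l') e; rewrite rk_funB -/h /ZA rk_fun_sum => <-.
  under [X in _ = _ - X]eq_bigr do rewrite rk_funZ.
  by move=> <-; hilb_ring.
have k0 l' : inball l' -> Gam AA CC l' (x, rk_elt pkd hf) = 0.
  by move=> b'; rewrite GamE //= rk_eltE // fx // subrr.
have := Gam_ker_inv linAA contrAA commAA bCC j k0 b.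
by rewrite GamE //= => /eqP; rewrite subr_eq0 => /eqP.
Qed.

Lemma coiso_invariant f : in_rk ipY (KS ipU ipY S) f -> forall j,
  in_rk ipY (KS ipU ipY S) (Mstar ipY j f).
Proof.
move=> hf j; have [x [_ fx]] := coiso_range hf.
have hk := in_rk_KS_kd coiso_bop coiso_pos hf.
exists (nsq ipX (A j x)); apply: (rk_bound_eq pKS _ (coiso_Gam_bound (A j x))) => l b.
by rewrite (coiso_Mstar j hk fx b).
Qed.

(** One-sided estimates suffice: [coiso_range] gives [|x|^2 <= |f|^2], [coiso_Gam_bound] gives
    [|M_j^* f|^2 <= |A_j x|^2], and [AC_contr] joins them. *)
Lemma coiso_inequality f : in_rk ipY (KS ipU ipY S) f ->
  \sum_(j < d) rk_nsq ipY (KS ipU ipY S) (Mstar ipY j f)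
    <= rk_nsq ipY (KS ipU ipY S) f - nsq ipY (f pt0).
Proof.
move=> hf; have [x [xle fx]] := coiso_range hf.
have hk := in_rk_KS_kd coiso_bop coiso_pos hf.
have f0 : f pt0 = Cc x by rewrite fx; [exact: (Gam0 linA contrA) | exact: inball0].
have : \sum_(j < d) rk_nsq ipY (KS ipU ipY S) (Mstar ipY j f) <= \sum_(j < d) nsq ipX (A j x).
  apply: ler_sum => j _; apply: rk_nsq_le.
  apply: (rk_bound_eq pKS _ (coiso_Gam_bound (A j x))) => l b.
  by rewrite (coiso_Mstar j hk fx b).
by rewrite f0; have := AC_contr x; lra.
Qed.

End CoisometricColligation.

(** * Extending and restricting the input space *)

Lemma ccr_extension (R : realType) (d : nat) (U Y : hilb R) (S : pt R d -> U -> Y) :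
  has_ccr S -> exists (F : hilb R) (St : pt R d -> F -> Y),
  let Sh : pt R d -> hprod U F -> Y := fun l p => S l p.1 + St l p.2 in
  let KSh := KS (@hip R (hprod U F)) (@hip R Y) Sh in
  schur (@hip R (hprod U F)) (@hip R Y) Sh /\
  (forall f, in_rk (@hip R Y) KSh f -> forall j, in_rk (@hip R Y) KSh (Mstar (@hip R Y) j f)) /\
  (forall f, in_rk (@hip R Y) KSh f ->
     \sum_(j < d) rk_nsq (@hip R Y) KSh (Mstar (@hip R Y) j f)
       <= rk_nsq (@hip R Y) KSh f - nsq (@hip R Y) (f pt0)).
Proof.
move=> [X [A [B [Cc [D [bA [bB [bC [bD [contr [commA real]]]]]]]]]]].
pose G := hprod (hpow d X) Y.
have linA j : lin (A j) by case: (bA j).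
have linC : lin Cc by case: bC.
have linD_ : lin D by case: bD.
have AC_contr x : \sum_(j < d) nsq (@hip R X) (A j x) + nsq (@hip R Y) (Cc x) <= nsq (@hip R X) x.
  have := contr x 0; rewrite nsq0 addr0 (lin0 linD_) addr0.
  by under eq_bigr do rewrite (lin0 (proj1 (bB _))) addr0.
have contrA x : \sum_(j < d) nsq (@hip R X) (A j x) <= nsq (@hip R X) x.
  by apply: le_trans (AC_contr x); rewrite lerDl nsq_ge0.
pose V (p : hprod X U) : G := ([ffun j => A j p.1 + B j p.2], Cc p.1 + D p.2).
have V_lin : lin V.
  move=> a p q; apply: (@injective_projections _ _ (V (a *: p + q)) (a *: V p + V q)) => /=.
    by apply/ffunP => j; rewrite !ffunE linA (proj1 (bB j)); hilb_ring.
  by rewrite linC linD_; hilb_ring.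
have V_contr p : nsq (@hip R G) (V p) <= nsq (@hip R (hprod X U)) p.
  rewrite !nsq_pair nsq_pw /=; under eq_bigr do rewrite ffunE.
  exact: contr.
have V_bop : bop (@hip R (hprod X U)) (@hip R G) V by split=> //; exists 1 => p; rewrite mul1r.
pose W := adj (@hip R (hprod X U)) (@hip R G) V.
have W_lin : lin W := adj_lin V_bop.
have W_contr g : nsq (@hip R (hprod X U)) (W g) <= nsq (@hip R G) g.
  by rewrite -[X in _ <= X]mul1r; apply: adj_bound => // p; rewrite mul1r.
have [F [tau [tau_lin tauE]]] := defect_space W_lin W_contr.
have tau_bop : bop (@hip R G) (@hip R F) tau.
  split=> //; exists 1 => g; rewrite mul1r /nsq tauE ReB lerBlDr lerDl; exact: nsq_ge0.
(* [ts ts^* = tau^* tau = 1 - V V^*]; the components of [ts] are the new columns added to [B] and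
   [D]. *)
pose ts := adj (@hip R G) (@hip R F) tau.
have ts_lin : lin ts := adj_lin tau_bop.
have tsP g f : hip (ts f) g = hip f (tau g).
  by rewrite hip_sym -(adjP tau_bop) -hip_sym.
have ts_bd f : nsq (@hip R G) (ts f) <= 1 * nsq (@hip R F) f.
  apply: adj_bound => // g; rewrite mul1r /nsq tauE ReB lerBlDr lerDl; exact: nsq_ge0.
pose B' j (p : hprod U F) : X := B j p.1 + (ts p.2).1 j.
pose D' (p : hprod U F) : Y := D p.1 + (ts p.2).2.
pose Gm := Gam A Cc.
pose St l f : Y := (ts f).2 + Gm l (\sum_(j < d) l j *: (ts f).1 j).
exists F, St; move=> Sh KSh.
have fst_bop : bop (@hip R (hprod U F)) (@hip R U) (fun p => p.1).
  by split=> //; exists 1 => p; rewrite mul1r nsq_pair lerDl nsq_ge0.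
have snd_bop : bop (@hip R (hprod U F)) (@hip R F) (fun p => p.2).
  by split=> //; exists 1 => p; rewrite mul1r nsq_pair lerDr nsq_ge0.
have bB' j : bop (@hip R (hprod U F)) (@hip R X) (B' j).
  apply: bopD; first exact: (bop_comp fst_bop (bB j)).
  apply: (bop_comp snd_bop (T' := fun f => (ts f).1 j)).
  split; first by move=> a x y; rewrite ts_lin /= !ffunE.
  exists 1 => f; apply: le_trans (ts_bd f); rewrite nsq_pair.
  by apply: (le_trans (nsq_pw_ge (ts f).1 j)); rewrite lerDl nsq_ge0.
have bD' : bop (@hip R (hprod U F)) (@hip R Y) D'.
  apply: bopD; first exact: (bop_comp fst_bop bD).
  apply: (bop_comp snd_bop (T' := fun f => (ts f).2)).
  split; first by move=> a x y; rewrite ts_lin.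
  by exists 1 => f; apply: le_trans (ts_bd f); rewrite nsq_pair lerDr nsq_ge0.
have SE l p : inball l -> Sh l p = D' p + Gm l (\sum_(j < d) l j *: B' j p).
  move=> b; rewrite /Sh; have [_ /(_ p.1)[x [xE ->]]] := real l b.
  have -> : \sum_(j < d) l j *: B' j p =
      \sum_(j < d) l j *: B j p.1 + \sum_(j < d) l j *: (ts p.2).1 j.
    by rewrite -big_split; apply: eq_bigr => j _; rewrite scalerDr.
  rewrite /D' /St /Gm (linD (Gam_lin linA contrA bC b)) -/Gm.
  have -> : Gm l (\sum_(j < d) l j *: B j p.1) = Cc x.
    by rewrite /Gm /Gam -(res_uniq linA contrA b xE).
  by hilb_ring.
have coiso (w w' : 'I_d -> X) (y y' : Y) (a a' : X) (u u' : hprod U F) :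
    (forall x v, \sum_(j < d) hip (A j x + B' j v) (w j) + hip (Cc x + D' v) y = hip x a + hip v u) ->
    (forall x v, \sum_(j < d) hip (A j x + B' j v) (w' j) + hip (Cc x + D' v) y' = hip x a' + hip v u') ->
    hip a a' + hip u u' = \sum_(j < d) hip (w j) (w' j) + hip y y'.
  (* Adjoint vectors are unique: tests with zero [F]-input identify the [X] and [U] parts with [W],
     tests with [F]-input alone identify the [F] part with [tau]. Isometry is then [tauE]. *)
  have rep (w0 : 'I_d -> X) (y0 : Y) (a0 : X) (u0 : hprod U F) :
    (forall x v, \sum_(j < d) hip (A j x + B' j v) (w0 j) + hip (Cc x + D' v) y0 = hip x a0 + hip v u0) ->
    W ([ffun j => w0 j], y0) = (a0, u0.1) /\ tau ([ffun j => w0 j], y0) = u0.2.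
    move=> h.
    have hp (v1 : U) (v2 : F) : hip ((v1, v2) : hprod U F) u0 = hip v1 u0.1 + hip v2 u0.2 by [].
    split.
      apply: (adj_uniq V_bop) => p.
      have := h p.1 (p.2, 0); rewrite hp hip0l addr0.
      move=> e; rewrite -[RHS]/(hip p.1 a0 + hip p.2 u0.1) -e.
      congr (_ + _); last by rewrite /D' /= (lin0 ts_lin) addr0.
      by apply: eq_bigr => j _; rewrite !ffunE /B' /= (lin0 ts_lin) ffunE addr0.
    apply: nsq_eq_hip => f; rewrite -tsP.
    have := h 0 (0, f); rewrite hp !hip0l !add0r => <-.
    congr (_ + _); last by rewrite /D' /= (lin0 linC) (lin0 linD_) !add0r.
    apply: eq_bigr => j _.
    by rewrite !ffunE /B' /= (lin0 (linA j)) (lin0 (proj1 (bB j))) !add0r.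
  move=> /rep[Wg tg] /rep[Wg' tg'].
  have := tauE ([ffun j => w j], y) ([ffun j => w' j], y'); rewrite Wg tg Wg' tg' => e.
  have -> : \sum_(j < d) hip (w j) (w' j) + hip y y' =
      hip (([ffun j => w j], y) : G) ([ffun j => w' j], y').
    by congr (_ + _); apply: eq_bigr => j _; rewrite !ffunE.
  rewrite -[hip u u']/(hip u.1 u'.1 + hip u.2 u'.2) e.
  have -> : hip ((a, u.1) : hprod X U) (a', u'.1) = hip a a' + hip u.1 u'.1 by [].
  by ring.
split; first exact: (coiso_schur linA bB' bC bD' AC_contr SE coiso).
split; first exact: (coiso_invariant linA bB' bC bD' AC_contr commA SE coiso).
exact: (coiso_inequality linA bB' bC bD' AC_contr commA SE coiso).
Qed.

(** [St] carries no linearity hypothesis; its vanishing at 0 is what lets [S] be read off on the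
    inputs [(u, 0)]. *)
Lemma ccr_restriction (R : realType) (d : nat) (U F Y : hilb R) (S : pt R d -> U -> Y)
  (St : pt R d -> F -> Y) : (forall l, inball l -> St l 0 = 0) ->
  has_ccr (fun l (p : hprod U F) => S l p.1 + St l p.2) -> has_ccr S.
Proof.
move=> St0 [X [A [B [Cc [D [bA [bB [bC [bD [contr [commA real]]]]]]]]]]].
have inl_bop : bop (@hip R U) (@hip R (hprod U F)) (fun u => (u, 0)).
  split; first by move=> a x y; apply: injective_projections => //=; rewrite scaler0 addr0.
  by exists 1 => u; rewrite mul1r nsq_pair /= nsq0 addr0.
exists X, A, (fun j u => B j (u, 0)), Cc, (fun u => D (u, 0)).
split; first exact: bA.
split; first by move=> j; apply: (bop_comp inl_bop (bB j)).
split; first exact: bC.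
split; first exact: (bop_comp inl_bop bD).
split.
  by move=> x u; have := contr x (u, 0); rewrite [nsq _ (u, 0)]nsq_pair /= nsq0 addr0.
split; first exact: commA.
move=> l b; have [inj ex] := real l b; split=> // u.
have [x [xE e]] := ex (u, 0); exists x; split=> //.
by rewrite -e /= St0 // addr0.
Qed.

Theorem theorem3p10 (R : realType) (d : nat) (U Y : hilb R) (S : pt R d -> U -> Y) :
  schur (@hip R U) (@hip R Y) S ->
  (has_ccr S <->
   exists (F : hilb R) (St : pt R d -> F -> Y),
     let Sh := fun (l : pt R d) (p : (U * F)%type) => S l p.1 + St l p.2 in
     let KSh := KS (ipsum (@hip R U) (@hip R F)) (@hip R Y) Sh in
     schur (ipsum (@hip R U) (@hip R F)) (@hip R Y) Sh /\
     (forall f : pt R d -> Y, in_rk (@hip R Y) KSh f ->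
        forall j : 'I_d, in_rk (@hip R Y) KSh (Mstar (@hip R Y) j f)) /\
     (forall f : pt R d -> Y, in_rk (@hip R Y) KSh f ->
        \sum_(j < d) rk_nsq (@hip R Y) KSh (Mstar (@hip R Y) j f)
          <= rk_nsq (@hip R Y) KSh f - nsq (@hip R Y) (f pt0))).
Proof.
(* [hprod U F] unfolds to the carrier [U * F] with form [ipsum], so the lemmas match the statement
   by conversion. *)
move=> [bS _]; split; first exact: ccr_extension.
move=> [F [St [[bSh [_ mc]] [inv ineq]]]].
apply: (@ccr_restriction R d U F Y S St).
  (* Linearity of [S l] and of the sum with [St l] forces [St l 0 = 0]. *)
  move=> l b; have [linS _] := bS l b; have [linSh _] := bSh l b.
  by have := lin0 linSh; rewrite /= (lin0 linS) add0r.
exact: (@functional_model R d (hprod U F) Y (fun l p => S l p.1 + St l p.2) bSh mc inv ineq).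
Qed.
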